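(* Let $H_1:\mathcal{L}_2^n\to\mathcal{L}_2^n$ be a causal LTI system with frequency response $H_1(j\omega)\in\mathbb{C}^{n\times n}$ and $H_2:\mathcal{L}_2^n\to\mathcal{L}_2^n$ a causal nonlinear system. Let $M=M^\top\in\mathbb{R}^{m\times m}$ and let $N$ be a causal, bounded LTI system from $\mathcal{L}_2^{2n}$ to $\mathcal{L}_2^m$ with frequency response $N(j\omega)$. Suppose that for every $\mu\in(0,1]$ the feedback interconnection $u_1=w+y_2$, $u_2=y_1$, $y_1=H_1u_1$, $y_2=\mu H_2 u_2$ is well-posed, and that $\mu H_2$ satisfies the soft incremental IQC with multipliers $(M,N)$. Let $\mathbf{\Pi}(M,N)$ be the set of all symmetric $\Pi\in\mathbb{R}^{2\times2}$ for which there exists $\tau>0$ with $$\begin{bmatrix} I \\ N(j\omega)\end{bmatrix}^*\begin{bmatrix}\Pi\otimes I_n & 0\\ 0 & -\tau M\end{bmatrix}\begin{bmatrix} I\\ N(j\omega)\end{bmatrix}\succeq 0\quad\text{for all }\omega\in\mathbb{R},$$ and let $$\mathcal{C}(M,N)=\bigcap_{\Pi\in\mathbf{\Pi}(M,N)}\left\{z\in\mathbb{C}\ \middle|\ \begin{bmatrix} z\\1\end{bmatrix}^*\Pi\begin{bmatrix} z\\1\end{bmatrix}\ge 0\right\}.$$ If there exists $r>0$ such that $\mathrm{dist}\big(\mathrm{SRG}(H_1(j\omega)),\ \mu\,\mathcal{C}(M,N)\big)\ge r$ for all $\mu\in(0,1]$ and all $\omega\in\mathbb{R}$, then the closed-loop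 map $T:w\mapsto y_1$ satisfies $\|T\|_\Delta<\infty$.
   Context: $\mathcal{L}_2^n$ is the space of square-integrable signals $[0,\infty)\to\mathbb{R}^n$ with inner product $\langle u,y\rangle=\int_0^\infty u^\top y\,dt$ and norm $\|u\|=\sqrt{\langle u,u\rangle}$; $\mathcal{L}_{2e}^n$ its extended space (signals whose truncations to $[0,T]$ are in $\mathcal{L}_2^n$ for all $T$). Well-posedness of the interconnection means that the map $u_1\mapsto w$ has a causal inverse on $\mathcal{L}_{2e}^n$; external inputs $w\in\mathcal{L}_2^n$. The incremental gain of a system $T$ is $\|T\|_\Delta=\sup\{\|Tu-Tv\|/\|u-v\|: u,v\in\mathcal{L}_2^n, u\ne v\}$. $G(H)=\{(u,Hu): u\in\mathcal{L}_2^n, Hu\in\mathcal{L}_2^n\}$. A system $H$ satisfies the soft incremental IQC with multipliers $(M,N)$ if $\int_0^\infty (N[\Delta u;\Delta y])^\top(t)\,M\,(N[\Delta u;\Delta y])(t)\,dt\ge 0$ for all $(u_1,y_1),(u_2,y_2)\in G(H)$, where $\Delta u=u_1-u_2$, $\Delta y=y_1-y_2$. For $u,y\in\mathbb{C}^n$ with $u\neq 0$, $\rho(u,y)=\|y\|/\|u\|$ and $\theta(u,y)=\arccos\frac{\mathrm{Re}\,u^*y}{\|u\|\|y\|}$ (set to $0$ if $y=0$). The frequency-wise SRG is $\mathrm{SRG}(H_1(j\omega))=\{\rho(u,H_1(j\omega)u)e^{\pm j\theta(u,H_1(j\omega)u)}\mid 0\ne u\in\mathbb{C}^n\}$. For sets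 $S_1,S_2\subseteq\mathbb{C}$, $\mathrm{dist}(S_1,S_2)=\inf_{a\in S_1,b\in S_2}|a-b|$, and $\mu\mathcal{C}=\{\mu z: z\in\mathcal{C}\}$. *)

(* Defs.v *)
From HB Require Import structures.
From mathcomp Require Import all_boot all_order all_algebra.
From mathcomp Require Import all_classical all_reals all_analysis.
From mathcomp.real_closed Require Import complex.
Set Implicit Arguments. Unset Strict Implicit. Unset Printing Implicit Defensive.
Import Order.TTheory GRing.Theory Num.Theory.
Import numFieldNormedType.Exports.
Local Open Scope classical_set_scope.
Local Open Scope ring_scope.

Section Defs.
Variable R : realType.
Local Notation mu := (@lebesgue_measure R).
Local Notation C := (R[i]).
Local Notation cre := (@complex.Re R).
Local Notation cim := (@complex.Im R).
Local Notation Rp := (`[(0:R), +oo[%classic : set R).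
Local Notation Icc T := (`[(0:R), T]%classic : set R).

(* A signal [0,oo) -> R^n, modelled as a function on R whose values for t < 0
   are irrelevant. *)
Definition signal (n : nat) := R -> 'I_n -> R.
Definition system (n m : nat) := signal n -> signal m.

Definition sigeq n (u v : signal n) := forall t, 0 <= t -> u t = v t.

Definition sadd n (u v : signal n) : signal n := fun t i => u t i + v t i.
Definition ssub n (u v : signal n) : signal n := fun t i => u t i - v t i.
Definition sscale n (a : R) (u : signal n) : signal n := fun t i => a * u t i.
Definition sstack n (u y : signal n) : signal (n + n) :=
  fun t i => match fintype.split i with inl j => u t j | inr j => y t j end.
Definition trunc n (T : R) (u : signal n) : signal n :=
  fun t i => if t <= T then u t i else 0.

Definition inL2 n (u : signal n) : Prop :=
  forall i, measurable_fun Rp (fun t => u t i) /\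
    (\int[mu]_(t in Rp) ((u t i) ^+ 2)%:E < +oo)%E.
Definition L2norm n (u : signal n) : R :=
  Num.sqrt (\sum_(i < n) fine (\int[mu]_(t in Rp) ((u t i) ^+ 2)%:E)).
Definition inL2e n (u : signal n) : Prop := forall T, inL2 (trunc T u).

Definition causal n m (H : system n m) : Prop :=
  forall (T : R) (u v : signal n),
    (forall t, 0 <= t <= T -> u t = v t) ->
    forall t, 0 <= t <= T -> H u t = H v t.

Definition maps_L2 n m (H : system n m) : Prop :=
  forall u, inL2 u -> inL2 (H u).

Definition bounded n m (H : system n m) : Prop :=
  maps_L2 H /\ exists c : R, forall u, inL2 u -> L2norm (H u) <= c * L2norm u.

(* Fourier transform on L_2 (Plancherel): U is the L_2(R)-limit, as T -> oo,
   of  w |-> \int_0^T u(t) e^{-j w t} dt. *)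
Definition FT_re n (u : signal n) (i : 'I_n) (T w : R) : R :=
  Rintegral mu (Icc T) (fun t => u t i * cos (w * t)).
Definition FT_im n (u : signal n) (i : 'I_n) (T w : R) : R :=
  - Rintegral mu (Icc T) (fun t => u t i * sin (w * t)).
Definition is_FT n (u : signal n) (U : R -> 'I_n -> C) : Prop :=
  forall i, measurable_fun setT (fun w => cre (U w i)) /\
    measurable_fun setT (fun w => cim (U w i)) /\
    (((\int[mu]_(w in setT)
        (((FT_re u i T w - cre (U w i)) ^+ 2
          + (FT_im u i T w - cim (U w i)) ^+ 2)%:E)) @[T --> +oo%R] --> 0)%E).

Definition freq_resp n m (H : system n m) (G : R -> 'M[C]_(m, n)) : Prop :=
  forall u, inL2 u -> forall U Y, is_FT u U -> is_FT (H u) Y ->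
    {ae mu, forall w, forall i, Y w i = \sum_(j < n) G w i j * U w j}.

Definition causal_LTI n m (H : system n m) (G : R -> 'M[C]_(m, n)) : Prop :=
  causal H /\ maps_L2 H /\ freq_resp H G.

(* well-posedness of u1 = w + mu H2 (H1 u1): the map u1 |-> w has a causal
   inverse on L_2e *)
Definition wellposed n (H1 H2 : system n n) (m : R) : Prop :=
  let F := fun u1 => ssub u1 (sscale m (H2 (H1 u1))) in
  exists S : system n n, causal S /\
    (forall w, inL2e w -> inL2e (S w) /\ sigeq (F (S w)) w) /\
    (forall u1, inL2e u1 -> inL2e (F u1) /\ sigeq (S (F u1)) u1).

Definition inc_IQC n k (H : system n n) (M : 'M[R]_k) (N : system (n + n) k) :=
  forall u1 u2, inL2 u1 -> inL2 (H u1) -> inL2 u2 -> inL2 (H u2) ->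
    let z := N (sstack (ssub u1 u2) (ssub (H u1) (H u2))) in
    (0 <= \int[mu]_(t in Rp)
             (\sum_(i < k) \sum_(j < k) z t i * M i j * z t j)%:E)%E.

Definition ctrans p q (A : 'M[C]_(p, q)) : 'M[C]_(q, p) := (map_mx conjc A)^T.
Definition cmx p q (A : 'M[R]_(p, q)) : 'M[C]_(p, q) := map_mx (real_complex R) A.
Definition psd p (A : 'M[C]_p) : Prop := forall x : 'cV[C]_p, 0 <= (ctrans x *m A *m x) 0 0.

Definition kronI2 n (P : 'M[R]_2) : 'M[R]_(n + n) :=
  block_mx (P 0 0 *: 1%:M) (P 0 1 *: 1%:M) (P 1 0 *: 1%:M) (P 1 1 *: 1%:M).

Definition PiSet n k (M : 'M[R]_k) (Nf : R -> 'M[C]_(k, n + n)) : set 'M[R]_2 :=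
  [set P | P^T = P /\ exists tau : R, 0 < tau /\ forall w : R,
     let S := col_mx (1%:M : 'M[C]_(n + n)) (Nf w) in
     psd (ctrans S *m cmx (block_mx (kronI2 n P) 0 0 (- tau *: M)) *m S)].

Definition vz (z : C) : 'cV[C]_2 := \col_(i < 2) (if i == 0 then z else 1).

Definition CSet n k (M : 'M[R]_k) (Nf : R -> 'M[C]_(k, n + n)) : set C :=
  [set z | forall P, PiSet M Nf P -> 0 <= (ctrans (vz z) *m cmx P *m vz z) 0 0].

Definition cnorm (z : C) : R := Num.sqrt (cre z ^+ 2 + cim z ^+ 2).
Definition vnorm p (x : 'cV[C]_p) : R := Num.sqrt (\sum_(i < p) cnorm (x i 0) ^+ 2).

Definition rho p (u y : 'cV[C]_p) : R := vnorm y / vnorm u.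
Definition theta p (u y : 'cV[C]_p) : R :=
  if y == 0 then 0 else acos (cre ((ctrans u *m y) 0 0) / (vnorm u * vnorm y)).

Definition SRG p (A : 'M[C]_p) : set C :=
  [set z | exists u : 'cV[C]_p, u != 0 /\
     (z = Complex (rho u (A *m u) * cos (theta u (A *m u)))
                  (rho u (A *m u) * sin (theta u (A *m u))) \/
      z = Complex (rho u (A *m u) * cos (theta u (A *m u)))
                  (- (rho u (A *m u) * sin (theta u (A *m u)))))].

Definition scale_set (m : R) (S : set C) : set C := [set real_complex R m * z | z in S].

Definition dist_ge (S1 S2 : set C) (r : R) : Prop :=
  forall a b, S1 a -> S2 b -> r <= cnorm (a - b).

End Defs.

(* Main.v *)
(** Write sigma(p, q) for the integral of (N [p; q])^T M (N [p; q]) and split it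
    into blocks, sigma(p, q) = suu p + 2 b(p, q) + syy q. Letting the gain of
    the nonlinearity tend to 0 in the IQC gives suu >= 0, and b(p, q) >= 0 for an
    input increment p of H2 and the corresponding output increment q as soon as
    suu p <= 0.

    A point z at distance less than r from SRG(H1(jw)) satisfies l z \notin C(M, N)
    for every l >= 1, so some Pi in Pi(M, N) is negative at l z, while by
    Plancherel the form of Pi dominates sigma. For one fixed nonreal z this forces
    suu = 0 and shows that |b(u, u)| >= eta ||u||^2, or else that b vanishes and
    syy is negative (off null functions). For z = z(w) + a with z(w) in the SRG,
    |a| < r and l -> oo it gives b(H1 u, u) <= - (r / 2) |b(u, u)|.

    So -b(H1 u, u) is coercive when b does not vanish. Let d be the truncation to
    [0, T] of the difference of two loop signals u1. Lax-Milgram on L2(T, oo)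
    yields g supported after T with b(H1 (d + g), h) = 0 for all h supported
    after T. The input d + g of H1 leads, by causality, to an output increment of
    H2 equal to d minus the difference of the external inputs on [0, T], and what
    it does after T is invisible to b(H1 (d + g), .); hence b >= 0 on this
    increment bounds ||d + g||, and therefore ||d||, independently of T. *)

From HB Require Import structures.
From mathcomp Require Import all_boot all_order all_algebra.
From mathcomp Require Import all_classical all_reals all_analysis.
From mathcomp Require Import measurable_realfun.
From mathcomp.real_closed Require Import complex.
From mathcomp Require Import ring lra.
Require Import Defs.
Set Implicit Arguments. Unset Strict Implicit. Unset Printing Implicit Defensive.
Import Order.TTheory GRing.Theory Num.Theory.
Import numFieldNormedType.Exports.
Local Open Scope classical_set_scope.
Local Open Scope ring_scope.

(** * Spaces with a semi-inner product: projection, Riesz, Lax-Milgram, uniform boundedness *)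

Section SemiHilbert.
Variable R : realType.

(** The IQC is soft: an inequality over the whole half-line, available only for square-integrable
    pairs, while a loop signal is controlled only up to time T. The output of H2 cannot be cut off
    at T, so the input is continued instead; coercivity is what makes the required continuation
    solvable.

    The multipliers attached to the points l z change with l and come without any bound. What
    controls them is that z is not real: with kap = |Re z| / |z| < 1, the off-diagonal entry B of
    the rescaled multiplier satisfies |B ip(p, q) - b(p, q)| <= kap |B| + O(1 / l) on unit vectors.
    One B serves all vectors, so the values of b at different vectors become comparable.

    The frequency response is the only access to H1 and N, and it concerns transforms, almost
    everywhere. Plancherel is therefore built first; linearity, insensitivity to null functions and
    continuity of the operators are then derived on the frequency side. Signals stay functions, so
    the norm is a seminorm and uniqueness holds only up to null vectors. *)

Definition bilinear_form (V W : lmodType R) (a : V -> W -> R) :=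
  [/\ forall x x' y, a (x + x') y = a x y + a x' y,
      forall x y y', a x (y + y') = a x y + a x y',
      forall c x y, a (c *: x) y = c * a x y
    & forall c x y, a x (c *: y) = c * a x y].

Definition semi_inner (V : lmodType R) (a : V -> V -> R) :=
  [/\ bilinear_form a, forall x y, a x y = a y x & forall x, 0 <= a x x].

Lemma bilinear_formNl (V W : lmodType R) (a : V -> W -> R) x y :
  bilinear_form a -> a (- x) y = - a x y.
Proof. by move=> [_ _ aZ _]; rewrite -scaleN1r aZ mulN1r. Qed.

Lemma bilinear_formNr (V W : lmodType R) (a : V -> W -> R) x y :
  bilinear_form a -> a x (- y) = - a x y.
Proof. by move=> [_ _ _ aZ]; rewrite -scaleN1r aZ mulN1r. Qed.

Lemma bilinear_form0l (V W : lmodType R) (a : V -> W -> R) y :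
  bilinear_form a -> a 0 y = 0.
Proof. by move=> [_ _ aZ _]; rewrite -(scale0r 0) aZ mul0r. Qed.

Lemma bilinear_form0r (V W : lmodType R) (a : V -> W -> R) x :
  bilinear_form a -> a x 0 = 0.
Proof. by move=> [_ _ _ aZ]; rewrite -(scale0r 0) aZ mul0r. Qed.

(** The discriminant criterion with [A = 0] allowed, since the forms below are only semidefinite;
    there it says that the linear term vanishes. With [c = 0] it is the first-order condition
    [b = 0]. *)
Lemma quad_ge0P (A b c : R) :
  (forall s, 0 <= A * s ^+ 2 + 2 * b * s + c) ->
  [/\ 0 <= A, 0 <= c & b ^+ 2 <= A * c].
Proof.
move=> h.
have c0 : 0 <= c by have := h 0; nra.
have [A0|A0] := leP 0 A; last first.
  have : 0 < - A by rewrite oppr_gt0.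
  move=> A0'; exfalso.
  (* Chosen so that [- A * s = - A + 2 |b| + c] and [s >= 1]; then [- A * s ^+ 2] exceeds
     [2 |b| s + c], and the polynomial is negative at [s] and at [- s]. *)
  pose s := 1 + 2 * `|b| / (- A) + c / (- A).
  have h1 := h s; have h2 := h (- s).
  have s1 : 1 <= s.
    rewrite /s -addrA lerDl; apply: addr_ge0; apply: divr_ge0 => //; rewrite ?mulr_ge0 //; lra.
  have e : (- A) * s = - A + 2 * `|b| + c.
    by rewrite /s; field; rewrite lt_eqF.
  have b0 := normr_ge0 b.
  have : (- A) * s * 1 <= (- A) * s * s by rewrite ler_pM2l// e; lra.
  rewrite {1}e; nra.
split=> //.
have [Az|An] := eqVneq A 0.
  rewrite Az mul0r in h *.
  have h1 := h (- (c + 1) * b); rewrite mul0r add0r in h1.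
  have [b0|b0] := eqVneq b 0; first by rewrite b0 expr0n.
  exfalso.
  have bp : 0 < b ^+ 2 by rewrite exprn_even_gt0.
  (* The affine function [2 b s + c] takes the value -1 there. *)
  have := h (- (c + 1) / (2 * b)).
  rewrite mul0r add0r.
  have -> : 2 * b * (- (c + 1) / (2 * b)) = - (c + 1) by field.
  lra.
have Ap : 0 < A by rewrite lt_neqAle eq_sym An.
have := h (- b / A).
have -> : A * (- b / A) ^+ 2 + 2 * b * (- b / A) + c = (A * c - b ^+ 2) / A by field.
by rewrite pmulr_lge0 ?invr_gt0// subr_ge0.
Qed.

Definition invS (n : nat) : R := n.+1%:R^-1.

Lemma invS_gt0 n : 0 < invS n. Proof. by rewrite invr_gt0. Qed.

Lemma near_invS_lt (e : R) : 0 < e ->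
  exists K, forall n, (K <= n)%N -> invS n < e.
Proof.
move=> e0; have [K] := ltr_add_invr e0; rewrite add0r => Ke; exists K => n Kn.
by apply: le_lt_trans Ke; rewrite /invS lef_pV2 ?posrE ?ler_nat.
Qed.

Section SemiInner.
Variables (V : lmodType R) (ip : V -> V -> R).
Hypothesis ipP : semi_inner ip.

Let ipDl x x' y : ip (x + x') y = ip x y + ip x' y. Proof. by case: ipP => -[]. Qed.
Let ipDr x y y' : ip x (y + y') = ip x y + ip x y'. Proof. by case: ipP => -[]. Qed.
Let ipZl c x y : ip (c *: x) y = c * ip x y. Proof. by case: ipP => -[]. Qed.
Let ipZr c x y : ip x (c *: y) = c * ip x y. Proof. by case: ipP => -[]. Qed.
Let ipC x y : ip x y = ip y x. Proof. by case: ipP. Qed.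
Let ip_ge0 x : 0 <= ip x x. Proof. by case: ipP. Qed.
Let ipNl x y : ip (- x) y = - ip x y. Proof. by apply: bilinear_formNl; case: ipP. Qed.
Let ipNr x y : ip x (- y) = - ip x y. Proof. by apply: bilinear_formNr; case: ipP. Qed.
Let ipE := (ipDl, ipDr, ipZl, ipZr, ipNl, ipNr).

Lemma cauchy_schwarz_sqr x y : ip x y ^+ 2 <= ip x x * ip y y.
Proof.
have [] // := @quad_ge0P (ip x x) (ip x y) (ip y y).
move=> s; have := ip_ge0 (s *: x + y); rewrite !ipE (ipC y x); nra.
Qed.

Definition hnorm x := Num.sqrt (ip x x).

Lemma hnorm_ge0 x : 0 <= hnorm x. Proof. exact: sqrtr_ge0. Qed.

Lemma sqr_hnorm x : hnorm x ^+ 2 = ip x x.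
Proof. by rewrite sqr_sqrtr. Qed.

Lemma cauchy_schwarz x y : `|ip x y| <= hnorm x * hnorm y.
Proof.
rewrite -(@ler_pXn2r _ 2) ?nnegrE ?mulr_ge0 ?hnorm_ge0//.
by rewrite real_normK ?num_real// exprMn !sqr_hnorm cauchy_schwarz_sqr.
Qed.

Lemma hnormD x y : hnorm (x + y) <= hnorm x + hnorm y.
Proof.
rewrite -(@ler_pXn2r _ 2) ?nnegrE ?addr_ge0 ?hnorm_ge0// sqrrD !sqr_hnorm !ipE (ipC y x).
have := cauchy_schwarz x y; have := ler_norm (ip x y); lra.
Qed.

Lemma hnormZ c x : hnorm (c *: x) = `|c| * hnorm x.
Proof.
by rewrite /hnorm ipZl ipZr mulrA -expr2 sqrtrM ?sqr_ge0// sqrtr_sqr.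
Qed.

Lemma hnormN x : hnorm (- x) = hnorm x.
Proof. by rewrite /hnorm ipNl ipNr opprK. Qed.

Lemma hnormB x y : hnorm (x - y) = hnorm (y - x).
Proof. by rewrite -hnormN opprB. Qed.

Lemma hnorm_triangle z x y : hnorm (x - y) <= hnorm (x - z) + hnorm (z - y).
Proof. by have := hnormD (x - z) (z - y); rewrite addrA subrK. Qed.

Lemma hnorm0 : hnorm 0 = 0.
Proof. by rewrite -(scale0r 0) hnormZ normr0 mul0r. Qed.

Lemma hnorm_eq0 x : ip x x = 0 -> hnorm x = 0.
Proof. by rewrite /hnorm => ->; rewrite sqrtr0. Qed.

Lemma ip_null x y : ip x x = 0 -> ip x y = 0.
Proof.
move=> x0; have := cauchy_schwarz_sqr x y.
rewrite x0 mul0r => h; apply/eqP; rewrite -sqrf_eq0 eq_le h; exact: sqr_ge0.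
Qed.

Definition complete := forall u : nat -> V,
  (forall e : R, 0 < e -> exists N, forall m n, (N <= m)%N -> (N <= n)%N -> hnorm (u m - u n) < e) ->
  exists x, forall e : R, 0 < e -> exists N, forall n, (N <= n)%N -> hnorm (u n - x) < e.

Definition subspace (N : V -> Prop) := N 0 /\ forall c x y, N x -> N y -> N (c *: x + y).

Definition hclosed (N : V -> Prop) :=
  forall x, (forall e : R, 0 < e -> exists2 y, N y & hnorm (x - y) < e) -> N x.

Hypothesis ip_complete : complete.

(** A minimising sequence for the distance to [N] is Cauchy by the parallelogram law; its limit
    attains the distance, and the first variation in the direction [z] gives orthogonality. *)
Lemma hprojection (N : V -> Prop) : subspace N -> hclosed N -> forall x,
  exists2 y, N y & forall z, N z -> ip (x - y) z = 0.
Proof.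
move=> [N0 NL] Nc x.
pose E := [set ip (x - y) (x - y) | y in [set y | N y]]%classic.
have E0 : has_inf E.
  split; first by exists (ip (x - 0) (x - 0)), 0.
  by exists 0 => _ [y _ <-].
pose d := inf E.
have dle y : N y -> d <= ip (x - y) (x - y).
  by move=> Ny; apply: ge_inf; [case: E0|exists y].
have dapp k : exists y, N y /\ ip (x - y) (x - y) < d + invS k.
  have [_ [y Ny <-] h] := @inf_adherent _ E (invS k) (invS_gt0 k) E0.
  by exists y.
have [u uP] := choice dapp.
have mid y z : N y -> N z -> N (2^-1 *: (y + z)).
  move=> Ny Nz; rewrite scalerDr; apply: (NL) => //.
  by rewrite -[X in N X]addr0; apply: NL.
(* The midpoint of [u m] and [u n] lies in [N], hence at squared distance at least [d] from [x]; the
   parallelogram identity turns this into a bound on the gap. *)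
have par m n : ip (u m - u n) (u m - u n) <= 2 * (invS m + invS n).
  have [Nm hm] := uP m; have [Nn hn] := uP n.
  have := dle _ (mid _ _ Nm Nn).
  move: hm hn; rewrite !ipE !(ipC x _) (ipC (u n) (u m)).
  move: (ip (u m) x) (ip (u n) x) (ip (u m) (u n)) (ip (u m) (u m)) (ip (u n) (u n)) (ip x x) (invS m) (invS n) => *; lra.
have [x0 x0P] : exists y, forall e : R, 0 < e -> exists K, forall n, (K <= n)%N -> hnorm (u n - y) < e.
  apply: ip_complete => e e0.
  have [|k ke] := @near_invS_lt (e ^+ 2 / 4); first by rewrite divr_gt0 ?exprn_gt0.
  exists k => m n km kn.
  rewrite -(@ltr_pXn2r _ 2) ?nnegrE ?hnorm_ge0 ?(ltW e0)// sqr_hnorm.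
  apply: le_lt_trans (par m n) _.
  have := ke _ km; have := ke _ kn; lra.
have Nx0 : N x0.
  by apply: Nc => e /x0P[K hK]; exists (u K); [case: (uP K)|rewrite hnormB hK].
exists x0 => // z Nz.
have dx0 : ip (x - x0) (x - x0) <= d.
  have d0 : 0 <= d by apply: lb_le_inf; [case: E0|move=> _ [y _ <-]].
  rewrite -sqr_hnorm -[leRHS]sqr_sqrtr// ler_pXn2r ?nnegrE ?hnorm_ge0 ?sqrtr_ge0//.
  apply/ler_addgt0Pr => e e0.
  have e2 : 0 < e / 2 by rewrite divr_gt0.
  have [K hK] := x0P _ e2.
  have [|k ke] := @near_invS_lt ((e / 2) ^+ 2); first by rewrite exprn_gt0.
  pose n := maxn K k.
  apply: le_trans (hnorm_triangle (u n) _ _) _.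
  have h1 : hnorm (u n - x0) < e / 2 by apply: hK; rewrite leq_maxl.
  suff : hnorm (x - u n) <= Num.sqrt d + e / 2 by lra.
  rewrite -(@ler_pXn2r _ 2) ?nnegrE ?hnorm_ge0 ?addr_ge0 ?sqrtr_ge0// ?(ltW e2)//.
  rewrite sqr_hnorm sqrrD sqr_sqrtr//.
  have [_ /ltW h2] := uP n; apply: le_trans h2 _.
  have h3 := ke _ (leq_maxr K k); rewrite -/n in h3.
  have := mulr_ge0 (sqrtr_ge0 d) (ltW e2); rewrite -mulr_natr; lra.
have [] // := @quad_ge0P (ip z z) (- ip (x - x0) z) 0.
  move=> s; rewrite addr0.
  have : d <= ip (x - (s *: z + x0)) (x - (s *: z + x0)) by apply: dle; exact: (NL).
  have -> : x - (s *: z + x0) = (x - x0) - s *: z by rewrite opprD addrCA addrC.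
  rewrite -/(x - x0); move: (x - x0) dx0 => y dx0; rewrite !ipE (ipC z y); lra.
move=> _ _; rewrite mulr0 sqrrN => h; apply/eqP; rewrite -sqrf_eq0 eq_le h; exact: sqr_ge0.
Qed.

(** The representing vector is a multiple of a vector orthogonal to the kernel of [l]. The bound on
    [l] both closes the kernel and prevents that vector from being null. *)
Lemma riesz (l : V -> R) : (forall x y, l (x + y) = l x + l y) ->
  (forall (c : R) x, l (c *: x) = c * l x) -> (exists c : R, forall x, `|l x| <= c * hnorm x) ->
  exists r, forall x, l x = ip r x.
Proof.
move=> lD lZ [c lc].
have lN x : l (- x) = - l x by rewrite -scaleN1r lZ mulN1r.
have [[x lx]|h] := pselect (exists x, l x != 0); last first.
  exists 0 => x; rewrite bilinear_form0l; last by case: ipP.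
  by apply/eqP/negPn/negP => lx; apply: h; exists x.
have Ns : subspace (fun y => l y = 0).
  split=> [|a y z ly lz]; first by rewrite -(scale0r 0) lZ mul0r.
  by rewrite lD lZ ly lz mulr0 addr0.
have c0 : 0 <= `|c| by [].
have Nc : hclosed (fun y => l y = 0).
  move=> y hy; apply/eqP; rewrite -normr_eq0 eq_le normr_ge0 andbT; apply/ler_addgt0Pr => e e0.
  have [|z lz hz] := hy (e / (`|c| + 1)); first by rewrite divr_gt0// ltr_wpDl.
  have -> : l y = l (y - z) by rewrite lD lN lz subr0.
  rewrite add0r; apply: le_trans (lc _) _.
  apply: (@le_trans _ _ ((`|c| + 1) * hnorm (y - z))).
    rewrite ler_wpM2r ?hnorm_ge0//; have := ler_norm c; lra.
  by rewrite mulrC -ler_pdivlMr ?ltr_wpDl// ltW.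
have [y ly yP] := hprojection Ns Nc x.
pose z := x - y.
have lz : l z = l x by rewrite lD lN ly subr0.
have zz : ip z z != 0.
  apply: contra lx => /eqP zz; rewrite -lz -normr_eq0 eq_le normr_ge0 andbT.
  by apply: le_trans (lc _) _; rewrite (hnorm_eq0 zz) mulr0.
exists ((l z / ip z z) *: z) => w.
have : ip z (w - (l w / l z) *: z) = 0.
  by apply: yP; rewrite lD lN lZ -mulrA mulVf ?mulr1 ?subrr// lz.
rewrite ipDr ipNr ipZr ipZl => /eqP; rewrite subr_eq0 => /eqP ->.
have lz' : l z != 0 by rewrite lz.
by move: zz lz'; move: (ip z z) (l z) => a b a0 b0; field; rewrite ?a0 ?b0.
Qed.

(** With [a g h = ip (A g) h], coercivity makes the range of [A] closed and its orthogonal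
    complement null. The form [a] need not be symmetric, so Riesz alone would not do. *)
Lemma lax_milgram (a : V -> V -> R) (l : V -> R) (c k : R) : bilinear_form a ->
  (forall x y, `|a x y| <= c * hnorm x * hnorm y) ->
  0 < k -> (forall x, k * ip x x <= a x x) ->
  (forall x y, l (x + y) = l x + l y) ->
  (forall (c : R) x, l (c *: x) = c * l x) -> (exists c : R, forall x, `|l x| <= c * hnorm x) ->
  exists g, forall h, a g h = l h.
Proof.
move=> [aDl aDr aZl aZr] ac k0 ak lD lZ lc.
have [A AP] : exists A : V -> V, forall g h, a g h = ip (A g) h.
  have h (g : V) : exists Ag, forall h, a g h = ip Ag h.
    by apply: riesz => //; exists (c * hnorm g) => x; rewrite ac.
  by have [A AP] := choice h; exists A.
have [r rP] := riesz lD lZ lc.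
have kA g : k * hnorm g <= hnorm (A g).
  have [g0|g0] := eqVneq (hnorm g) 0; first by rewrite g0 mulr0 hnorm_ge0.
  have gp : 0 < hnorm g by rewrite lt_neqAle eq_sym g0 hnorm_ge0.
  rewrite -(ler_pM2r gp) -mulrA -expr2 sqr_hnorm; apply: le_trans (ak g) _.
  by rewrite AP; apply: le_trans (ler_norm _) (cauchy_schwarz _ _).
have nullP x y : (forall z, ip x z = ip y z) -> forall z, ip (x - y) z = 0.
  by move=> h z; rewrite !ipE h subrr.
(* The range of [A] enlarged by the null vectors: [A] comes from a choice and is linear only modulo
   these. *)
pose N y := exists g, forall z, ip (y - A g) z = 0.
have Alin s x y z : ip (A (s *: x + y)) z = s * ip (A x) z + ip (A y) z.
  by rewrite -!AP aDl aZl.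
have Ns : subspace N.
  split=> [|s x y [g hg] [h hh]].
    by exists 0 => z; rewrite !ipE -AP -(scale0r 0) aZl ipZl; ring.
  exists (s *: g + h) => z; rewrite !ipE Alin.
  by have := hg z; have := hh z; rewrite !ipE => /eqP + /eqP; rewrite !subr_eq0 => /eqP -> /eqP ->; ring.
have nA x y : hnorm (A x - A y) = hnorm (A (x - y)).
  suff h z : ip (A x - A y) z = ip (A (x - y)) z.
    have -> : hnorm (A x - A y) = Num.sqrt (ip (A (x - y)) (A x - A y)) by rewrite -h.
    by rewrite ipC h.
  by rewrite (addrC x) -[- y]scaleN1r Alin !ipE; ring.
have Nc : hclosed N.
  move=> y yP.
  have [g gP] : exists g : nat -> V, forall n, hnorm (y - A (g n)) < invS n.
    suff h n : exists g, hnorm (y - A g) < invS n by have [g gP] := choice h; exists g.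
    have [|z [h hh] zn] := yP (invS n); first exact: invS_gt0.
    exists h; apply: le_lt_trans (hnorm_triangle z _ _) _.
    by rewrite (hnorm_eq0 (hh _)) addr0.
  have [g0 g0P] : exists g0, forall e : R, 0 < e -> exists K, forall n, (K <= n)%N -> hnorm (g n - g0) < e.
    apply: ip_complete => e e0.
    have [|K KP] := @near_invS_lt (k * e / 2); first by rewrite divr_gt0 ?mulr_gt0.
    exists K => m n Km Kn.
    rewrite -(ltr_pM2l k0); apply: le_lt_trans (kA _) _; rewrite -nA.
    apply: le_lt_trans (hnorm_triangle y _ _) _; rewrite hnormB.
    have := gP m; have := gP n; have := KP _ Km; have := KP _ Kn; lra.
  exists g0 => z; apply: ip_null; rewrite -sqr_hnorm; apply/eqP; rewrite sqrf_eq0.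
  rewrite eq_le hnorm_ge0 andbT; apply/ler_addgt0Pr => e e0.
  have [|K1 K1P] := @near_invS_lt (e / 2); first by rewrite divr_gt0.
  have cp : 0 < `|c| + 1 by rewrite ltr_wpDl.
  have [|K2 K2P] := g0P (e / (2 * (`|c| + 1))); first by rewrite divr_gt0 ?mulr_gt0.
  pose n := maxn K1 K2.
  rewrite add0r; apply: le_trans (hnorm_triangle (A (g n)) _ _) _.
  have h1 : hnorm (A (g n - g0)) <= (`|c| + 1) * hnorm (g n - g0).
    set w := g n - g0.
    have [h0|h0] := eqVneq (hnorm (A w)) 0; first by rewrite h0 mulr_ge0 ?hnorm_ge0// ltW.
    have hp : 0 < hnorm (A w) by rewrite lt_neqAle eq_sym h0 hnorm_ge0.
    rewrite -(ler_pM2r hp) -expr2 sqr_hnorm -AP.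
    apply: le_trans (ler_norm _) _; apply: le_trans (ac _ _) _.
    rewrite ler_wpM2r ?hnorm_ge0// ler_wpM2r ?hnorm_ge0//; have := ler_norm c; lra.
  rewrite nA.
  have h2 : hnorm (g n - g0) < e / (2 * (`|c| + 1)) by apply: K2P; rewrite leq_maxr.
  have h3 : (`|c| + 1) * hnorm (g n - g0) <= e / 2.
    have -> : e / 2 = (`|c| + 1) * (e / (2 * (`|c| + 1))) by field; rewrite gt_eqF.
    by rewrite ler_pM2l// ltW.
  have := gP n; have := K1P n (leq_maxl _ _); lra.
have [y [g hg] yP] := hprojection Ns Nc r.
pose z := r - y.
(* The residual [z] is orthogonal to [A z], so [a z z = 0] and coercivity makes [z] null. *)
have z0 : ip z z = 0.
  have : ip z (A z) = 0.
    by apply: yP; exists z => w; rewrite subrr; apply: bilinear_form0l; case: ipP.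
  rewrite ipC -AP => az; have := ak z; rewrite az => h.
  by apply/eqP; rewrite eq_le ip_ge0 andbT -(pmulr_rle0 _ k0).
exists g => h; rewrite AP rP.
have := hg h; have := ip_null h z0; rewrite /z !ipE; lra.
Qed.

(** The vectors null for [D] form a subspace, by Cauchy-Schwarz for [D], and a closed one, by
    [D <= c ip]. Projecting [x] onto it leaves a vector orthogonal to [S], hence null for [ip] and
    then for [D]. *)
Lemma dense_semi_inner_eq0 (D : V -> V -> R) (S : V -> Prop) (c : R) : semi_inner D ->
  (forall x, D x x <= c * ip x x) ->
  (forall x, S x -> D x x = 0) ->
  (forall x, (forall s, S s -> ip x s = 0) -> ip x x = 0) ->
  forall x, D x x = 0.
Proof.
move=> DP Dc DS Sdense x.
have [[DDl DDr DZl DZr] DC D0] := DP.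
have Dnull y z : D y y = 0 -> D y z = 0.
  move=> y0; have [] // := @quad_ge0P (D z z) (D y z) 0.
    move=> s; have := D0 (s *: z + y); rewrite !(DDl,DDr,DZl,DZr) y0 (DC z y); lra.
  by move=> _ _; rewrite mulr0 => h; apply/eqP; rewrite -sqrf_eq0 eq_le h sqr_ge0.
have D00 : D 0 0 = 0 by rewrite -(scale0r 0) DZl mul0r.
have Ns : subspace (fun y => D y y = 0).
  split=> // s y z y0 z0.
  by rewrite !(DDl,DDr,DZl,DZr) y0 z0 (Dnull _ _ y0) DC (Dnull _ _ y0); ring.
have Dsub y n : D n n = 0 -> D y y = D (y - n) (y - n).
  move=> n0; rewrite DDl !DDr -scaleN1r !(DZr, DZl) n0 (Dnull _ _ n0) (DC y n) (Dnull _ _ n0); ring.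
have Nc : hclosed (fun y => D y y = 0).
  move=> y hy; apply/eqP; rewrite eq_le D0 andbT; apply/ler_addgt0Pr => e e0.
  have cp : 0 < `|c| + 1 by rewrite ltr_wpDl.
  have [|n n0 hn] := hy (Num.sqrt (e / (`|c| + 1))); first by rewrite sqrtr_gt0 divr_gt0.
  rewrite (Dsub _ _ n0) add0r; apply: le_trans (Dc _) _.
  have : hnorm (y - n) ^+ 2 <= e / (`|c| + 1).
    rewrite -[leRHS]sqr_sqrtr; last by rewrite divr_ge0 ?ltW.
    by rewrite ler_pXn2r ?nnegrE ?hnorm_ge0 ?sqrtr_ge0// ltW.
  rewrite sqr_hnorm ler_pdivlMr// => h; apply: le_trans h; rewrite mulrC.
  rewrite ler_wpM2l//; have := ler_norm c; lra.
have [y y0 yP] := hprojection Ns Nc x.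
rewrite (Dsub _ _ y0); apply/eqP; rewrite eq_le D0 andbT; apply: le_trans (Dc _) _.
by rewrite Sdense ?mulr0// => s Ss; apply: yP; apply: DS.
Qed.

(* Sokal's gliding hump: p would exceed n on a ball nested in the previous one. *)
Lemma lsc_seminorm_bounded (p : V -> R) :
  (forall x y, p (x + y) <= p x + p y) -> (forall (c : R) x, p (c *: x) = `|c| * p x) ->
  (forall x (M : R), M < p x -> exists2 e : R, 0 < e & forall y, hnorm (y - x) < e -> M < p y) ->
  exists c : R, forall x, p x <= c * hnorm x.
Proof.
move=> pD pZ plsc; apply: contrapT => nb.
have nb' (c : R) : exists x, c * hnorm x < p x.
  by apply: contrapT => h; apply: nb; exists c => x; rewrite leNgt; apply/negP => ?; apply: h; exists x.
have pN x : p (- x) = p x by rewrite -scaleN1r pZ normrN normr1 mul1r.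
have p0 x : 0 <= p x.
  have := pD x (- x); rewrite subrr pN -(scale0r 0) pZ normr0 mul0r; lra.
(* As [p] is dominated by no multiple of the norm, rescaling yields arbitrarily short vectors on
   which [p] is arbitrarily large. *)
have big (e M : R) : 0 < e -> exists x, hnorm x < e /\ M < p x.
  move=> e0; pose c := 2 * (`|M| + 1) / e.
  have c0 : 0 < c by rewrite divr_gt0 ?mulr_gt0 ?ltr_wpDl.
  have [x hx] := nb' c.
  have px : 0 < p x by apply: le_lt_trans hx; rewrite mulr_ge0 ?hnorm_ge0// ltW.
  exists (((`|M| + 1) / p x) *: x); rewrite hnormZ pZ ger0_norm ?divr_ge0 ?addr_ge0//; split.
    rewrite mulrAC ltr_pdivrMr//.
    have : c * hnorm x * e < p x * e by rewrite ltr_pM2r.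
    rewrite (_ : c * _ * e = 2 * ((`|M| + 1) * hnorm x)); last by rewrite /c; field; rewrite gt_eqF.
    have : 0 <= (`|M| + 1) * hnorm x by rewrite mulr_ge0 ?addr_ge0 ?hnorm_ge0.
    lra.
  rewrite -mulrA mulVf ?gt_eqF// mulr1; have := ler_norm M; lra.
have step (b : V * R) (n : nat) : exists b' : V * R, 0 < b.2 ->
    [/\ 0 < b'.2, b'.2 <= invS n, hnorm (b'.1 - b.1) + b'.2 <= b.2
      & forall y, hnorm (y - b'.1) <= b'.2 -> n%:R < p y].
  have [b0|b0] := ltP 0 b.2; last by exists b.
  have [|xi [xi1 xi2]] := big (b.2 / 2) n%:R; first by rewrite divr_gt0.
  have [x [hx px]] : exists x, hnorm (x - b.1) < b.2 / 2 /\ n%:R < p x.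
    (* Since [2 p xi <= p (b.1 + xi) + p (b.1 - xi)], one of the two translates keeps the value
       above [n]. *)
    have h : n%:R < p (b.1 + xi) \/ n%:R < p (b.1 - xi).
      have := pD (b.1 + xi) (- (b.1 - xi)); rewrite pN opprB addrC subrKA.
      rewrite -mulr2n -scaler_nat pZ normr_nat => h.
      have [|h1] := ltP n%:R (p (b.1 + xi)); [by left|right; lra].
    case: h => h; [exists (b.1 + xi)|exists (b.1 - xi)]; split=> //; rewrite addrC addKr ?hnormN//.
  have [e e0 eP] := plsc _ _ px.
  (* The radius serves three purposes: [e / 2] keeps [p] above [n] on the closed ball, [b.2 / 2]
     nests the balls, [invS n] makes the centres Cauchy. *)
  exists (x, Num.min (e / 2) (Num.min (b.2 / 2) (invS n))) => _ /=.
  have ep : 0 < e / 2 by rewrite divr_gt0.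
  split.
  - by rewrite !lt_min ep divr_gt0//= invS_gt0.
  - by rewrite !ge_min lexx !orbT.
  - have : Num.min (e / 2) (Num.min (b.2 / 2) (invS n)) <= b.2 / 2 by rewrite !ge_min lexx !orbT.
    lra.
  - move=> y; rewrite !le_min => /andP[ye _]; apply: eP; lra.
have [f fP] : exists f : V * R * nat -> V * R, forall bn : V * R * nat, 0 < bn.1.2 ->
    [/\ 0 < (f bn).2, (f bn).2 <= invS bn.2, hnorm ((f bn).1 - bn.1.1) + (f bn).2 <= bn.1.2
      & forall y, hnorm (y - (f bn).1) <= (f bn).2 -> bn.2%:R < p y].
  have [f fP] := choice (fun bn : V * R * nat => step bn.1 bn.2).
  by exists f.
pose u := fix u n := if n is k.+1 then f (u k, k) else (0, 1).
have u0 n : 0 < (u n).2 by elim: n => [//|n IH]; case: (fP (u n, n) IH).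
have uS n := fP (u n, n) (u0 n).
have nest m k : hnorm ((u (m + k)%N).1 - (u m).1) + (u (m + k)%N).2 <= (u m).2.
  elim: k => [|k IH]; first by rewrite addn0 subrr hnorm0 add0r.
  rewrite addnS; have [_ _ h _] := uS (m + k)%N.
  have := hnorm_triangle (u (m + k)%N).1 (u (m + k).+1).1 (u m).1; rewrite /= in h *; lra.
have dist m n : (m <= n)%N -> hnorm ((u n).1 - (u m).1) <= (u m).2.
  move=> mn; have := nest m (n - m)%N; rewrite subnKC//; have := u0 n; lra.
have [x xP] : exists x, forall e : R, 0 < e -> exists K, forall n, (K <= n)%N -> hnorm ((u n).1 - x) < e.
  apply: ip_complete => e e0.
  have [|k ke] := @near_invS_lt (e / 2); first by rewrite divr_gt0.
  exists k.+1 => m n km kn; have := ke k (leqnn k).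
  have := hnorm_triangle (u k.+1).1 (u m).1 (u n).1.
  have := dist _ _ km; have := dist _ _ kn; rewrite (hnormB (u n).1).
  have [_ /= ? _ _] := uS k; rewrite /=; lra.
have xin n : hnorm (x - (u n).1) <= (u n).2.
  apply/ler_addgt0Pr => e e0; have [K KP] := xP _ e0.
  have := hnorm_triangle (u (maxn K n)).1 x (u n).1.
  have := KP _ (leq_maxl K n); have := dist _ _ (leq_maxr K n); rewrite (hnormB x (u (maxn K n)).1); lra.
have pn n : n%:R < p x.
  by have [_ _ _] := uS n; apply; apply: (xin n.+1).
have := pn (Num.bound (p x)); rewrite ltNge; apply/negP; rewrite negbK.
by apply/ltW; apply: archi_boundP.
Qed.

End SemiInner.

(** Passage to the limit [e -> 0]. Only [e <= 1] is asked, because the gains and the inverse scale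
    factors to which it is applied range over that interval. *)
Lemma le_vanish (x K : R) : (forall e : R, 0 < e <= 1 -> x <= K * e) -> x <= 0.
Proof.
move=> h; apply/ler_addgt0Pr => e e0; rewrite add0r.
have Kp : 0 < `|K| + 1 by rewrite ltr_wpDl.
have d0 : 0 < e / (`|K| + 1) by rewrite divr_gt0.
pose d := Num.min 1 (e / (`|K| + 1)).
apply: le_trans (h d _) _; first by rewrite /d lt_min ltr01 d0 /= ge_min lexx.
have d1 : d <= e / (`|K| + 1) by rewrite /d ge_min lexx orbT.
have dp : 0 < d by rewrite /d lt_min ltr01.
apply: le_trans (_ : (`|K| + 1) * d <= _).
  by rewrite ler_wpM2r ?ltW//; have := ler_norm K; lra.
by rewrite mulrC -ler_pdivlMr.
Qed.

(* AM-GM on A m^2 and the constant term, then the discriminant of the quadratic. *)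
Lemma quad_trap (A B D e m x1 kap i c y : R) : 0 < m -> 0 <= e ->
  `|x1| <= kap * m -> A * m ^+ 2 + 2 * B * x1 + D < 0 ->
  (forall s, 0 <= A * s ^+ 2 + 2 * (B * i - c) * s + (D - y * e)) ->
  `|B * i - c| <= kap * `|B| + `|y| / (2 * m) * e /\
  A * m ^+ 2 <= 2 * kap * m * `|B| + `|y| * e.
Proof.
move=> m0 e0 hx hP /quad_ge0P[A0 c0 hd].
have Bx : - (B * x1) <= `|B| * (kap * m).
  apply: le_trans (ler_norm _) _; rewrite normrN normrM ler_wpM2l//.
have yn := ler_norm (- y); rewrite normrN in yn.
have ye : - y * e <= `|y| * e by rewrite ler_wpM2r.
have h1 : A * m ^+ 2 + (D - y * e) <= 2 * kap * m * `|B| + `|y| * e by nra.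
have m2 : 0 <= m ^+ 2 by exact: sqr_ge0.
have Am : 0 <= A * m ^+ 2 by exact: mulr_ge0.
split; last by lra.
have rhs : 0 <= 2 * kap * m * `|B| + `|y| * e by lra.
have h2 : 4 * (A * m ^+ 2) * (D - y * e) <= (2 * kap * m * `|B| + `|y| * e) ^+ 2.
  apply: le_trans (_ : (A * m ^+ 2 + (D - y * e)) ^+ 2 <= _).
    have := sqr_ge0 (A * m ^+ 2 - (D - y * e)); rewrite !sqrrD sqrrN; lra.
  by rewrite ler_pXn2r ?nnegrE//; lra.
have -> : kap * `|B| + `|y| / (2 * m) * e = (2 * kap * m * `|B| + `|y| * e) / (2 * m).
  by field; rewrite gt_eqF.
rewrite ler_pdivlMr ?mulr_gt0//.
rewrite -(@ler_pXn2r _ 2) ?nnegrE ?mulr_ge0 ?normr_ge0 ?(ltW m0)// exprMn real_normK ?num_real//.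
apply: le_trans h2; nra.
Qed.

(* [trap] is the quadratic inequality of a multiplier that is negative at z / e,
   where |z| = m and Re z = x1; its entries are rescaled so that the negativity
   reads the same for all e. As e -> 0 the dominating form degenerates in p. *)
Section FormTrap.
Variables (V : lmodType R) (ip : V -> V -> R) (suu syy : V -> R) (b : V -> V -> R).
Variables (m x1 kap : R).
Hypotheses (ipP : semi_inner ip) (bP : bilinear_form b).
Hypotheses (m0 : 0 < m) (kap0 : 0 <= kap) (kap1 : kap < 1) (hx : `|x1| <= kap * m).
Hypothesis suu_ge0 : forall p, 0 <= suu p.
Hypothesis syyZ : forall c q, syy (c *: q) = c ^+ 2 * syy q.
Hypothesis trap : forall e : R, 0 < e <= 1 -> exists A B D : R,
  A * m ^+ 2 + 2 * B * x1 + D < 0 /\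
  forall p q, suu p + 2 * b p q + syy q <= A * e * ip p p + 2 * B * ip p q + D / e * ip q q.

Let unit u := ip u u = 1.

Let normalize u : ip u u != 0 -> exists2 c, c != 0 & unit (c *: u).
Proof.
move=> u0; exists (Num.sqrt (ip u u))^-1.
  by rewrite invr_eq0 sqrtr_eq0 -ltNge lt_neqAle eq_sym u0; case: ipP => _ _ ->.
have [[_ _ ipZl ipZr] _ ip0] := ipP.
rewrite /unit ipZl ipZr mulrA -invfM -expr2 sqr_sqrtr; last exact: ip0.
by rewrite mulVf.
Qed.

(** Testing the trap at [((s / e) *: p, q)] and multiplying by [e] turns its right-hand side into
    [A s ^ 2 + 2 B (ip p q) s + D], with the very coefficients that are negative at [(m, x1)];
    [quad_trap] compares the two. *)
Lemma unit_trap (e : R) : 0 < e <= 1 -> exists A B D : R,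
  [/\ forall p q, unit p -> unit q ->
       `|B * ip p q - b p q| <= kap * `|B| + `|syy q| / (2 * m) * e /\
       A * m ^+ 2 <= 2 * kap * m * `|B| + `|syy q| * e,
      forall p, suu p <= A * e * ip p p &
      forall q, unit q -> b q q = 0 -> syy q < 0].
Proof.
move=> /andP[e0 e1]; have [A [B [D [hP hQ]]]] := @trap e ltac:(by rewrite e0).
have [bDl bDr bZl bZr] := bP; have [[ipDl ipDr ipZl ipZr] _ ip0] := ipP.
have ipB : bilinear_form ip by case: ipP.
have h p q : unit p -> unit q -> forall s : R,
    0 <= A * s ^+ 2 + 2 * (B * ip p q - b p q) * s + (D - syy q * e).
  move=> pu qu s; have := hQ ((s / e) *: p) q; have := suu_ge0 ((s / e) *: p).
  rewrite !(bZl, ipZl, ipZr) pu qu => s0.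
  rewrite -(ler_pM2l e0).
  have -> : e * (A * e * (s / e * (s / e * 1)) + 2 * B * (s / e * ip p q) + D / e * 1) =
     A * s ^+ 2 + 2 * (B * ip p q) * s + D by field; rewrite gt_eqF.
  have -> : e * (suu ((s / e) *: p) + 2 * (s / e * b p q) + syy q) =
     e * suu ((s / e) *: p) + 2 * b p q * s + syy q * e by field; rewrite gt_eqF.
  have := mulr_ge0 (ltW e0) s0; lra.
exists A, B, D; split.
- move=> p q pu qu; exact: (quad_trap m0 (ltW e0) hx hP (h _ _ pu qu)).
- move=> p; have := hQ p 0.
  have -> : syy 0 = 0 by rewrite -(scale0r 0) syyZ expr0n mul0r.
  by rewrite !(bilinear_form0r _ bP, bilinear_form0r _ ipB) !mulr0 !addr0.
- move=> q qu bq; rewrite ltNge; apply/negP => y0.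
  (* With [b q q = 0] and [syy q >= 0] the quadratic gives [B ^+ 2 <= A * D], so
     [A |z| ^ 2 + 2 B Re z + D] would be nonnegative at every [z], against the hypothesis on [m] and
     [x1]. *)
  have := h q q qu qu; rewrite qu bq mulr1 subr0 => /quad_ge0P[A0 D0 hd].
  have ye := mulr_ge0 y0 (ltW e0).
  have Bx : - (B * x1) <= `|B| * (kap * m).
    by apply: le_trans (ler_norm _) _; rewrite normrN normrM ler_wpM2l.
  have AD : B ^+ 2 <= A * D by apply: le_trans hd _; rewrite ler_wpM2l//; lra.
  have Am : 0 <= A * m ^+ 2 by rewrite mulr_ge0 ?sqr_ge0.
  have h1 : A * m ^+ 2 + D < 2 * (`|B| * (kap * m)) by lra.
  have h2 : (A * m ^+ 2 + D) ^+ 2 < (2 * (`|B| * (kap * m))) ^+ 2.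
    by rewrite ltr_pXn2r ?nnegrE//; lra.
  have h3 := sqr_ge0 (A * m ^+ 2 - D).
  have h4 : (2 * (`|B| * (kap * m))) ^+ 2 = 4 * (kap ^+ 2 * (B ^+ 2 * m ^+ 2)).
    by rewrite !exprMn real_normK ?num_real//; ring.
  have m2 : 0 <= m ^+ 2 by exact: sqr_ge0.
  have k2 : kap ^+ 2 <= 1 by rewrite expr2 mulr_ile1// ltW.
  have Bm : 0 <= B ^+ 2 * m ^+ 2 by rewrite mulr_ge0 ?sqr_ge0.
  have h5 : kap ^+ 2 * (B ^+ 2 * m ^+ 2) <= B ^+ 2 * m ^+ 2 by rewrite ler_piMl.
  have h6 : B ^+ 2 * m ^+ 2 <= A * D * m ^+ 2 by rewrite ler_wpM2r.
  move: h2; rewrite h4; move: h3; rewrite !sqrrD sqrrN; lra.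
Qed.

Let k1 : 0 < 1 - kap. Proof. by rewrite subr_gt0. Qed.

(** One has [suu p <= A e (ip p p)], and [A] stays bounded above as [e -> 0]: because [kap < 1], the
    estimate at a unit vector paired with itself absorbs [kap |B|] and bounds [B], which in turn
    bounds [A]. *)
Lemma trap_suu_le0 p : suu p <= 0.
Proof.
have [p0|p0] := eqVneq (ip p p) 0.
  have [|A [B [D [_ h _]]]] := @unit_trap 1; first by rewrite ltr01 lexx.
  by have := h p; rewrite p0 mulr0.
have [c c0 cu] := normalize p0.
pose q := c *: p.
pose Bmax := (`|b q q| + `|syy q| / (2 * m)) / (1 - kap).
pose Amax := (2 * kap * m * Bmax + `|syy q|) / m ^+ 2.
have m2 : 0 < m ^+ 2 by rewrite exprn_gt0.
apply: (@le_vanish _ (Amax * ip p p)) => e e01.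
have [A [B [D [h1 h2 _]]]] := unit_trap e01.
have [] := h1 q q cu cu; rewrite cu mulr1 => h3 h4.
have [e0 e1] := andP e01.
have ye : `|syy q| * e <= `|syy q| by rewrite ler_piMr.
have yem : `|syy q| / (2 * m) * e <= `|syy q| / (2 * m).
  by rewrite ler_piMr// divr_ge0// mulr_ge0// ltW.
have hB : `|B| <= Bmax.
  rewrite ler_pdivlMr//; have := ler_normB (B - b q q) (- b q q).
  rewrite opprK subrK normrN; lra.
have hA : A <= Amax.
  rewrite ler_pdivlMr//; apply: le_trans h4 _; rewrite lerD// ler_wpM2l//.
  by rewrite !mulr_ge0// ltW.
have pp : 0 <= ip p p by case: ipP.
apply: le_trans (h2 p) _; rewrite mulrAC ler_wpM2r// ?(ltW e0)//.
by rewrite ler_wpM2r.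
Qed.

(** For a given [e] the same [B] serves all vectors. If [b u0 u0 = 0] for one unit vector, then
    [B = O(e)], which forces [b] to vanish on non-null vectors. Otherwise [|B|] is bounded below
    through [u0], up to [O(e)], and this passes on to [|b u u|] for every unit [u]. *)
Lemma trap_dichotomy :
  (exists2 eta : R, 0 < eta & forall u, eta * ip u u <= `|b u u|) \/
  ((forall p q, ip p p != 0 -> ip q q != 0 -> b p q = 0) /\
   forall q, ip q q != 0 -> syy q < 0).
Proof.
have [[u0 [u0u bu0]]|nb] := pselect (exists u, unit u /\ b u u = 0).
  right.
  have b0 p q : unit p -> unit q -> b p q = 0.
    move=> pu qu; apply/eqP; rewrite -normr_eq0 eq_le normr_ge0 andbT.
    pose K0 := `|syy u0| / (2 * m) / (1 - kap).
    apply: (@le_vanish _ ((`|ip p q| + kap) * K0 + `|syy q| / (2 * m))) => e e01.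
    have [A [B [D [h1 _ _]]]] := unit_trap e01.
    have [] := h1 u0 u0 u0u u0u; rewrite u0u bu0 mulr1 subr0 => h3 _.
    have [h4 _] := h1 p q pu qu.
    have [e0 e1] := andP e01.
    have hB : `|B| <= K0 * e.
      rewrite /K0 mulrAC ler_pdivlMr//; lra.
    have := ler_normB (B * ip p q) (B * ip p q - b p q); rewrite opprB addrCA subrr addr0 normrM.
    have h5 : (`|ip p q| + kap) * `|B| <= (`|ip p q| + kap) * (K0 * e).
      by rewrite ler_wpM2l// addr_ge0.
    rewrite mulrDl -mulrA; lra.
  have [bDl bDr bZl bZr] := bP.
  have bq0 p q : ip p p != 0 -> ip q q != 0 -> b p q = 0.
    move=> /normalize[c c0 cp] /normalize[d d0 dq].
    have := b0 _ _ cp dq; rewrite bZl bZr => /eqP.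
    by rewrite !mulf_eq0 (negPf c0) (negPf d0) => /eqP.
  split=> // q q0; have [c c0 cq] := normalize q0.
  have [|A [B [D [_ _ h]]]] := @unit_trap 1; first by rewrite ltr01 lexx.
  have := h _ cq; rewrite bZl bZr bq0// !mulr0 syyZ => /(_ erefl).
  by rewrite pmulr_rlt0// exprn_even_gt0.
have [[u0 u0u]|nu] := pselect (exists u, unit u); last first.
  left; exists 1 => // u; rewrite mul1r.
  have [->//|/normalize[c _ cu]] := eqVneq (ip u u) 0.
  by exfalso; apply: nu; exists (c *: u).
(* Up to [O(e)], [(1 - kap) |B| <= |b u u|] and [|b u0 u0| <= (1 + kap) |B|]; [rho] is the quotient
   of the two factors. *)
left; pose rho := (1 - kap) / (1 + kap).
have k1' : 0 < 1 + kap by rewrite ltr_pwDl.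
have rho0 : 0 < rho by rewrite divr_gt0.
have bu0 : b u0 u0 != 0 by apply/eqP => h; apply: nb; exists u0.
have unit_le u : unit u -> rho * `|b u0 u0| <= `|b u u|.
  move=> uu; rewrite -subr_le0.
  pose K0 := `|syy u0| / (2 * m); pose K1 := `|syy u| / (2 * m).
  apply: (@le_vanish _ (rho * K0 + K1)) => e e01.
  have [A [B [D [h1 _ _]]]] := unit_trap e01.
  have [] := h1 u0 u0 u0u u0u; rewrite u0u mulr1 -/K0 => h3 _.
  have [] := h1 u u uu uu; rewrite uu mulr1 -/K1 => h4 _.
  have h5 : `|b u0 u0| <= (1 + kap) * `|B| + K0 * e.
    have := ler_normB B (B - b u0 u0); rewrite opprB addrCA subrr addr0; lra.
  have h6 : (1 - kap) * `|B| <= `|b u u| + K1 * e.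
    have := ler_normB (B - b u u) (- b u u); rewrite opprK subrK normrN; lra.
  have h7 : rho * `|b u0 u0| <= rho * ((1 + kap) * `|B| + K0 * e) by rewrite ler_pM2l.
  have h8 : rho * ((1 + kap) * `|B|) = (1 - kap) * `|B| by rewrite mulrA divfK ?gt_eqF.
  move: h7; rewrite mulrDr h8 mulrDl mulrA; lra.
exists (rho * `|b u0 u0|); first by rewrite mulr_gt0// normr_gt0.
move=> u; have [->|u1] := eqVneq (ip u u) 0; first by rewrite mulr0.
have [c c0 cu] := normalize u1.
have [bDl bDr bZl bZr] := bP; have [[ipDl ipDr ipZl ipZr] _ ip0] := ipP.
have := unit_le _ cu; rewrite bZl bZr mulrA -expr2 normrM (ger0_norm (sqr_ge0 _)).
have c2 : 0 < c ^+ 2 by rewrite exprn_even_gt0.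
have : c ^+ 2 * ip u u = 1 by rewrite expr2 -mulrA -ipZr -ipZl.
move=> e1 h; rewrite -(ler_pM2l c2); apply: le_trans h.
by rewrite mulrCA e1 mulr1.
Qed.

End FormTrap.
End SemiHilbert.

(** * Square-integrable functions *)

Section SquareIntegrable.
Variable R : realType.
Local Notation mu := (@lebesgue_measure R).

Lemma ae_mp (P Q : R -> Prop) : {ae mu, forall x, P x} -> (forall x, P x -> Q x) ->
  {ae mu, forall x, Q x}.
Proof.
move=> [N [mN N0 sub]] PQ; exists N; split=> // x nQ; apply: sub => Px; apply: nQ; exact: PQ.
Qed.

Lemma ae_and (P Q : R -> Prop) : {ae mu, forall x, P x} -> {ae mu, forall x, Q x} ->
  {ae mu, forall x, P x /\ Q x}.
Proof.
move=> [N [mN N0 sN]] [M [mM M0 sM]]; exists (N `|` M); split.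
- exact: measurableU.
- by rewrite null_set_setU.
- move=> x nPQ; have [Px|nP] := pselect (P x); last by left; apply: sN.
  by right; apply: sM => Qx; apply: nPQ.
Qed.

Lemma cvg_sumr (I : finType) (f : nat -> I -> R) (l : I -> R) :
  (forall i, f ^~ i @ \oo --> l i) -> (fun k => \sum_i f k i) @ \oo --> \sum_i l i.
Proof.
move=> h; elim: (index_enum I) => [|i s IH].
  by rewrite big_nil; under eq_fun do rewrite big_nil; exact: cvg_cst.
by rewrite big_cons; under eq_fun do rewrite big_cons; apply: cvgD.
Qed.

Lemma nneseries_lty_cvg (a : R ^nat) : (forall k, 0 <= a k) ->
  (\sum_(k <oo) (a k)%:E < +oo)%E -> cvgn (series a).
Proof.
move=> a0 h; have f0 : (\sum_(k <oo) (a k)%:E)%E \is a fin_num.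
  by rewrite ge0_fin_numE// nneseries_ge0// => k _ _; rewrite lee_fin.
apply: nondecreasing_is_cvgn; first exact: nondecreasing_series.
exists (fine (\sum_(k <oo) (a k)%:E)%E) => _ [n _ <-].
rewrite -lee_fin fineK// /series/= -sumEFin.
by apply: nneseries_lim_ge => k _ _; rewrite lee_fin.
Qed.

(** By Tonelli the sum of the series has a finite integral, hence is finite almost everywhere. *)
Lemma ae_summable (D : set R) (g : nat -> R -> R) : measurable D ->
  (forall k, measurable_fun D (g k)) -> (forall k x, 0 <= g k x) ->
  (\sum_(k <oo) \int[mu]_(x in D) (g k x)%:E < +oo)%E ->
  {ae mu, forall x, D x -> cvgn (series (g ^~ x))}.
Proof.
move=> mD mg g0 h.
have mE k : measurable_fun D (EFin \o g k) by exact/measurable_EFinP.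
have gE k x : D x -> (0 <= (EFin \o g k) x)%E by rewrite lee_fin.
have i : mu.-integrable D (fun x => \sum_(k <oo) (EFin \o g k) x)%E.
  apply/integrableP; split; 
    first exact: (@ge0_emeasurable_sum _ _ _ D (fun k => EFin \o g k) xpredT (fun k x Dx _ => gE k x Dx) (fun k _ => mE k)).
  under eq_integral => x xD.
    rewrite gee0_abs; last by apply: nneseries_ge0 => k _ _; rewrite lee_fin.
    over.
  by rewrite integral_nneseries.
apply: (ae_mp (@integrable_ae _ _ _ mu D mD _ i)) => x hx Dx.
apply: nneseries_lty_cvg => //; have := hx Dx.
by rewrite ge0_fin_numE// nneseries_ge0// => k _ _; rewrite lee_fin.
Qed.

(** Fatou as the transfer of a uniform bound to the limit. It gives upper bounds on limit energies
    and, applied to kernel masses tending to pi, also a lower bound on an energy. *)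
Lemma fatou_bound (D : set R) (h : nat -> R -> R) (f : R -> R) (c : \bar R) :
  measurable D -> (forall k, measurable_fun D (h k)) -> measurable_fun D f ->
  (forall k x, 0 <= h k x) -> (forall x, 0 <= f x) ->
  {ae mu, forall x, D x -> h ^~ x @ \oo --> f x} ->
  (forall k, (\int[mu]_(x in D) (h k x)%:E <= c)%E) ->
  (\int[mu]_(x in D) (f x)%:E <= c)%E.
Proof.
move=> mD mh mf h0 f0 cv hc.
have mE k : measurable_fun D (EFin \o h k) by exact/measurable_EFinP.
have hE k x : D x -> (0 <= (EFin \o h k) x)%E by rewrite lee_fin.
have mlim : measurable_fun D (fun x => limn_einf (fun k => (EFin \o h k) x)).
  rewrite /limn_einf; apply: measurableT_comp => //.
  apply: measurable_fun_limn_esup => k; exact: measurableT_comp.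
have lef : {ae mu, forall x, D x -> ((f x)%:E <= limn_einf (fun k => (EFin \o h k) x))%E}.
  move/ae_mp : cv; apply => x hx Dx.
  have : (fun k => (EFin \o h k) x) @ \oo --> (f x)%:E.
    by apply: cvg_EFin; [exact: nearW|exact: hx].
  by move=> /cvg_limn_einf_sup[-> _].
apply: (@le_trans _ _ (\int[mu]_(x in D) limn_einf (fun k => (EFin \o h k) x))%E).
  apply: ae_ge0_le_integral => //.
  - by move=> x _; rewrite lee_fin.
  - exact/measurable_EFinP.
  - move=> x Dx; rewrite limn_einf_lim; apply: lime_ge; first exact: is_cvg_einfs.
    apply: nearW => k; apply: le_ereal_inf_tmp => _ [m _ <-]; exact: hE.
apply: (le_trans (@fatou _ _ _ mu D mD _ mE hE)).
rewrite limn_einf_lim; apply: lime_le; first exact: is_cvg_einfs.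
apply: nearW => k; apply: ereal_inf_le; exists (\int[mu]_(x in D) (h k x)%:E)%E => //=.
by exists k => //=.
Qed.

Definition sqint (D : set R) (f : R -> R) :=
  measurable_fun D f /\ (\int[mu]_(x in D) ((f x) ^+ 2)%:E < +oo)%E.

Section Domain.
Variables (D : set R) (mD : measurable D).

Lemma sqint_integrable f : sqint D f -> mu.-integrable D (EFin \o (fun x => f x ^+ 2)).
Proof.
move=> [mf fi]; apply/integrableP; split.
  exact/measurable_EFinP/measurable_funX.
by under eq_integral => x _ do rewrite /= ger0_norm ?sqr_ge0//.
Qed.

Lemma sqintM f g : sqint D f -> sqint D g ->
  mu.-integrable D (EFin \o (fun x => f x * g x)).
Proof.
move=> sf sg; apply: (@le_integrable _ _ _ mu D mD _
    (fun x => (f x ^+ 2)%:E + (g x ^+ 2)%:E)%E).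
- by apply/measurable_EFinP/measurable_funM; [case: sf|case: sg].
- move=> x Dx; rewrite /= lee_fin normrM [leRHS]ger0_norm ?addr_ge0 ?sqr_ge0//.
  rewrite -(real_normK (num_real (f x))) -(real_normK (num_real (g x))).
  have := sqr_ge0 (`|f x| - `|g x|); have := mulr_ge0 (normr_ge0 (f x)) (normr_ge0 (g x)).
  rewrite sqrrB; lra.
- by apply: integrableD => //; exact: sqint_integrable.
Qed.

Lemma sqintP f : sqint D f <->
  measurable_fun D f /\ mu.-integrable D (EFin \o (fun x => f x * f x)).
Proof.
split=> [sf|[mf fi]]; first by split; [case: sf|exact: sqintM].
split=> //; have /integrableP[_] := fi.
by under eq_integral => x _ do rewrite /= -expr2 ger0_norm ?sqr_ge0//.
Qed.

Lemma sqintD f g : sqint D f -> sqint D g -> sqint D (fun x => f x + g x).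
Proof.
move=> sf sg; apply/sqintP; split.
  by apply: measurable_funD; [case: sf|case: sg].
rewrite (_ : _ \o _ = fun x => ((f x * f x)%:E + (f x * g x)%:E) + ((f x * g x)%:E + (g x * g x)%:E))%E; last first.
  by apply/funext => x /=; rewrite -?EFinD; congr EFin; ring.
by do !apply: integrableD => //; exact: sqintM.
Qed.

Lemma sqintZ c f : sqint D f -> sqint D (fun x => c * f x).
Proof.
move=> sf; apply/sqintP; split; first by apply: measurable_funM; [exact: measurable_cst|case: sf].
rewrite (_ : _ \o _ = fun x => ((c * c)%:E * (f x * f x)%:E)%E); last first.
  by apply/funext => x /=; rewrite -EFinM; congr EFin; ring.
by apply: integrableZl => //; exact: sqintM.
Qed.

Lemma sqint0 : sqint D (fun=> 0).
Proof.
split; first exact: measurable_cst.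
by under eq_integral => x _ do rewrite expr0n; rewrite integral0.
Qed.

Lemma sqintN f : sqint D f -> sqint D (fun x => - f x).
Proof. by move=> /(sqintZ (-1)); under eq_fun do rewrite mulN1r. Qed.

End Domain.

(** Measurability travels with the set, so that the vector space structure of [L2 D I] depends on
    [D] and [I] alone. *)
Record mset := MSet { mset_set :> set R ; msetP : measurable mset_set }.

Definition inL2on (D : set R) (I : finType) (u : R -> I -> R) :=
  forall i, sqint D (fun x => u x i).

(* The elements are functions, not classes modulo null functions, so [ip] below is
   only a semi-inner product. *)
Record L2 (D : mset) (I : finType) := MkL2 { l2f :> R -> I -> R ; l2P : inL2on D l2f }.

HB.instance Definition _ (D : mset) (I : finType) := gen_eqMixin (L2 D I).
HB.instance Definition _ (D : mset) (I : finType) := gen_choiceMixin (L2 D I).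

Section L2mod.
Variables (D : mset) (I : finType).
Implicit Types u v : L2 D I.

Lemma L2_eq u v : (forall x i, u x i = v x i) -> u = v.
Proof.
move=> uv; have e : l2f u = l2f v by apply/funext => x; apply/funext => i; exact: uv.
case: u e {uv} => f fP; case: v => g gP /= e; rewrite e in fP *.
congr MkL2; exact: Prop_irrelevance.
Qed.

Definition L2_zero : L2 D I := @MkL2 D I (fun _ _ => 0) (fun i => sqint0 D).
Definition L2_add u v : L2 D I :=
  @MkL2 D I (fun x i => u x i + v x i) (fun i => sqintD (msetP D) (l2P u i) (l2P v i)).
Definition L2_opp u : L2 D I :=
  @MkL2 D I (fun x i => - u x i) (fun i => sqintN (msetP D) (l2P u i)).
Definition L2_scale c u : L2 D I :=
  @MkL2 D I (fun x i => c * u x i) (fun i => sqintZ (msetP D) c (l2P u i)).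

Lemma L2_addA : associative L2_add.
Proof. by move=> u v w; apply: L2_eq => x i /=; rewrite addrA. Qed.
Lemma L2_addC : commutative L2_add.
Proof. by move=> u v; apply: L2_eq => x i /=; rewrite addrC. Qed.
Lemma L2_add0 : left_id L2_zero L2_add.
Proof. by move=> u; apply: L2_eq => x i /=; rewrite add0r. Qed.
Lemma L2_addN : left_inverse L2_zero L2_opp L2_add.
Proof. by move=> u; apply: L2_eq => x i /=; rewrite addNr. Qed.

HB.instance Definition _ := GRing.isZmodule.Build (L2 D I) L2_addA L2_addC L2_add0 L2_addN.

Lemma L2_scaleA a b u : L2_scale a (L2_scale b u) = L2_scale (a * b) u.
Proof. by apply: L2_eq => x i /=; rewrite mulrA. Qed.
Lemma L2_scale1 : left_id 1 L2_scale.
Proof. by move=> u; apply: L2_eq => x i /=; rewrite mul1r. Qed.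
Lemma L2_scaleDr : right_distributive L2_scale +%R.
Proof. by move=> c u v; apply: L2_eq => x i /=; rewrite mulrDr. Qed.
Lemma L2_scaleDl u : {morph L2_scale^~ u : a b / a + b}.
Proof. by move=> a b; apply: L2_eq => x i /=; rewrite mulrDl. Qed.

HB.instance Definition _ :=
  GRing.Zmodule_isLmodule.Build R (L2 D I) L2_scaleA L2_scale1 L2_scaleDr L2_scaleDl.

Lemma L2DE u v x i : (u + v) x i = u x i + v x i. Proof. by []. Qed.
Lemma L2NE u x i : (- u) x i = - u x i. Proof. by []. Qed.
Lemma L2BE u v x i : (u - v) x i = u x i - v x i. Proof. by []. Qed.
Lemma L2ZE c u x i : (c *: u) x i = c * u x i. Proof. by []. Qed.

Definition dot (u v : R -> I -> R) (x : R) : R := \sum_i u x i * v x i.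

Definition ip u v : R := \int[mu]_(x in D) dot u v x.

Lemma dot_integrable u v : mu.-integrable D (EFin \o dot u v).
Proof.
rewrite /dot; have h i := sqintM (msetP D) (l2P u i) (l2P v i).
rewrite (_ : _ \o _ = fun x => (\sum_(i <- index_enum I) ((u x i) * (v x i))%:E)%E); last first.
  by apply/funext => x /=; rewrite sumEFin.
by apply: (@integrable_sum _ _ _ mu D (msetP D)) => i _; exact: h.
Qed.

Lemma EFin_ip u v : ((ip u v)%:E = \int[mu]_(x in D) (dot u v x)%:E)%E.
Proof. by rewrite /ip /Rintegral fineK//; exact: (@integrable_fin_num _ _ _ mu D (msetP D) _ (dot_integrable u v)). Qed.

Lemma dotC u v x : dot u v x = dot v u x.
Proof. by apply: eq_bigr => i _; rewrite mulrC. Qed.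

Lemma dot_ge0 (u : R -> I -> R) x : 0 <= dot u u x.
Proof. by apply: sumr_ge0 => i _; rewrite -expr2 sqr_ge0. Qed.

Lemma ip_semi_inner : semi_inner ip.
Proof.
have C u v : ip u v = ip v u by apply: eq_Rintegral => x _; exact: dotC.
have Dl u u' v : ip (u + u') v = ip u v + ip u' v.
  rewrite /ip -(@RintegralD _ _ _ mu D _ _ (msetP D) (dot_integrable u v) (dot_integrable u' v)).
  apply: eq_Rintegral => x _; rewrite /dot -big_split/=.
  by apply: eq_bigr => i _; rewrite mulrDl.
have Zl c u v : ip (c *: u) v = c * ip u v.
  rewrite /ip -(@RintegralZl _ _ _ mu D _ c (msetP D) (dot_integrable u v)).
  apply: eq_Rintegral => x _; rewrite /dot big_distrr/=.
  by apply: eq_bigr => i _; rewrite mulrA.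
split=> //; last by move=> u; apply: Rintegral_ge0 => x _; exact: dot_ge0.
split=> // [u v v'|c u v]; first by rewrite C Dl !(C _ u).
by rewrite C Zl (C _ u).
Qed.

Lemma sqr_le_dot (u : R -> I -> R) x i : u x i ^+ 2 <= dot u u x.
Proof.
rewrite /dot (bigD1 i)//= -expr2 lerDl; apply: sumr_ge0 => j _.
by rewrite -expr2 sqr_ge0.
Qed.

Lemma ip_ae0 u : ip u u = 0 -> {ae mu, forall x, mset_set D x -> forall i, u x i = 0}.
Proof.
move=> u0; have := EFin_ip u u; rewrite u0 => h.
have mf : measurable_fun D (EFin \o dot u u) by apply: (measurable_int mu); exact: dot_integrable.
have : (\int[mu]_(x in D) `|(EFin \o dot u u) x| = 0)%E.
  by rewrite [RHS]h; apply: eq_integral => x _ /=; rewrite ger0_norm// dot_ge0.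
move/(ae_eq_integral_abs mu (msetP D) mf).1 => hae; apply: (ae_mp hae) => x /= hx Dx i.
have [e] := hx Dx.
by apply/eqP; rewrite -sqrf_eq0 eq_le sqr_ge0 -e sqr_le_dot.
Qed.

Lemma sqint_of_dot (f : R -> I -> R) : (forall i, measurable_fun D (fun x => f x i)) ->
  (\int[mu]_(x in D) (dot f f x)%:E < +oo)%E -> inL2on D f.
Proof.
move=> mf h i; split => //; apply: le_lt_trans h.
apply: ge0_le_integral => //.
- exact: msetP.
- by move=> x _; rewrite lee_fin sqr_ge0.
- by apply/measurable_EFinP; apply: measurable_funX; exact: mf.
- apply/measurable_EFinP; rewrite /dot; apply: measurable_sum => j; apply: measurable_funM; exact: mf.
- by move=> x _; rewrite lee_fin sqr_le_dot.
Qed.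

(** Here [f] is a bare function, and its square-integrability is part of the conclusion. Limits
    enter [L2] in this way, in the completeness proof and again in the final gain estimate. *)
Lemma L2_fatou (w : nat -> L2 D I) (f : R -> I -> R) (c : R) :
  (forall i, measurable_fun D (fun x => f x i)) ->
  {ae mu, forall x, mset_set D x -> forall i, (fun k => w k x i) @ \oo --> f x i} ->
  (forall k, ip (w k) (w k) <= c) ->
  exists2 F : L2 D I, l2f F = f & ip F F <= c.
Proof.
move=> mf cv hc.
have mdot (g : R -> I -> R) : (forall i, measurable_fun D (fun x => g x i)) ->
    measurable_fun D (dot g g).
  move=> mg; rewrite /dot; apply: measurable_sum => i; exact: measurable_funM.
have le : (\int[mu]_(x in D) (dot f f x)%:E <= c%:E)%E.
  apply: (@fatou_bound D (fun k => dot (w k) (w k))) => //.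
  - exact: msetP.
  - by move=> k; apply: mdot => i; case: (l2P (w k) i).
  - exact: mdot.
  - by move=> k x; exact: dot_ge0.
  - exact: dot_ge0.
  - apply: (ae_mp cv) => x hx Dx; rewrite /dot.
    apply: (@cvg_sumr _ (fun k i => w k x i * w k x i)) => i.
    by apply: cvgM; exact: hx.
  - by move=> k; rewrite -EFin_ip lee_fin.
have fP : inL2on D f by apply: sqint_of_dot => //; apply: le_lt_trans le _; rewrite ltry.
by exists (MkL2 fP) => //; rewrite -lee_fin EFin_ip.
Qed.

Lemma ae_cvg_of_summable (w : nat -> L2 D I) (a : R ^nat) :
  (forall k, ip (w k) (w k) <= a k) -> (forall k, 0 <= a k) -> cvgn (series a) ->
  {ae mu, forall x, mset_set D x -> cvgn (series (fun k => dot (w k) (w k) x))}.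
Proof.
move=> wa a0 ca.
apply: (@ae_summable D (fun k x => dot (w k) (w k) x)).
- exact: msetP.
- by move=> k; apply/measurable_EFinP; apply: (measurable_int mu); exact: dot_integrable.
- by move=> k x; exact: dot_ge0.
- apply: (@le_lt_trans _ _ (\sum_(k <oo) (a k)%:E)%E).
    apply: lee_nneseries => [k _ _|k _]; last by rewrite -EFin_ip lee_fin.
    by rewrite -EFin_ip lee_fin; case: ip_semi_inner.
  have := ca; move/cvg_ex => [l al].
  suff -> : (\sum_(k <oo) (a k)%:E = l%:E)%E by rewrite ltry.
  apply/cvg_lim => //.
  under eq_fun do rewrite sumEFin.
  by apply: cvg_EFin; [exact: nearW|exact: al].
Qed.

(** Riesz-Fischer: a fast Cauchy subsequence converges almost everywhere, and Fatou bounds the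
    distance to its limit. *)
Lemma L2_complete : complete ip.
Proof.
move=> u uC.
have [K KP] : exists K : nat -> nat, forall j m n, (K j <= m)%N -> (K j <= n)%N ->
    hnorm ip (u m - u n) < 4^-1 ^+ j.
  have h (j : nat) : exists N, forall m n, (N <= m)%N -> (N <= n)%N ->
      hnorm ip (u m - u n) < 4^-1 ^+ j.
    by apply: uC; rewrite exprn_gt0// invr_gt0.
  by have [K KP] := choice h; exists K.
(* The maximum makes the thresholds nondecreasing, so one index [j] controls all later terms of the
   subsequence. *)
pose k j := \max_(i < j.+1) K i.
have Kk i j : (i <= j)%N -> (K i <= k j)%N.
  by move=> ij; apply: (leq_bigmax (Ordinal (n := j.+1) (m := i) ij)).
pose w j := u (k j).
have wC j m n : (j <= m)%N -> (j <= n)%N -> hnorm ip (w m - w n) < 4^-1 ^+ j.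
  by move=> jm jn; apply: KP; exact: Kk.
have ipP := ip_semi_inner.
(* The weight makes square summability enough for absolute convergence, through
   [|a| <= 2 ^ j a ^ 2 + 2 ^ (- j)]. *)
pose d j : L2 D I := (Num.sqrt (2 ^+ j)) *: (w j.+1 - w j).
have dd j x : dot (d j) (d j) x = 2 ^+ j * dot (w j.+1 - w j) (w j.+1 - w j) x.
  rewrite /dot big_distrr/=; apply: eq_bigr => i _.
  by rewrite mulrACA -expr2 sqr_sqrtr ?exprn_ge0.
have dae : {ae mu, forall x, mset_set D x -> cvgn (series (fun j => dot (d j) (d j) x))}.
  apply: (@ae_cvg_of_summable _ (geometric 1 (2^-1))).
  - move=> j; rewrite -(sqr_hnorm ipP) (hnormZ ipP) exprMn real_normK ?num_real//.
    rewrite sqr_sqrtr ?exprn_ge0// /geometric/= mul1r.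
    have h : hnorm ip (w j.+1 - w j) ^+ 2 <= (4^-1 ^+ j) ^+ 2.
      by rewrite ler_pXn2r ?nnegrE ?hnorm_ge0 ?exprn_ge0 ?invr_ge0// ltW// wC.
    apply: le_trans (_ : 2 ^+ j * 4^-1 ^+ j <= _).
      rewrite ler_wpM2l ?exprn_ge0//; apply: le_trans h _.
      by rewrite expr2 ler_piMr ?exprn_ge0 ?invr_ge0// exprn_ile1 ?invr_ge0// invf_le1// ler1n.
    by rewrite -exprMn le_eqVlt; apply/orP; left; apply/eqP; congr (_ ^+ _); field.
  - by move=> j; rewrite /geometric/= mul1r exprn_ge0// invr_ge0.
  - by apply: is_cvg_geometric_series; rewrite ger0_norm ?invr_ge0// invf_lt1// ltr1n.
(* The upper limit is measurable at once and equals the limit wherever there is one; its values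
   elsewhere affect only a null set. *)
pose f x i := fine (limn_esup (fun j => (w j x i)%:E)).
have mf i : measurable_fun D (fun x => f x i).
  apply: (measurableT_comp (@fine_measurable R setT measurableT)) => //.
  apply: measurable_fun_limn_esup => j; apply/measurable_EFinP; by case: (l2P (w j) i).
have wf : {ae mu, forall x, mset_set D x -> forall i, (fun j => w j x i) @ \oo --> f x i}.
  apply: (ae_mp dae) => x hx Dx i.
  have cs : cvgn (series (fun j => w j.+1 x i - w j x i)).
    apply: normed_cvg.
    apply: (@series_le_cvg _ _ (fun j => dot (d j) (d j) x + geometric 1 (2^-1) j)).
    - by move=> n /=; rewrite normr_ge0.
    - by move=> n; rewrite addr_ge0 ?dot_ge0// /geometric/= mul1r exprn_ge0// invr_ge0.
    - move=> n /=; rewrite dd.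
      set a := w n.+1 x i - w n x i.
      have h : a ^+ 2 <= dot (w n.+1 - w n) (w n.+1 - w n) x by apply: (sqr_le_dot (w n.+1 - w n) x i).
      have t0 : 0 < 2 ^+ n :> R by rewrite exprn_gt0.
      rewrite /geometric/= mul1r exprVn.
      apply: le_trans (_ : 2 ^+ n * `|a| ^+ 2 + (2 ^+ n)^-1 <= _); last first.
        by rewrite lerD2r ler_pM2l// real_normK ?num_real.
      rewrite -(ler_pM2l t0) mulrDr divff ?gt_eqF//.
      have := sqr_ge0 (2 ^+ n * `|a| - 2^-1); have := mulr_ge0 (ltW t0) (normr_ge0 a).
      rewrite sqrrB exprMn; lra.
    - apply: is_cvg_seriesD; first exact: hx.
      by apply: is_cvg_geometric_series; rewrite ger0_norm ?invr_ge0// invf_lt1// ltr1n.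
  have /cvg_ex[l hl] := cs.
  have wl : (fun j => w j x i) @ \oo --> l + w 0%N x i.
    have -> : (fun j => w j x i) = (fun j => series (fun j => w j.+1 x i - w j x i) j + w 0%N x i).
      by apply/funext => j; rewrite /series/= telescope_sumr// subrK.
    by apply: cvgD => //; exact: cvg_cst.
  suff -> : f x i = l + w 0%N x i by [].
  rewrite /f; have : (fun j => (w j x i)%:E) @ \oo --> (l + w 0%N x i)%:E.
    by apply: cvg_EFin; [exact: nearW|exact: wl].
  by move=> /cvg_limn_einf_sup[_ ->].
have bnd j : exists2 F : L2 D I, l2f F = (fun x i => f x i - w j x i) & ip F F <= (4^-1 ^+ j) ^+ 2.
  apply: (@L2_fatou (fun m => w (m + j)%N - w j)).
  - by move=> i; apply: measurable_funB => //; case: (l2P (w j) i).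
  - apply: (ae_mp wf) => x hx Dx i; apply: cvgB; last exact: cvg_cst.
    by rewrite (cvg_shiftn j (fun m => w m x i)); exact: hx.
  - move=> m; rewrite -(sqr_hnorm ipP) ler_pXn2r ?nnegrE ?hnorm_ge0 ?exprn_ge0 ?invr_ge0//.
    by rewrite ltW// wC// leq_addl.
have [F0 F0E _] := bnd 0%N.
pose F := F0 + w 0%N.
have FE x i : F x i = f x i by rewrite L2DE F0E subrK.
have Fw j : hnorm ip (w j - F) <= 4^-1 ^+ j.
  have [G GE Gle] := bnd j.
  have -> : w j - F = - G.
    by apply: L2_eq => x i; rewrite L2BE FE L2NE GE opprB.
  rewrite (hnormN ipP) -(@ler_pXn2r _ 2) ?nnegrE ?hnorm_ge0 ?exprn_ge0 ?invr_ge0//.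
  by rewrite (sqr_hnorm ipP).
exists F => e e0.
have [j hj] : exists j, 4^-1 ^+ j < e / 2.
  have : (fun j => (4^-1 : R) ^+ j) @ \oo --> 0.
    by apply: cvg_expr; rewrite ger0_norm ?invr_ge0// invf_lt1// ltr1n.
  move/cvgr0Pnorm_lt => /(_ (e / 2)) [|N _ hN]; first by rewrite divr_gt0.
  by exists N; have := hN N (leqnn N); rewrite /= ger0_norm ?exprn_ge0 ?invr_ge0.
exists (k j) => n kn.
apply: le_lt_trans (hnorm_triangle ipP (w j) _ _) _.
have h1 := Fw j; have h2 : hnorm ip (u n - w j) < 4^-1 ^+ j.
  by apply: KP; [apply: leq_trans kn; exact: Kk|exact: Kk].
move: h1 h2 hj; move: (4^-1 ^+ j) => q; lra.
Qed.

End L2mod.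

Lemma le_Rintegral_ae (D : set R) (f g : R -> R) : measurable D ->
  mu.-integrable D (EFin \o f) -> mu.-integrable D (EFin \o g) ->
  {ae mu, forall x, D x -> f x <= g x} -> \int[mu]_(x in D) f x <= \int[mu]_(x in D) g x.
Proof.
move=> mD fi gi h; rewrite -subr_ge0 -(@RintegralB _ _ _ mu D _ _ mD gi fi).
(* The positive part equals the difference almost everywhere and is nonnegative everywhere. *)
pose k x := Num.max 0 (g x - f x).
suff -> : \int[mu]_(x in D) (g x - f x) = \int[mu]_(x in D) k x.
  by apply: Rintegral_ge0 => x _; rewrite /k le_max lexx.
have mf : measurable_fun D f by apply/measurable_EFinP; exact: (measurable_int mu).
have mg : measurable_fun D g by apply/measurable_EFinP; exact: (measurable_int mu).
congr fine; apply: ae_eq_integral => //.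
- by apply/measurable_EFinP; exact: measurable_funB.
- apply/measurable_EFinP; apply: measurable_maxr; first exact: measurable_cst.
  exact: measurable_funB.
- apply: (ae_mp h) => x hx Dx; congr EFin; rewrite /k max_r// subr_ge0; exact: hx.
Qed.

Lemma le_ip_ae (D : mset) (I J : finType) (u v : L2 D I) (u' v' : L2 D J) :
  {ae mu, forall x, mset_set D x -> dot u v x <= dot u' v' x} -> ip u v <= ip u' v'.
Proof. by apply: le_Rintegral_ae; [exact: msetP|exact: dot_integrable|exact: dot_integrable]. Qed.

Lemma eq_ip_ae (D : mset) (I : finType) (u v u' v' : L2 D I) :
  {ae mu, forall x, mset_set D x -> forall i, u x i = u' x i} ->
  {ae mu, forall x, mset_set D x -> forall i, v x i = v' x i} ->
  ip u v = ip u' v'.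
Proof.
move=> hu hv; apply/eqP; rewrite eq_le; apply/andP; split; apply: le_ip_ae;
  apply: (ae_mp (ae_and hu hv)) => x [h1 h2] Dx;
  rewrite /dot le_eqVlt; apply/orP; left; apply/eqP/eq_bigr => i _;
  by rewrite h1// h2.
Qed.

Lemma ip_ae_eq0 (D : mset) (I : finType) (u : L2 D I) :
  {ae mu, forall x, mset_set D x -> forall i, u x i = 0} -> ip u u = 0.
Proof.
move=> h; rewrite (eq_ip_ae (u' := 0) (v' := 0) h h).
by apply: bilinear_form0l; case: (ip_semi_inner D I).
Qed.

End SquareIntegrable.

(** * Plancherel on a bounded interval *)

Section Kernel.
Variable R : realType.
Local Notation mu := (@lebesgue_measure R).

Lemma is_derive_expRM (a w : R) : is_derive w 1 (fun w => expR (a * w)) (a * expR (a * w)).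
Proof.
rewrite mulrC; apply: (@is_derive1_comp _ expR (fun w => a * w)).
apply: is_derive_eq; last exact: mulr1.
Qed.

Lemma is_derive_sinM (a w : R) : is_derive w 1 (fun w => sin (w * a)) (a * cos (w * a)).
Proof.
under eq_fun do rewrite mulrC.
rewrite mulrC [w * a]mulrC; apply: (@is_derive1_comp _ sin (fun w => a * w)).
apply: is_derive_eq; last exact: mulr1.
Qed.

Lemma is_derive_cosM (a w : R) : is_derive w 1 (fun w => cos (w * a)) (- a * sin (w * a)).
Proof.
under eq_fun do rewrite mulrC.
rewrite mulNr -mulrN mulrC [w * a]mulrC; apply: (@is_derive1_comp _ cos (fun w => a * w)).
apply: is_derive_eq; last exact: mulr1.
Qed.

Lemma cvg_expRN (e : R) : 0 < e -> expR (- e * w) @[w --> +oo%R] --> (0 : R).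
Proof.
move=> e0.
have h : e * w @[w --> +oo%R] --> +oo%R by exact: gt0_cvgMry.
by under eq_fun do rewrite mulNr; exact: (cvg_comp _ _ h (@cvgr_expR R)).
Qed.

Lemma cvg0_mul_bounded (E g : R -> R) (M : R) (F : set_system R) : Filter F ->
  E @ F --> (0 : R) -> (forall w, `|g w| <= M) -> (fun w => E w * g w) @ F --> (0 : R).
Proof.
move=> FF hE hg.
have M0 : 0 <= M by apply: le_trans (hg 0); exact: normr_ge0.
have hE' : (fun w => M * `|E w|) @ F --> (0 : R).
  rewrite -(mulr0 M) -(normr0 R); apply: cvgMr; exact: cvg_norm.
have hEN : (fun w => - (M * `|E w|)) @ F --> (0 : R) by rewrite -oppr0; exact: cvgN.
apply: (squeeze_cvgr _ hEN hE'); apply: nearW => w.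
rewrite -ler_norml normrM mulrC ler_wpM2r//.
Qed.

(** The Poisson kernel without its factor [1 / pi]: the cosine transform of [expR (- e * w)] on the
    half-line, of mass pi on the whole line. *)
Definition pk (e x : R) := e / (e ^+ 2 + x ^+ 2).

Lemma pk_den_gt0 (e x : R) : 0 < e -> 0 < e ^+ 2 + x ^+ 2.
Proof. by move=> e0; rewrite ltr_wpDr ?sqr_ge0// exprn_gt0. Qed.

Lemma pk_ge0 (e x : R) : 0 < e -> 0 <= pk e x.
Proof. by move=> e0; rewrite /pk divr_ge0// ?(ltW e0)// ltW// pk_den_gt0. Qed.

Lemma pk_le (e x : R) : 0 < e -> pk e x <= e^-1.
Proof.
move=> e0; rewrite ler_pdivrMr ?pk_den_gt0// ler_pdivlMl//.
by rewrite -expr2 lerDl sqr_ge0.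
Qed.

Lemma pkN (e x : R) : pk e (- x) = pk e x. Proof. by rewrite /pk sqrrN. Qed.

Lemma continuous_pk (e : R) : 0 < e -> continuous (pk e).
Proof.
move=> e0 s.
rewrite /continuous_at /pk; apply: cvgM; first exact: cvg_cst.
apply: cvgV; first by rewrite gt_eqF// pk_den_gt0.
by apply: cvgD; [exact: cvg_cst|exact: exprn_continuous].
Qed.

Section ExpWindow.
Variable e : R.
Hypothesis e0 : 0 < e.

Lemma expRN_integral : (\int[mu]_(w in `[0%R, +oo[) (expR (- e * w))%:E = (e^-1)%:E)%E.
Proof.
have D (w : R) := is_derive_expRM (- e) w.
pose F (w : R) : R := - e^-1 * expR (- e * w).
have DF (w : R) : is_derive w 1 F (expR (- e * w)).
  have := @is_deriveZ _ _ _ _ (- e^-1) w 1 _ (D w).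
  rewrite (_ : - e^-1 *: (- e * expR (- e * w)) = expR (- e * w))//.
  by rewrite /GRing.scale/=; field; rewrite gt_eqF.
have F0 : F 0 = - e^-1 by rewrite /F mulr0 expR0 mulr1.
rewrite (@ge0_continuous_FTC2y _ _ F 0 0).
- by rewrite F0 -EFinN -EFinD add0r opprK.
- by move=> x _; exact: expR_ge0.
- apply: continuous_subspaceT => x; apply: differentiable_continuous.
  by apply/derivable1_diffP; case: (D x).
- rewrite -[X in _ --> X](mulr0 (- e^-1)); apply: cvgMr; exact: cvg_expRN.
- by move=> x _; case: (DF x).
- apply: cvg_at_right_filter; apply: differentiable_continuous.
  by apply/derivable1_diffP; case: (DF 0).
- by move=> x _; rewrite derive1E; apply: derive_val.
Qed.

Lemma expRN_integrable : mu.-integrable `[0%R, +oo[ (fun w => (expR (- e * w))%:E).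
Proof.
apply/integrableP; split.
  apply/measurable_EFinP; apply: (measurableT_comp (@measurable_expR R)).
  exact: measurable_funM.
under eq_integral => x _ do rewrite /= ger0_norm ?expR_ge0//.
by rewrite expRN_integral ltry.
Qed.

(** The integrand changes sign, so the fundamental theorem on the half-line is applied to the
    nonnegative [expR (- e * w) * (1 + cos (w * x))], and the part without cosine is subtracted. *)
Lemma expRN_cos_integral x :
  \int[mu]_(w in `[0%R, +oo[) (expR (- e * w) * cos (w * x)) = pk e x.
Proof.
have q0 := pk_den_gt0 x e0; set q := (_ + _) in q0.
pose F (w : R) : R := - e^-1 * expR (- e * w) + q^-1 * (expR (- e * w) * (x * sin (w * x) - e * cos (w * x))).
pose f (w : R) : R := expR (- e * w) * (1 + cos (w * x)).
have DF (w : R) : is_derive w 1 F (f w).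
  have DE := is_derive_expRM (- e) w.
  have DS := is_derive_sinM x w.
  have DC := is_derive_cosM x w.
  have := @is_deriveD _ _ _ _ _ w 1 _ _ (@is_deriveZ _ _ _ _ (- e^-1) w 1 _ DE)
    (@is_deriveZ _ _ _ _ (q^-1) w 1 _ (@is_deriveM _ _ _ _ w 1 _ _ DE
      (@is_deriveB _ _ _ _ _ w 1 _ _ (@is_deriveZ _ _ _ _ x w 1 _ DS) (@is_deriveZ _ _ _ _ e w 1 _ DC)))).
  move=> h; refine (is_derive_eq h _).
  transitivity (- e^-1 * (- e * expR (- e * w)) + q^-1 * (expR (- e * w) *
      (x * (x * cos (w * x)) - e * (- x * sin (w * x))) +
      (x * sin (w * x) - e * cos (w * x)) * (- e * expR (- e * w)))) => //.
  rewrite /f.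
  have qn : q != 0 by rewrite gt_eqF.
  have en : e != 0 by rewrite gt_eqF.
  move: (expR (- e * w)) (sin (w * x)) (cos (w * x)) => E s c.
  by rewrite /q in qn *; field; rewrite ?qn ?en.
have F0 : F 0 = - e^-1 - q^-1 * e.
  by rewrite /F mulr0 !mul0r expR0 sin0 cos0; ring.
have h : (\int[mu]_(w in `[0%R, +oo[) (f w)%:E = (e^-1 + pk e x)%:E)%E.
  rewrite (@ge0_continuous_FTC2y _ _ F 0 0).
  - by rewrite F0 -EFinN -EFinD /pk -/q; congr EFin; ring.
  - move=> w _; rewrite mulr_ge0 ?expR_ge0//; have := cos_geN1 (w * x); lra.
  - apply: continuous_subspaceT => w; apply: differentiable_continuous.
    have DE := is_derive_expRM (- e) w; have DC := is_derive_cosM x w.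
    by apply/derivable1_diffP; apply: derivableM => //; apply: derivableD.
  - rewrite -[X in _ --> X](addr0 (0 : R)); apply: cvgD.
      rewrite -[X in _ --> X](mulr0 (- e^-1)); apply: cvgMr; exact: cvg_expRN.
    rewrite -[X in _ --> X](mulr0 (q^-1)); apply: cvgMr.
    apply: (@cvg0_mul_bounded _ _ (`|x| + e)); first exact: cvg_expRN.
    move=> w; apply: le_trans (ler_normB _ _) _; rewrite !normrM (gtr0_norm e0).
    by apply: lerD; apply: ler_piMr => //; rewrite ?(ltW e0)// ler_norml ?sin_le1 ?sin_geN1 ?cos_le1 ?cos_geN1.
  - by move=> w _; case: (DF w).
  - apply: cvg_at_right_filter; apply: differentiable_continuous.
    by apply/derivable1_diffP; case: (DF 0).
  - by move=> w _; rewrite derive1E; apply: derive_val.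
have hf : (\int[mu]_(w in `[0%R, +oo[) `|(f w)%:E| < +oo)%E.
  under eq_integral => w _.
    rewrite gee0_abs ?lee_fin; last by rewrite /f mulr_ge0 ?expR_ge0//; have := cos_geN1 (w * x); lra.
    over.
  by rewrite h ltry.
have mf : measurable_fun [set: R] f.
  apply: measurable_funM.
    apply: (measurableT_comp (@measurable_expR R)); exact: measurable_funM.
  apply: measurable_funD => //; apply: continuous_measurable_fun => w.
  apply: continuous_comp; last exact: continuous_cos.
  exact: mulrr_continuous.
have fint : mu.-integrable `[0%R, +oo[ (EFin \o f).
  by apply/integrableP; split => //; apply/measurable_EFinP; exact: measurable_funTS.
have -> : \int[mu]_(w in `[0, +oo[) (expR (- e * w) * cos (w * x)) =
    \int[mu]_(w in `[0, +oo[) (f w - expR (- e * w)).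
  by apply: eq_Rintegral => w _; rewrite /f mulrDr mulr1 addrAC subrr add0r.
rewrite (@RintegralB _ _ _ mu _ _ _ _ fint expRN_integrable)//.
by rewrite /Rintegral h expRN_integral /= addrAC subrr add0r.
Qed.

End ExpWindow.

Lemma pk_integral_le (e a b t : R) : 0 < e -> a < b ->
  \int[mu]_(s in `[a, b]) pk e (t - s) = atan ((b - t) / e) - atan ((a - t) / e).
Proof.
move=> e0 ab; rewrite /Rintegral.
pose F (s : R) : R := atan ((s - t) / e).
have DF (s : R) : is_derive s 1 F (pk e (t - s)).
  have D1 : is_derive s 1 (fun s => (s - t) / e : R) (e^-1).
    under eq_fun do rewrite mulrC.
    have := @is_deriveZ _ _ _ _ e^-1 s 1 _ (@is_deriveB _ _ _ _ _ s 1 _ _ (is_derive_id s 1) (is_derive_cst t s 1)).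
    move=> h; refine (is_derive_eq h _); rewrite /GRing.scale/= subr0 mulr1//.
  have h := @is_derive1_comp _ (@atan R) (fun s => (s - t) / e) s _ _ (is_derive1_atan _) D1.
  refine (is_derive_eq h _); rewrite /pk.
  have p1 : 0 < 1 + ((s - t) / e) ^+ 2 by rewrite ltr_pwDl ?sqr_ge0.
  have p2 := pk_den_gt0 (t - s) e0.
  field; rewrite ?gt_eqF//.
have DFc s : {for s, continuous F}.
  by apply: differentiable_continuous; apply/derivable1_diffP; case: (DF s).
rewrite (@continuous_FTC2 _ _ F)//.
- apply: continuous_subspaceT => s.
  apply: (@continuous_comp _ _ _ (fun s => t - s) (pk e)); last exact: continuous_pk.
  apply: continuousB; [exact: cst_continuous|exact: id].
- split.
  + by move=> s _; case: (DF s).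
  + by apply: cvg_at_right_filter; exact: DFc.
  + by apply: cvg_at_left_filter; exact: DFc.
- by move=> s _; rewrite derive1E; apply: derive_val.
Qed.


Lemma integrableZl_EFin (D : set R) (f : R -> R) (c : R) : measurable D ->
  mu.-integrable D (EFin \o f) -> mu.-integrable D (EFin \o (fun x => c * f x)).
Proof.
move=> mD i; rewrite (_ : _ \o _ = (fun x => c%:E * (EFin \o f) x)%E).
  exact: (@integrableZl _ _ _ mu D mD).
by apply/funext => x /=; rewrite EFinM.
Qed.

Lemma integrable_mul_bounded (D : set R) (b k : R -> R) (M : R) : measurable D ->
  mu.-integrable D (EFin \o b) -> measurable_fun D k -> (forall y, `|k y| <= M) ->
  mu.-integrable D (EFin \o (fun y => b y * k y)).
Proof.
move=> mD ib mk kM.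
have mb : measurable_fun D b by apply/measurable_EFinP; exact: measurable_int ib.
apply: (@le_integrable _ _ _ mu D mD _ (fun y => M%:E * (b y)%:E)%E).
- by apply/measurable_EFinP; exact: measurable_funM.
- move=> y _; rewrite -EFinM !abse_EFin lee_fin !normrM mulrC ler_wpM2r//.
  exact: le_trans (kM y) (ler_norm M).
- exact: (@integrableZl _ _ _ mu D mD).
Qed.

Lemma Rintegral_mul_bounded (D : set R) (b k : R -> R) (M : R) : measurable D ->
  mu.-integrable D (EFin \o b) -> measurable_fun D k -> (forall y, `|k y| <= M) ->
  `|\int[mu]_(y in D) (b y * k y)| <= M * \int[mu]_(y in D) `|b y|.
Proof.
move=> mD ib mk kM.
have ibk := integrable_mul_bounded mD ib mk kM.
have ibn := @integrable_norm _ _ _ mu D _ ib.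
apply: le_trans (@le_normr_Rintegral _ _ _ mu D _ mD ibk) _.
rewrite -(@RintegralZl _ _ _ mu D _ M mD)//.
apply: (@le_Rintegral _ _ _ mu D _ _ mD).
- exact: (@integrable_norm _ _ _ mu D _ ibk).
- exact: integrableZl_EFin.
- by move=> y _; rewrite normrM mulrC ler_wpM2r.
Qed.

(** The product [M |a x| |b y|] dominates the integrand. Trigonometric kernels and the Poisson
    kernel are both covered. *)
Lemma fubini_bounded (a b : R -> R) (k : R * R -> R) (M : R) :
  mu.-integrable setT (EFin \o a) -> mu.-integrable setT (EFin \o b) ->
  measurable_fun setT k -> (forall z, `|k z| <= M) ->
  mu.-integrable setT (EFin \o (fun x => a x * \int[mu]_y (b y * k (x, y)))) /\
  \int[mu]_x (a x * \int[mu]_y (b y * k (x, y))) =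
  \int[mu]_y (b y * \int[mu]_x (a x * k (x, y))).
Proof.
move=> ia ib mk kM.
have M0 : 0 <= M by apply: le_trans (kM (0, 0)); exact: normr_ge0.
have ma : measurable_fun setT a by apply/measurable_EFinP; exact: measurable_int ia.
have mb : measurable_fun setT b by apply/measurable_EFinP; exact: measurable_int ib.
have mk1 x : measurable_fun setT (fun y => k (x, y)) by apply: measurableT_comp => //; exact: pair1_measurable.
have mk2 y : measurable_fun setT (fun x => k (x, y)) by apply: measurableT_comp => //; exact: pair2_measurable.
pose f (z : R * R) := (a z.1 * b z.2 * k z)%:E.
have mf : measurable_fun setT f.
  apply/measurable_EFinP; apply: measurable_funM => //; apply: measurable_funM.
  - by apply: measurableT_comp => //; exact: measurable_fst.
  - by apply: measurableT_comp => //; exact: measurable_snd.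
have mf2 : measurable_fun setT (abse \o f) by exact: measurableT_comp.
have ik1 x : mu.-integrable setT (EFin \o (fun y => b y * k (x, y))).
  by apply: (@integrable_mul_bounded _ _ _ M).
have ik2 y : mu.-integrable setT (EFin \o (fun x => a x * k (x, y))).
  by apply: (@integrable_mul_bounded _ _ _ M).
have in1 x : (\int[mu]_y f (x, y) = (a x * \int[mu]_y (b y * k (x, y)))%:E)%E.
  rewrite EFinM /Rintegral fineK; last exact: (@integrable_fin_num _ _ _ mu setT measurableT _ (ik1 x)).
  rewrite -(@integralZl _ _ _ mu setT measurableT _ (ik1 x)).
  by apply: eq_integral => y _; rewrite /f/= -EFinM mulrA.
have in2 y : (\int[mu]_x f (x, y) = (b y * \int[mu]_x (a x * k (x, y)))%:E)%E.
  rewrite EFinM /Rintegral fineK; last exact: (@integrable_fin_num _ _ _ mu setT measurableT _ (ik2 y)).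
  rewrite -(@integralZl _ _ _ mu setT measurableT _ (ik2 y)).
  by apply: eq_integral => x _; rewrite /f/= -EFinM; congr EFin; ring.
have fi : (mu \x mu)%E.-integrable setT f.
  apply: ((@integrable12ltyP _ _ _ _ _ mu mu f mf).2).
  pose B := \int[mu]_y `|b y|.
  have ibn := @integrable_norm _ _ _ mu setT _ ib.
  have ian := @integrable_norm _ _ _ mu setT _ ia.
  have BE : (\int[mu]_y (`|b y|)%:E = B%:E)%E.
    by rewrite /B /Rintegral fineK//; exact: (@integrable_fin_num _ _ _ mu setT measurableT _ ibn).
  apply: (@le_lt_trans _ _ (\int[mu]_x ((M * B) * `|a x|)%:E)%E); last first.
    have := integrableZl_EFin (M * B) measurableT ian => /integrableP[_].
    apply: le_lt_trans; apply: ge0_le_integral => //.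
    - move=> x _; rewrite lee_fin !mulr_ge0// /B; exact: Rintegral_ge0.
    - apply/measurable_EFinP; apply: measurable_funM => //; exact: measurableT_comp.
    - apply: measurableT_comp => //.
      apply/measurable_EFinP; apply: measurable_funM => //; exact: measurableT_comp.
    - by move=> x _; exact: lee_abs.
  apply: ge0_le_integral => //.
  - by move=> x _; exact: integral_ge0.
  - have h := @measurable_fun_fubini_tonelli_F _ _ _ _ _ mu (abse \o f) mf2 (fun z => abse_ge0 (f z)).
    exact h.
  - apply/measurable_EFinP; apply: measurable_funM => //; exact: measurableT_comp.
  - move=> x _.
    apply: (@le_trans _ _ (\int[mu]_y ((`|a x| * M)%:E * (`|b y|)%:E))%E).
      apply: ge0_le_integral => //.
      + apply: measurableT_comp => //; apply: measurableT_comp => //; exact: pair1_measurable.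
      + apply: emeasurable_funM => //; apply/measurable_EFinP; exact: measurableT_comp.
      + move=> y _; rewrite /f/= -EFinM lee_fin !normrM mulrAC ler_wpM2r// ler_wpM2l//.
    rewrite ge0_integralZl//.
    + by rewrite BE -EFinM lee_fin -[leLHS]mulrA [leLHS]mulrC.
    + by apply/measurable_EFinP; exact: measurableT_comp.
    + by rewrite lee_fin mulr_ge0.
split.
  have := @integrable_fubini_F _ _ _ _ _ mu mu _ fi.
  by apply: (@eq_integrable _ _ _ mu setT measurableT) => x _; rewrite /= -in1.
congr fine; transitivity (\int[mu]_x \int[mu]_y f (x, y))%E.
  by apply: eq_integral => x _; rewrite in1.
transitivity (\int[mu]_y \int[mu]_x f (x, y))%E; first exact: (@Fubini _ _ _ _ _ mu mu _ fi).
by apply: eq_integral => y _; rewrite in2.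
Qed.


Lemma fubini_bounded_sym (a b : R -> R) (k : R * R -> R) (M : R) :
  mu.-integrable setT (EFin \o a) -> mu.-integrable setT (EFin \o b) ->
  measurable_fun setT k -> (forall z, `|k z| <= M) ->
  mu.-integrable setT (EFin \o (fun y => b y * \int[mu]_x (a x * k (x, y)))).
Proof.
move=> ia ib mk kM.
have mk' : measurable_fun setT (fun z : R * R => k (z.2, z.1)).
  apply: (@measurableT_comp _ _ _ _ _ _ k) => //.
  by apply/measurable_fun_pair; [exact: measurable_snd|exact: measurable_fst].
exact: (fubini_bounded ib ia mk' (fun z => kM (z.2, z.1))).1.
Qed.

Lemma mulr_le_half_sqrD (x y : R) : x * y <= 2^-1 * x ^+ 2 + 2^-1 * y ^+ 2.
Proof. have := sqr_ge0 (x - y); rewrite sqrrB; lra. Qed.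

Lemma ae_neq (a : R) : {ae mu, forall x, x <> a}.
Proof.
exists [set a]; split; [exact: measurable_set1|exact: lebesgue_measure_set1|].
by move=> x /= /contrapT.
Qed.

Lemma lin_add (V W : lmodType R) (f : V -> W) :
  (forall c u v, f (c *: u + v) = c *: f u + f v) -> forall u v, f (u + v) = f u + f v.
Proof. by move=> h u v; have := h 1 u v; rewrite !scale1r. Qed.

Lemma lin_scale (V W : lmodType R) (f : V -> W) :
  (forall c u v, f (c *: u + v) = c *: f u + f v) -> forall c u, f (c *: u) = c *: f u.
Proof.
move=> h c u; have f0 : f 0 = 0.
  by have := h 1 0 0; rewrite !scale1r addr0 => /(congr1 (fun y => y - f 0)); rewrite addrK subrr.
by have := h c u 0; rewrite f0 !addr0.
Qed.

Section FourierCompact.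
Variable T : R.
Hypothesis T0 : 0 < T.
Local Notation I := (`[0%R, T]%classic : set R).

Definition ft_cos (f : R -> R) (w : R) : R := \int[mu]_(t in I) (f t * cos (w * t)).
Definition ft_sin (f : R -> R) (w : R) : R := \int[mu]_(t in I) (f t * sin (w * t)).

Lemma measurable_mul_comp (g : R -> R) : continuous g ->
  measurable_fun setT (fun z : R * R => g (z.1 * z.2)).
Proof.
move=> cg; apply: (@measurableT_comp _ _ _ _ _ _ g); first exact: continuous_measurable_fun.
apply: measurable_funM; [exact: measurable_fst|exact: measurable_snd].
Qed.

Lemma measurable_cosM (t : R) : measurable_fun [set: R] (fun w => cos (w * t)).
Proof.
apply: (@measurableT_comp _ _ _ _ _ _ (@cos R)).
  by apply: continuous_measurable_fun; exact: continuous_cos.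
exact: measurable_funM.
Qed.

Lemma measurable_sinM (t : R) : measurable_fun [set: R] (fun w => sin (w * t)).
Proof.
apply: (@measurableT_comp _ _ _ _ _ _ (@sin R)).
  by apply: continuous_measurable_fun; exact: continuous_sin.
exact: measurable_funM.
Qed.

Lemma normr_cos_le1 (x : R) : `|cos x| <= 1. Proof. by rewrite ler_norml cos_le1 cos_geN1. Qed.
Lemma normr_sin_le1 (x : R) : `|sin x| <= 1. Proof. by rewrite ler_norml sin_le1 sin_geN1. Qed.

Lemma sqint1_itv : sqint I (fun=> 1).
Proof.
have mI : measurable I by exact: measurable_itv.
split; first exact: measurable_cst.
under eq_integral => x _ do rewrite expr1n.
rewrite (@integral_cst _ _ _ mu I mI) mul1e.
by rewrite [X in (X < _)%E]lebesgue_measure_itv/= lte_fin T0 -EFinB ltry.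
Qed.

Lemma sqint_integrable_itv (f : R -> R) : sqint I f -> mu.-integrable I (EFin \o f).
Proof.
move=> sf; have mI : measurable I by exact: measurable_itv.
have := sqintM mI sf sqint1_itv; rewrite (_ : _ \o _ = EFin \o f)//.
by apply/funext => x /=; rewrite mulr1.
Qed.

(** * Bessel's inequality for one function on [[0, T]] *)

Section OneSignal.
Variable f : R -> R.
Hypothesis fi : mu.-integrable I (EFin \o f).

Let f0 := f \_ I.

Let f0i : mu.-integrable setT (EFin \o f0).
Proof.
rewrite /f0 -restrict_EFin; apply/(integrable_mkcond (mu := mu) (EFin \o f)) => //.
Qed.

Let maskE (k : R -> R) : \int[mu]_(t in I) (f t * k t) = \int[mu]_t (f0 t * k t).
Proof.
rewrite Rintegral_mkcond; apply: eq_Rintegral => t _.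
by rewrite /f0 /patch; case: ifP => //; rewrite mul0r.
Qed.

Lemma ft_cosE w : ft_cos f w = \int[mu]_t (f0 t * cos (w * t)). Proof. exact: maskE. Qed.
Lemma ft_sinE w : ft_sin f w = \int[mu]_t (f0 t * sin (w * t)). Proof. exact: maskE. Qed.

Section Window.
Variable g : R -> R.
Hypotheses (cg : continuous g) (g1 : forall x, `|g x| <= 1).

Let ftg (w : R) : R := \int[mu]_t (f0 t * g (w * t)).

Let mg (t : R) : measurable_fun setT (fun w : R => g (w * t)).
Proof.
apply: (@measurableT_comp _ _ _ _ _ _ g); first exact: continuous_measurable_fun.
exact: measurable_funM.
Qed.

(** Fubini yields measurability only of the transform times an integrable weight; the Gaussian is
    such a weight without zeros, and dividing by it recovers [ftg]. *)
Lemma measurable_ftg : measurable_fun setT ftg.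
Proof.
have [h _] := fubini_bounded (@integrableT_gauss R) f0i (measurable_mul_comp cg) (fun z => g1 _).
have {}h : measurable_fun setT (fun x => gauss_fun x * ftg x) by apply/measurable_EFinP; exact: (measurable_int mu h).
rewrite (_ : ftg = fun x => expR (x ^+ 2) * (gauss_fun x * ftg x)); last first.
  by apply/funext => x; rewrite mulrA /gauss_fun -expRD subrr expR0 mul1r.
apply: measurable_funM => //; apply: (measurableT_comp (@measurable_expR R)).
exact: measurable_funX.
Qed.

Lemma normr_ftg_le w : `|ftg w| <= \int[mu]_t `|f0 t|.
Proof.
have mgw : measurable_fun setT (fun t => g (w * t)).
  by under eq_fun do rewrite mulrC; exact: mg.
have := Rintegral_mul_bounded measurableT f0i mgw (fun y => g1 (w * y)).
by rewrite mul1r.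
Qed.

Variable E : R -> R.
Hypothesis Ei : mu.-integrable setT (EFin \o E).

(** The square of the transform is a double integral in time; once the orders are exchanged, the
    frequency integral acts on [g (w * t) * g (w * s)] alone. The cosine and sine versions add up to
    [cos (w * (t - s))]. *)
Lemma window_square :
  let A t := \int[mu]_s (f0 s * \int[mu]_w (E w * (g (w * t) * g (w * s)))) in
  mu.-integrable setT (EFin \o (fun t => f0 t * A t)) /\
  \int[mu]_w (E w * ftg w ^+ 2) = \int[mu]_t (f0 t * A t).
Proof.
move=> A.
have Efi : mu.-integrable setT (EFin \o (fun w => E w * ftg w)).
  exact: (integrable_mul_bounded measurableT Ei measurable_ftg normr_ftg_le).
have Egi t : mu.-integrable setT (EFin \o (fun w => E w * g (w * t))).
  exact: (integrable_mul_bounded measurableT Ei (mg t) (fun w => g1 _)).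
have AE t : A t = \int[mu]_w ((E w * ftg w) * g (w * t)).
  have [_ h] := fubini_bounded (Egi t) f0i (measurable_mul_comp cg) (fun z => g1 _).
  transitivity (\int[mu]_y (f0 y * \int[mu]_x (E x * g (x * t) * g (x * y)))).
    apply: eq_Rintegral => s _; congr (_ * _); apply: eq_Rintegral => w _; ring.
  by rewrite /= in h; rewrite -h; apply: eq_Rintegral => w _; rewrite /ftg/=; ring.
have [_ h] := fubini_bounded Efi f0i (measurable_mul_comp cg) (fun z => g1 _).
have h2 := fubini_bounded_sym Efi f0i (measurable_mul_comp cg) (fun z => g1 _).
split.
  by apply: (@eq_integrable _ _ _ mu setT measurableT _ _ _ h2) => t _; rewrite /= AE.
transitivity (\int[mu]_x (E x * ftg x * \int[mu]_t (f0 t * g (x * t)))).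
  by apply: eq_Rintegral => w _; rewrite expr2 mulrA.
by rewrite /= in h; rewrite h; apply: eq_Rintegral => t _; rewrite AE.
Qed.

Lemma window_kernel_integrable t :
  mu.-integrable setT (EFin \o (fun s => f0 s * \int[mu]_w (E w * (g (w * t) * g (w * s))))).
Proof.
have Egi : mu.-integrable setT (EFin \o (fun w => E w * g (w * t))).
  exact: (integrable_mul_bounded measurableT Ei (mg t) (fun w => g1 _)).
have h := fubini_bounded_sym Egi f0i (measurable_mul_comp cg) (fun z => g1 _).
apply: (@eq_integrable _ _ _ mu setT measurableT _ _ _ h) => s _ /=.
by congr (_ * _)%:E; apply: eq_Rintegral => w _; rewrite mulrA.
Qed.

End Window.

(* Abel summation: weighting the energy of the transform by exp (- e w) turns it
   into a double integral against the kernel [pk e], of total mass at most pi. *)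
Section Abel.
Variable e : R.
Hypothesis e0 : 0 < e.
Let E : R -> R := (fun w => expR (- e * w)) \_ `[0%R, +oo[.

Let Ei : mu.-integrable setT (EFin \o E).
Proof.
rewrite /E -restrict_EFin; apply/(integrable_mkcond (mu := mu) (EFin \o _)) => //.
exact: expRN_integrable.
Qed.

Lemma abel_square :
  \int[mu]_w (E w * (ft_cos f w ^+ 2 + ft_sin f w ^+ 2)) =
  \int[mu]_t (f0 t * \int[mu]_s (f0 s * pk e (t - s))) /\
  mu.-integrable setT (EFin \o (fun t => f0 t * \int[mu]_s (f0 s * pk e (t - s)))).
Proof.
have [ic hc] := window_square (@continuous_cos R) normr_cos_le1 Ei.
have [js hs] := window_square (@continuous_sin R) normr_sin_le1 Ei.
have kc t := window_kernel_integrable (@continuous_cos R) normr_cos_le1 Ei t.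
have ks t := window_kernel_integrable (@continuous_sin R) normr_sin_le1 Ei t.
have sq (g : R -> R) : continuous g -> (forall x, `|g x| <= 1) ->
    mu.-integrable setT (EFin \o (fun w => E w * (\int[mu]_t (f0 t * g (w * t))) ^+ 2)).
  move=> cg g1; pose B := \int[mu]_t `|f0 t|.
  apply: (@integrable_mul_bounded _ _ _ (B ^+ 2)) => //.
    by apply: measurable_funX; exact: measurable_ftg.
  move=> y; rewrite normrX ler_pXn2r ?nnegrE//; first exact: normr_ftg_le.
  by rewrite /B; apply: Rintegral_ge0.
have trig (g : R -> R) (t s : R) : continuous g -> (forall x, `|g x| <= 1) ->
    mu.-integrable setT (EFin \o (fun w => E w * (g (w * t) * g (w * s)))).
  move=> cg g1; have mg (r : R) : measurable_fun setT (fun w : R => g (w * r)).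
    apply: (@measurableT_comp _ _ _ _ _ _ g); first exact: continuous_measurable_fun.
    exact: measurable_funM.
  apply: (@integrable_mul_bounded _ _ _ 1) => //; first exact: measurable_funM.
  by move=> w; rewrite normrM mulr_ile1.
have kerE t s : \int[mu]_w (E w * (cos (w * t) * cos (w * s))) +
    \int[mu]_w (E w * (sin (w * t) * sin (w * s))) = pk e (t - s).
  rewrite -(@RintegralD _ _ _ mu setT _ _ measurableT
    (trig _ t s (@continuous_cos R) normr_cos_le1) (trig _ t s (@continuous_sin R) normr_sin_le1)).
  rewrite -(expRN_cos_integral e0) [RHS]Rintegral_mkcond; apply: eq_Rintegral => w _.
  rewrite -mulrDr -cosB -mulrBr /E /patch; case: ifP => //; by rewrite mul0r.
have AE t : \int[mu]_s (f0 s * pk e (t - s)) =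
    \int[mu]_s (f0 s * \int[mu]_w (E w * (cos (w * t) * cos (w * s)))) +
    \int[mu]_s (f0 s * \int[mu]_w (E w * (sin (w * t) * sin (w * s)))).
  rewrite -(@RintegralD _ _ _ mu setT _ _ measurableT (kc t) (ks t)).
  by apply: eq_Rintegral => s _; rewrite -mulrDr kerE.
split; last first.
  have := @integrableD _ _ _ mu setT measurableT _ _ ic js.
  apply: (@eq_integrable _ _ _ mu setT measurableT) => t _ /=.
  by rewrite -EFinD -mulrDr AE.
transitivity (\int[mu]_w (E w * (\int[mu]_t (f0 t * cos (w * t))) ^+ 2 +
                          E w * (\int[mu]_t (f0 t * sin (w * t))) ^+ 2)).
  by apply: eq_Rintegral => w _; rewrite ft_cosE ft_sinE mulrDr.
rewrite (@RintegralD _ _ _ mu setT _ _ measurableT (sq _ (@continuous_cos R) normr_cos_le1)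
   (sq _ (@continuous_sin R) normr_sin_le1)) hc hs.
rewrite -(@RintegralD _ _ _ mu setT _ _ measurableT ic js).
by apply: eq_Rintegral => t _; rewrite -mulrDr AE.
Qed.

End Abel.

Lemma measurable_pkB (e : R) : 0 < e -> measurable_fun setT (fun z : R * R => pk e (z.1 - z.2)).
Proof.
move=> e0; apply: (@measurableT_comp _ _ _ _ _ _ (pk e)).
  by apply: continuous_measurable_fun; exact: continuous_pk.
by apply: measurable_funB; [exact: measurable_fst|exact: measurable_snd].
Qed.

Hypothesis sf : sqint I f.

(** Schur's test: [f0 t * f0 s] is at most the half sum of the squares, the kernel is symmetric, and
    its integral over [[0, T]] in one variable stays below pi. *)
Lemma abel_square_le (e : R) : 0 < e ->
  \int[mu]_t (f0 t * \int[mu]_s (f0 s * pk e (t - s))) <= pi * \int[mu]_(t in I) (f t ^+ 2).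
Proof.
move=> e0; have [_ ji] := abel_square e0.
pose one : R -> R := (cst (1 : R)) \_ I.
pose sq : R -> R := (fun t => f0 t ^+ 2).
have mI : measurable I by exact: measurable_itv.
have oneE s : one s = (s \in I)%:R by rewrite /one /patch; case: ifP.
have onei : mu.-integrable setT (EFin \o one).
  rewrite /one -restrict_EFin; apply/(integrable_mkcond (mu := mu) (EFin \o _)) => //.
  exact: sqint_integrable_itv sqint1_itv.
have sqi : mu.-integrable setT (EFin \o sq).
  rewrite (_ : sq = (fun t => f t ^+ 2) \_ I); last first.
    by apply/funext => t; rewrite /sq /f0 /patch; case: ifP => //; rewrite expr0n.
  rewrite -restrict_EFin; apply/(integrable_mkcond (mu := mu) (EFin \o _)) => //.
  exact: sqint_integrable.
have pkb (z : R * R) : `|pk e (z.1 - z.2)| <= e^-1.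
  by rewrite ger0_norm ?pk_ge0// pk_le.
have [i1 h1] := fubini_bounded sqi onei (measurable_pkB e0) pkb.
have i2 := fubini_bounded_sym sqi onei (measurable_pkB e0) pkb.
pose X := \int[mu]_t (sq t * \int[mu]_s (one s * pk e (t - s))).
have W t : \int[mu]_s (one s * pk e (t - s)) <= pi.
  have -> : \int[mu]_s (one s * pk e (t - s)) = \int[mu]_(s in I) (pk e (t - s)).
    rewrite [RHS]Rintegral_mkcond; apply: eq_Rintegral => s _.
    by rewrite oneE /patch; case: ifP; rewrite ?mul1r ?mul0r.
  rewrite (pk_integral_le _ e0 T0).
  rewrite [leRHS]splitr; apply/ltW/ltrD; first exact: atan_ltpi2.
  by rewrite ltrNl; exact: atan_gtNpi2.
have W0 t : 0 <= \int[mu]_s (one s * pk e (t - s)).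
  apply: Rintegral_ge0 => s _; rewrite mulr_ge0 ?pk_ge0//.
  by rewrite oneE.
apply: (@le_trans _ _ X); last first.
  rewrite -(@RintegralZl _ _ _ mu I _ pi mI (sqint_integrable sf)).
  rewrite [leRHS]Rintegral_mkcond; apply: (@le_Rintegral _ _ _ mu setT _ _ measurableT i1).
    rewrite -restrict_EFin; apply/(integrable_mkcond (mu := mu) (EFin \o _)) => //.
    exact: integrableZl_EFin (sqint_integrable sf).
  move=> t _; rewrite /sq /f0 /patch; case: ifP => _; last by rewrite expr0n mul0r.
  by rewrite mulrC; apply: ler_wpM2r; [exact: sqr_ge0|exact: W].
have XE : X = \int[mu]_s (one s * \int[mu]_t (sq t * pk e (s - t))).
  rewrite /X h1 /=; apply: eq_Rintegral => s _; congr (_ * _).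
  by apply: eq_Rintegral => t _; rewrite -pkN opprB.
pose H t := \int[mu]_s (sq s * pk e (t - s)).
have Hi : mu.-integrable setT (EFin \o (fun t => one t * H t)).
  apply: (@eq_integrable _ _ _ mu setT measurableT _ _ _ i2) => t _ /=.
  by congr (_ * _)%:E; apply: eq_Rintegral => s _; rewrite -pkN opprB.
have mpk (t : R) : measurable_fun setT (fun s : R => pk e (t - s)).
  apply: (@measurableT_comp _ _ _ _ _ _ (pk e)); last exact: measurable_funB.
  by apply: continuous_measurable_fun; exact: continuous_pk.
have pkb1 t s : `|pk e (t - s)| <= e^-1 by exact: (pkb (t, s)).
have ib (h : R -> R) t : mu.-integrable setT (EFin \o h) ->
    mu.-integrable setT (EFin \o (fun s => h s * pk e (t - s))).
  by move=> hi; apply: (integrable_mul_bounded measurableT hi (mpk t) (pkb1 t)).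
(* By symmetry of the kernel both halves of [Y] have integral [X / 2]. *)
pose Y t := 2^-1 * (sq t * \int[mu]_s (one s * pk e (t - s))) + 2^-1 * (one t * H t).
have XS : \int[mu]_x (sq x * \int[mu]_y (one y * pk e ((x, y).1 - (x, y).2))) = X.
  by rewrite /X; apply: eq_Rintegral => t _; congr (_ * _).
have XH : \int[mu]_x (one x * H x) = X by exact: (esym XE).
clearbody X.
have ia1 := integrableZl_EFin 2^-1 measurableT i1.
have ia2 := integrableZl_EFin 2^-1 measurableT Hi.
have XY : X = \int[mu]_t (Y t).
  rewrite /Y (@RintegralD _ _ _ mu setT _ _ measurableT ia1 ia2).
  rewrite (@RintegralZl _ _ _ mu setT _ 2^-1 measurableT i1).
  rewrite (@RintegralZl _ _ _ mu setT _ 2^-1 measurableT Hi).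
  by rewrite XS XH ![2^-1 * _]mulrC -splitr.
rewrite XY; apply: (@le_Rintegral _ _ _ mu setT _ _ measurableT ji).
  exact: (@integrableD _ _ _ mu setT measurableT _ _ ia1 ia2).
move=> t _; rewrite /Y.
have [tI|tI] := boolP (t \in I); last first.
  have f0t : f0 t = 0 by rewrite /f0 /patch (negPf tI).
  by rewrite oneE (negPf tI) /sq f0t expr0n !mul0r !mulr0 addr0.
have ot : one t = 1 by rewrite oneE tI.
rewrite ot mul1r -/(H t).
rewrite -(@RintegralZl _ _ _ mu setT _ (f0 t) measurableT (ib _ t f0i)).
rewrite -(@RintegralZl _ _ _ mu setT _ (sq t) measurableT (ib _ t onei)).
have ib1 := integrableZl_EFin 2^-1 measurableT (integrableZl_EFin (sq t) measurableT (ib _ t onei)).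
have ib2 := integrableZl_EFin 2^-1 measurableT (ib _ t sqi).
rewrite -(@RintegralZl _ _ _ mu setT _ 2^-1 measurableT (integrableZl_EFin (sq t) measurableT (ib _ t onei))).
rewrite /H -(@RintegralZl _ _ _ mu setT _ 2^-1 measurableT (ib _ t sqi)).
rewrite -(@RintegralD _ _ _ mu setT _ _ measurableT ib1 ib2).
apply: (@le_Rintegral _ _ _ mu setT _ _ measurableT).
- exact: integrableZl_EFin (ib _ t f0i).
- exact: (@integrableD _ _ _ mu setT measurableT _ _ ib1 ib2).
- move=> s _; have := pk_ge0 (t - s) e0; move: (pk e (t - s)) => p p0.
  rewrite mulrA [leRHS](_ : _ = (2^-1 * (sq t * one s) + 2^-1 * sq s) * p); last by ring.
  apply: ler_wpM2r => //; rewrite oneE /sq; have [sI|sI] := boolP (s \in I).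
    by rewrite mulr1 mulr_le_half_sqrD.
  have -> : f0 s = 0 by rewrite /f0 /patch (negPf sI).
  by rewrite !mulr0 expr0n mulr0 addr0.
Qed.

Lemma ft_even_sqr w : ft_cos f (- w) ^+ 2 + ft_sin f (- w) ^+ 2 = ft_cos f w ^+ 2 + ft_sin f w ^+ 2.
Proof.
have -> : ft_cos f (- w) = ft_cos f w.
  by apply: eq_Rintegral => t _; rewrite mulNr cosN.
have -> : ft_sin f (- w) = -1 * ft_sin f w.
  rewrite !ft_sinE -(@RintegralZl _ _ _ mu setT _ (-1) measurableT).
    by apply: eq_Rintegral => t _; rewrite mulNr sinN; ring.
  apply: (@integrable_mul_bounded _ _ _ 1) => //.
    by under eq_fun do rewrite mulrC; exact: measurable_sinM.
  by move=> t; exact: normr_sin_le1.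
by rewrite mulN1r sqrrN.
Qed.

Lemma measurable_ft_cos : measurable_fun setT (ft_cos f).
Proof.
have := measurable_ftg (@continuous_cos R) normr_cos_le1.
by rewrite (_ : ft_cos f = fun w => \int[mu]_t (f0 t * cos (w * t)))//; apply/funext => w; exact: ft_cosE.
Qed.

Lemma measurable_ft_sin : measurable_fun setT (ft_sin f).
Proof.
have := measurable_ftg (@continuous_sin R) normr_sin_le1.
by rewrite (_ : ft_sin f = fun w => \int[mu]_t (f0 t * sin (w * t)))//; apply/funext => w; exact: ft_sinE.
Qed.

Let P w := ft_cos f w ^+ 2 + ft_sin f w ^+ 2.

Let P0 w : 0 <= P w. Proof. by rewrite addr_ge0 ?sqr_ge0. Qed.

Let mP : measurable_fun setT P.
Proof.
by apply: measurable_funD; apply: measurable_funX; [exact: measurable_ft_cos|exact: measurable_ft_sin].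
Qed.

Lemma abel_squareE (e : R) : 0 < e ->
  (\int[mu]_(w in `[0%R, +oo[) (expR (- e * w) * P w)%:E =
   (\int[mu]_t (f0 t * \int[mu]_s (f0 s * pk e (t - s))))%:E)%E.
Proof.
move=> e0; have [h _] := abel_square e0.
have Pi : mu.-integrable `[0%R, +oo[ (EFin \o (fun w => expR (- e * w) * P w)).
  pose B := \int[mu]_t `|f0 t|.
  apply: (@integrable_mul_bounded _ _ _ (B ^+ 2 + B ^+ 2)).
  - exact: measurable_itv.
  - exact: expRN_integrable.
  - exact: measurable_funTS.
  have B0 : 0 <= B by apply: Rintegral_ge0.
  have sq (g : R -> R) w : continuous g -> (forall x, `|g x| <= 1) ->
      (\int[mu]_t (f0 t * g (w * t))) ^+ 2 <= B ^+ 2.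
    move=> cg g1; rewrite -(real_normK (num_real (\int[mu]_t _))).
    by rewrite ler_pXn2r ?nnegrE//; exact: normr_ftg_le.
  move=> w; rewrite ger0_norm// /P ft_cosE ft_sinE; apply: lerD; apply: sq.
  - exact: continuous_cos.
  - exact: normr_cos_le1.
  - exact: continuous_sin.
  - exact: normr_sin_le1.
transitivity ((\int[mu]_(w in `[0%R, +oo[) (expR (- e * w) * P w))%:E).
  rewrite /Rintegral fineK//.
  exact: (@integrable_fin_num _ _ _ mu _ (measurable_itv _) _ Pi).
congr EFin; rewrite -h Rintegral_mkcond; apply: eq_Rintegral => w _.
by rewrite /patch; case: ifP => //; rewrite mul0r.
Qed.


(** The Abel weights tend to 1 as [e = invS R k] tends to 0, and Fatou keeps the uniform bound of
    [abel_square_le]. *)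
Lemma half_line_energy_le :
  (\int[mu]_(w in `[0%R, +oo[) (P w)%:E <= (pi * \int[mu]_(t in I) (f t ^+ 2))%:E)%E.
Proof.
apply: (@fatou_bound _ `[0%R, +oo[ (fun k w => expR (- invS R k * w) * P w)).
- exact: measurable_itv.
- move=> k; apply: measurable_funM; last exact: measurable_funTS.
  apply: (measurableT_comp (@measurable_expR R)); exact: measurable_funM.
- exact: measurable_funTS.
- by move=> k w; rewrite mulr_ge0 ?expR_ge0.
- exact: P0.
- apply: aeW => w _; rewrite -[X in _ --> X]mul1r; apply: cvgM; last exact: cvg_cst.
  rewrite -expR0; apply: continuous_cvg; first exact: continuous_expR.
  rewrite -(mul0r w); apply: cvgM; last exact: cvg_cst.
  rewrite -oppr0; apply: cvgN; exact: cvg_harmonic.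
- by move=> k; rewrite abel_squareE ?invS_gt0// lee_fin abel_square_le// invS_gt0.
Qed.

Lemma energyE : (\int[mu]_w (P w)%:E = 2%:E * \int[mu]_(w in `[0%R, +oo[) (P w)%:E)%E.
Proof.
have mPE : measurable_fun setT (fun w => (P w)%:E) by apply/measurable_EFinP.
have -> : [set: R] = `]-oo, 0%R] `|` `]0%R, +oo[.
  by rewrite -setCitvl setUv.
rewrite ge0_integral_setU//=; last 3 first.
- by apply: measurable_funTS.
- by move=> w _; rewrite lee_fin.
- by apply/disj_setPS => x /=; rewrite !in_itv/= andbT => -[h1 h2]; move: (lt_le_trans h2 h1); rewrite ltxx.
rewrite integral_itv_obnd_cbnd; last by apply: measurable_funTS.
have P0E w : (0 <= (P w)%:E)%E by rewrite lee_fin.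
have sub := @ge0_integration_by_substitution0 R (fun w => (P w)%:E) mPE P0E.
rewrite sub.
have -> : (\int[mu]_(w in `]-oo, 0%R]) (P (- w))%:E = \int[mu]_(w in `]-oo, 0%R]) (P w)%:E)%E.
  by apply: eq_integral => w _; rewrite /P ft_even_sqr.
by rewrite -[(_ + _)%E]mule2n -mule_natl.
Qed.

Lemma energy_le : (\int[mu]_w (P w)%:E <= (2 * pi * \int[mu]_(t in I) (f t ^+ 2))%:E)%E.
Proof.
by rewrite energyE -mulrA EFinM lee_pmul2l// half_line_energy_le.
Qed.

Lemma ft_sqint : sqint setT (ft_cos f) /\ sqint setT (ft_sin f).
Proof.
have h (g : R -> R) : measurable_fun setT g -> (forall w, g w ^+ 2 <= P w) -> sqint setT g.
  move=> mg gP; split => //; apply: le_lt_trans (_ : (\int[mu]_w (P w)%:E < +oo)%E).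
    apply: ge0_le_integral => //.
    - by move=> w _; rewrite lee_fin sqr_ge0.
    - by apply/measurable_EFinP; exact: measurable_funX.
    - exact/measurable_EFinP.
    - by move=> w _; rewrite lee_fin gP.
  by apply: le_lt_trans energy_le _; rewrite ltry.
split; apply: h.
- exact: measurable_ft_cos.
- by move=> w; rewrite lerDl sqr_ge0.
- exact: measurable_ft_sin.
- by move=> w; rewrite lerDr sqr_ge0.
Qed.

Lemma abel_le_energy (e : R) : 0 < e ->
  ((\int[mu]_t (f0 t * \int[mu]_s (f0 s * pk e (t - s))))%:E <=
   \int[mu]_(w in `[0%R, +oo[) (P w)%:E)%E.
Proof.
move=> e0; rewrite -abel_squareE//; apply: ge0_le_integral => //.
- by move=> w _; rewrite lee_fin mulr_ge0 ?expR_ge0.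
- apply/measurable_EFinP; apply: measurable_funM; last exact: measurable_funTS.
  apply: (measurableT_comp (@measurable_expR R)); exact: measurable_funM.
- apply/measurable_EFinP; exact: measurable_funTS.
- move=> w; rewrite /= in_itv/= andbT => w0; rewrite lee_fin ler_piMl//.
  by rewrite -expR0 ler_expR mulNr oppr_le0 mulr_ge0// ltW.
Qed.

End OneSignal.


(** * Equality in Bessel's inequality for the indicator of [[0, b]] *)

Section Step.
Variable b : R.
Hypotheses (b0 : 0 < b) (bT : b <= T).
Let st (t : R) : R := if t <= b then 1 else 0.

Lemma sqint_step : sqint I st.
Proof.
have mst : measurable_fun setT st.
  rewrite (_ : st = \1_(`]-oo, b]%classic)); first exact: measurable_indic.
  by apply/funext => t; rewrite /st indicE mem_setE in_itv/=; case: (t <= b).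
split; first exact: measurable_funTS.
apply: le_lt_trans (sqint1_itv).2; apply: ge0_le_integral => //.
- by move=> t _; rewrite lee_fin sqr_ge0.
- by apply/measurable_EFinP; apply: measurable_funX; exact: measurable_funTS.
- by move=> t _; rewrite lee_fin /st; case: (t <= b); rewrite ?expr0n ?expr1n.
Qed.

(** For an indicator the inner kernel integral is a difference of arctangents and tends to pi inside
    the interval. The Abel sums lie below the energy, which is therefore at least [pi * b]. *)
Lemma step_energy :
  ((pi * b)%:E <= \int[mu]_(w in `[0%R, +oo[) (ft_cos st w ^+ 2 + ft_sin st w ^+ 2)%:E)%E.
Proof.
have si := sqint_integrable_itv sqint_step.
(* The interval is open: at its end points the kernel mass tends to [pi / 2] only. *)
pose D := `]0%R, b[%classic : set R.
have mD : measurable D by exact: measurable_itv.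
pose W (e t : R) : R := \int[mu]_(s in `[0%R, b]) pk e (t - s).
have WE e t : 0 < e -> W e t = atan ((b - t) / e) - atan ((0 - t) / e) by move=> e0; exact: pk_integral_le.
have D_pi : (\int[mu]_(t in D) (pi : R)%:E = (pi * b)%:E)%E.
  rewrite (@integral_cst _ _ _ mu D mD) [X in (_ * X)%E]lebesgue_measure_itv/= lte_fin b0 -EFinB subr0.
  by rewrite -EFinM.
rewrite -D_pi.
have stE t : (st \_ I) t = (t \in (`[0%R, b]%classic : set R))%:R.
  rewrite /patch /st !mem_setE !in_itv/=; have [t0|t0] := leP 0 t => //=.
  by have [tb|tb] := leP t b => //=; rewrite ?(le_trans tb bT)//=; case: ifP.
apply: (@fatou_bound _ D (fun k t => W (invS R k) t) (fun=> pi)).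
- by [].
- move=> k; apply: measurable_funTS.
  have e0 := invS_gt0 R k.
  rewrite (_ : (fun t => _) = fun t => atan ((b - t) / invS R k) - atan ((0 - t) / invS R k)); last first.
    by apply/funext => t; rewrite WE.
  have m c : measurable_fun setT (fun t : R => atan ((c - t) / invS R k)).
    apply: (@measurableT_comp _ _ _ _ _ _ (@atan R)).
      by apply: continuous_measurable_fun; exact: continuous_atan.
    by apply: measurable_funM => //; exact: measurable_funB.
  by apply: measurable_funB; exact: m.
- exact: measurable_cst.
- by move=> k t; apply: Rintegral_ge0 => s _; rewrite pk_ge0// invS_gt0.
- by move=> t; exact: pi_ge0.
- apply: aeW => t; rewrite /D /= in_itv/= => /andP[t0 tb].
  have at_cvg c : 0 < c -> (fun k => atan (c / invS R k)) @ \oo --> (pi / 2 : R).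
    move=> c0; have h : (fun k => c / invS R k) @ \oo --> +oo%R.
      rewrite /invS; under eq_fun do rewrite invrK.
      apply/cvgryPge => A; exists (Num.bound (`|A| / c)) => // k /= hk.
      rewrite mulrC -ler_pdivrMr//; apply: le_trans (_ : `|A| / c <= _).
        by rewrite ler_pM2r ?invr_gt0// ler_norm.
      apply/ltW; apply: lt_le_trans (archi_boundP _) _; first by rewrite divr_ge0// ltW.
      by rewrite ler_nat; apply: leq_trans hk _.
    exact: (cvg_comp _ _ h (@cvgy_atan R)).
  have h : (fun k => atan ((b - t) / invS R k) + atan (t / invS R k)) @ \oo --> (pi / 2 + pi / 2 : R).
    by apply: cvgD; apply: at_cvg => //; rewrite subr_gt0.
  rewrite -splitr in h; apply: cvg_trans h; apply: near_eq_cvg; apply: nearW => k.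
  by rewrite WE ?invS_gt0// sub0r mulNr atanN opprK.
- move=> k; have e0 := invS_gt0 R k.
  apply: (le_trans _ (abel_le_energy si e0)).
  have [_ ji] := abel_square si e0.
  set h := fun t => _ in ji.
  have hE t : h t = (t \in (`[0%R, b]%classic : set R))%:R * W (invS R k) t.
    rewrite /h stE; congr (_ * _); rewrite /W [RHS]Rintegral_mkcond.
    by apply: eq_Rintegral => s _; rewrite stE /patch; case: ifP; rewrite ?mul1r ?mul0r.
  have W0 t : 0 <= W (invS R k) t by apply: Rintegral_ge0 => s _; rewrite pk_ge0.
  rewrite /Rintegral fineK; last exact: (@integrable_fin_num _ _ _ mu setT measurableT _ ji).
  apply: (@le_trans _ _ (\int[mu]_(t in D) (h t)%:E)%E).
    rewrite le_eqVlt; apply/orP; left; apply/eqP; apply: eq_integral => t.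
    rewrite /D mem_setE in_itv/= => /andP[t0 tb]; rewrite hE mem_setE in_itv/= !ltW//= mul1r//.
  apply: ge0_subset_integral => //; first exact: measurable_int ji.
  by move=> t _; rewrite lee_fin hE mulr_ge0.
Qed.

Lemma stepE : (\int[mu]_w (ft_cos st w ^+ 2 + ft_sin st w ^+ 2)%:E = (2 * pi * \int[mu]_(t in I) st t ^+ 2)%:E)%E.
Proof.
have si := sqint_integrable_itv sqint_step.
apply/eqP; rewrite eq_le (energy_le si sqint_step) /= (energyE si) -mulrA EFinM.
rewrite lee_pmul2l//; apply: le_trans step_energy; rewrite lee_fin ler_wpM2l ?pi_ge0//.
rewrite -lee_fin /Rintegral fineK; last first.
  exact: (@integrable_fin_num _ _ _ mu I (measurable_itv _) _ (sqint_integrable sqint_step)).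
apply: (@le_trans _ _ (\int[mu]_(t in `[0%R, b]) (1 : R)%:E)%E); last first.
  rewrite (@integral_cst _ _ _ mu _ (measurable_itv _)) mul1e [X in (X <= _)%E]lebesgue_measure_itv/=.
  by rewrite lte_fin b0 -EFinB subr0.
rewrite integral_mkcond [leRHS]integral_mkcond.
apply: ge0_le_integral => //.
- by move=> t _; rewrite erestrict_ge0// => x _; rewrite lee_fin sqr_ge0.
- apply/(measurable_restrictT _ _).1 => //; apply/measurable_EFinP; apply: measurable_funX.
  exact: sqint_step.1.
- by apply/(measurable_restrictT _ _).1.
- move=> t _; rewrite /patch /st !mem_setE !in_itv/=.
  have [t0|t0] := leP 0 t => //=; have [tb|tb] := leP t b => //=.
    by case: ifP => _; rewrite ?expr1n.
  by case: ifP => _; rewrite ?expr0n.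
Qed.

End Step.

Definition itvT : mset R := MSet (@measurable_itv R `[0%R, T]).
Definition lineT : mset R := MSet (@measurableT _ R).

Lemma sqint_itvT (u : L2 itvT unit) : sqint I (fun t => u t tt).
Proof. exact: (l2P u tt). Qed.

Lemma ft_lin (f g : R -> R) (c : R) (h : R -> R -> R) : sqint I f -> sqint I g ->
  (forall w : R, measurable_fun setT (h w)) -> (forall w t, `|h w t| <= 1) -> forall w,
  \int[mu]_(t in I) ((c * f t + g t) * h w t) =
  c * \int[mu]_(t in I) (f t * h w t) + \int[mu]_(t in I) (g t * h w t).
Proof.
move=> sf sg mh h1 w; have mI : measurable I by exact: measurable_itv.
have ih (k : R -> R) : sqint I k -> mu.-integrable I (EFin \o (fun t => k t * h w t)).
  move=> sk; apply: (integrable_mul_bounded mI (sqint_integrable_itv sk) _ (h1 w)).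
  exact: measurable_funTS.
rewrite -(@RintegralZl _ _ _ mu I _ c mI (ih f sf)).
rewrite -(@RintegralD _ _ _ mu I _ _ mI (integrableZl_EFin c mI (ih f sf)) (ih g sg)).
by apply: eq_Rintegral => t _; ring.
Qed.

Lemma measurable_trigM (w : R) :
  measurable_fun setT (fun t => cos (w * t)) /\ measurable_fun setT (fun t => sin (w * t)).
Proof.
by split; under eq_fun do rewrite mulrC; [exact: measurable_cosM|exact: measurable_sinM].
Qed.

Lemma ft_cos_lin f g c w : sqint I f -> sqint I g ->
  ft_cos (fun t => c * f t + g t) w = c * ft_cos f w + ft_cos g w.
Proof.
move=> sf sg; apply: (ft_lin c (h := fun w t => cos (w * t)) sf sg).
  by move=> x; exact: (measurable_trigM x).1.
by move=> x t; exact: normr_cos_le1.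
Qed.

Lemma ft_sin_lin f g c w : sqint I f -> sqint I g ->
  ft_sin (fun t => c * f t + g t) w = c * ft_sin f w + ft_sin g w.
Proof.
move=> sf sg; apply: (ft_lin c (h := fun w t => sin (w * t)) sf sg).
  by move=> x; exact: (measurable_trigM x).2.
by move=> x t; exact: normr_sin_le1.
Qed.

Definition ft_pair (u : L2 itvT unit) : R -> bool -> R :=
  fun w i => if i then ft_cos (fun t => u t tt) w else ft_sin (fun t => u t tt) w.

Lemma ft_pairP u : inL2on lineT (ft_pair u).
Proof.
have [h1 h2] := ft_sqint (sqint_integrable_itv (sqint_itvT u)) (sqint_itvT u).
by case.
Qed.

Definition ftp (u : L2 itvT unit) : L2 lineT bool := MkL2 (ft_pairP u).

Lemma ftp_lin c u v : ftp (c *: u + v) = c *: ftp u + ftp v.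
Proof.
apply: L2_eq => w [] /=.
- exact: (ft_cos_lin c w (sqint_itvT u) (sqint_itvT v)).
- exact: (ft_sin_lin c w (sqint_itvT u) (sqint_itvT v)).
Qed.

Lemma ip_ftpE u : ((ip (ftp u) (ftp u))%:E =
  \int[mu]_w (ft_cos (fun t => u t tt) w ^+ 2 + ft_sin (fun t => u t tt) w ^+ 2)%:E)%E.
Proof.
rewrite EFin_ip; apply: eq_integral => w _; congr EFin.
by rewrite /dot big_bool/= !expr2.
Qed.

Lemma dot_unit (u v : R -> unit -> R) x : dot u v x = u x tt * v x tt.
Proof. by rewrite /dot (bigD1 tt)//= big1 ?addr0//; case. Qed.

Lemma ip_itvT (u : L2 itvT unit) : ip u u = \int[mu]_(t in I) (u t tt ^+ 2).
Proof. by apply: eq_Rintegral => t _; rewrite dot_unit expr2. Qed.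

Lemma ftp_bessel u : ip (ftp u) (ftp u) <= 2 * pi * ip u u.
Proof.
rewrite -lee_fin ip_ftpE ip_itvT.
exact: (energy_le (sqint_integrable_itv (sqint_itvT u)) (sqint_itvT u)).
Qed.

(** The primitive of [u] vanishes on []0, T]], and by Lebesgue differentiation its derivative is [u]
    almost everywhere. *)
Lemma steps_dense (u : L2 itvT unit) :
  (forall b, 0 < b <= T -> \int[mu]_(t in `[0%R, b]) (u t tt) = 0) -> ip u u = 0.
Proof.
move=> h; pose f t := u t tt; pose f0 := f \_ I.
have ui := sqint_integrable_itv (sqint_itvT u).
have loc : locally_integrable [set: R] f0 by apply: integrable_locally.
have f0i : mu.-integrable setT (EFin \o f0).
  by rewrite /f0 -restrict_EFin; apply/(integrable_mkcond (mu := mu) (EFin \o f)).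
have intf y : mu.-integrable `]-oo, y] (EFin \o f0).
  by apply: (@integrableS _ _ _ mu setT).
have hae := FTC1Ny intf loc.
(* The end points are set aside so that the primitive is constant on a whole neighbourhood of
   [x]. *)
apply: ip_ae_eq0; apply: (ae_mp (ae_and hae (ae_and (ae_neq 0) (ae_neq T)))) => x [[_ dF] [x0 xT]] xI [].
move: xI; rewrite /= in_itv/= => /andP[x0' xT'].
have xp : 0 < x by rewrite lt_neqAle eq_sym x0' andbT; apply/eqP.
have xq : x < T by rewrite lt_neqAle xT' andbT; apply/eqP.
have -> : u x tt = f0 x by rewrite /f0 /patch mem_setE in_itv/= x0' xT'.
rewrite -dF derive1E.
have -> : 'D_1 (fun x0 : R => \int[mu]_(t in [set` `]-oo, x0]]) f0 t) x = 'D_1 (cst (0 : R)) x.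
  apply: near_eq_derive; near=> y.
  have yp : 0 < y by near: y; exact: lt_nbhsr.
  have yq : y < T by near: y; exact: lt_nbhsl.
  rewrite -Rintegral_mkcondr.
  have -> : `]-oo, y] `&` `[0%R, T] = `[0%R, y]%classic :> set R.
    apply/seteqP; split=> t /=; rewrite !in_itv/=.
      by move=> [-> /andP[->]].
    by move=> /andP[-> ty]; split => //; apply: le_trans ty (ltW yq).
  by rewrite h// yp ltW.
exact: derive_cst.
Unshelve. all: by end_near. Qed.

Definition L2_step (b : R) (bP : 0 < b <= T) : L2 itvT unit :=
  @MkL2 R itvT unit (fun t _ => if t <= b then 1 else 0) (fun _ => sqint_step b).

(* By Bessel, 2 pi ||u||^2 - ||F u||^2 is a semi-inner product; it vanishes on the
   indicator functions of [0, b], which are dense. *)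
Lemma ftp_plancherel u : ip (ftp u) (ftp u) = 2 * pi * ip u u.
Proof.
have ipV := ip_semi_inner itvT unit; have [[vDl vDr vZl vZr] vC v0] := ipV.
have [[wDl wDr wZl wZr] wC w0] := ip_semi_inner lineT bool.
have fZ := lin_scale ftp_lin; have fD := lin_add ftp_lin.
pose D (x y : L2 itvT unit) := 2 * pi * ip x y - ip (ftp x) (ftp y).
suff : D u u = 0 by move/eqP; rewrite subr_eq0 => /eqP.
apply: (@dense_semi_inner_eq0 R _ (@ip R itvT unit) ipV (@L2_complete R itvT unit) D
  (fun v => exists b (bP : 0 < b <= T), v = L2_step bP) (2 * pi)).
- split.
  + split.
    * by move=> x x' y; rewrite /D fD vDl wDl mulrDr opprD addrACA.
    * by move=> x y y'; rewrite /D fD vDr wDr mulrDr opprD addrACA.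
    * by move=> c x y; rewrite /D fZ vZl wZl mulrBr mulrCA.
    * by move=> c x y; rewrite /D fZ vZr wZr mulrBr mulrCA.
  + by move=> x y; rewrite /D vC wC.
  + by move=> x; rewrite subr_ge0 ftp_bessel.
- by move=> x; rewrite /D gerBl.
- move=> _ [b [bP ->]]; have /andP[b0 bT] := bP.
  apply/eqP; rewrite subr_eq0; apply/eqP; apply: EFin_inj.
  by rewrite ip_ftpE ip_itvT; rewrite /= (stepE b0 bT).
- move=> x hx; apply: steps_dense => b bP.
  transitivity (ip x (L2_step bP)); last by apply: hx; exists b, bP.
  have /andP[b0 bT] := bP.
  have -> : `[0%R, b]%classic = `[0%R, T] `&` `]-oo, b] :> set R.
    apply/seteqP; split=> t /=; rewrite !in_itv/=.
      by move=> /andP[-> tb]; rewrite tb (le_trans tb bT).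
    by move=> [/andP[-> _] ->].
  rewrite Rintegral_mkcondr; apply: eq_Rintegral => t _.
  rewrite dot_unit/= /patch mem_setE in_itv/=; case: ifP => _; rewrite ?mulr1 ?mulr0//.
Qed.

End FourierCompact.

End Kernel.

(** * Plancherel on the half-line *)

Section LineTransform.
Variable R : realType.
Local Notation mu := (@lebesgue_measure R).

Lemma sqint_subset (A B : set R) (f : R -> R) : measurable A -> measurable B ->
  A `<=` B -> sqint B f -> sqint A f.
Proof.
move=> mA mB AB [mf fi]; split; first exact: measurable_funS mf.
apply: le_lt_trans fi; apply: ge0_subset_integral => //.
- by apply/measurable_EFinP; exact: measurable_funX.
- by move=> x _; rewrite lee_fin sqr_ge0.
Qed.

Lemma Rintegral_sum (D : set R) (I : finType) (f : I -> R -> R) : measurable D ->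
  (forall i, mu.-integrable D (EFin \o f i)) ->
  \int[mu]_(x in D) (\sum_i f i x) = \sum_i \int[mu]_(x in D) f i x.
Proof.
move=> mD fi.
suff [] : mu.-integrable D (EFin \o (fun x => \sum_i f i x)) /\
  \int[mu]_(x in D) (\sum_i f i x) = \sum_i \int[mu]_(x in D) f i x by [].
elim: (index_enum I) => [|i s [IHi IH]].
  rewrite big_nil; under eq_fun do rewrite big_nil; split.
    exact: (@integrable0 _ _ _ mu D).
  by rewrite (@Rintegral_cst _ _ _ mu D mD) mul0r.
rewrite big_cons; under eq_fun do rewrite big_cons; split.
  exact: (@integrableD _ _ _ mu D mD _ _ (fi i) IHi).
by rewrite (@RintegralD _ _ _ mu D _ _ mD (fi i) IHi) IH.
Qed.

Definition slice (D : mset R) (J I : finType) (u : L2 D (J * I)%type) (i : I) : L2 D J :=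
  @MkL2 R D J (fun x j => u x (j, i)) (fun j => l2P u (j, i)).

Lemma ip_slice (D : mset R) (J I : finType) (u v : L2 D (J * I)%type) :
  ip u v = \sum_i ip (slice u i) (slice v i).
Proof.
rewrite -(Rintegral_sum (msetP D) (fun i => dot_integrable (slice u i) (slice v i))).
apply: eq_Rintegral => x _; rewrite /dot exchange_big/= pair_bigA/=.
by apply: eq_bigr => -[].
Qed.

Definition comp1 (D : mset R) (I : finType) (u : L2 D I) (i : I) : L2 D unit :=
  @MkL2 R D unit (fun x _ => u x i) (fun _ => l2P u i).

Lemma ip_comp1 (D : mset R) (I : finType) (u v : L2 D I) :
  ip u v = \sum_i ip (comp1 u i) (comp1 v i).
Proof.
rewrite -(Rintegral_sum (msetP D) (fun i => dot_integrable (comp1 u i) (comp1 v i))).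
by apply: eq_Rintegral => x _; apply: eq_bigr => i _; rewrite dot_unit.
Qed.

Let le_sum3 (a b c : R) : 0 < a -> 0 < b -> 0 < c ->
  [/\ a <= a + b + c, b <= a + b + c & c <= a + b + c].
Proof. by move=> ? ? ?; split; lra. Qed.

Let lt_comb3 (a b c k e : R) : a < e -> b < e -> c < e -> 0 <= k ->
  a + (k * b + c) <= (2 + k) * e.
Proof. by move=> ae be ce k0; have := ler_wpM2l k0 (ltW be); lra. Qed.

Let polar (k y a p c a' q c' : R) : a + 2 * p + c = k * y -> y = a' + 2 * q + c' ->
  a = k * a' -> c = k * c' -> p = k * q.
Proof. by move=> h Ey Ea Ec; subst y a c; lra. Qed.

Let sandwich (s x y a b c e : R) : 0 <= s -> a < e -> b < e ->
  x <= s * c + a -> s * c <= x + a -> y <= c + b -> c <= y -> `|x - s * y| <= (1 + s) * e.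
Proof.
move=> s0 ae be h1 h2 h3 h4; rewrite ler_norml; apply/andP.
have := ler_wpM2l s0 h3; have := ler_wpM2l s0 h4; have := ler_wpM2l s0 (ltW be).
by rewrite mulrDr; split; lra.
Qed.

Lemma semi_inner_eql (V : lmodType R) (ip : V -> V -> R) (ipP : semi_inner ip) x y z :
  hnorm ip (x - y) = 0 -> ip x z = ip y z.
Proof.
move=> h0; have := cauchy_schwarz ipP (x - y) z; rewrite h0 mul0r normr_le0.
have [bP _ _] := ipP; have [Dl _ _ _] := bP; rewrite Dl.
by rewrite (_ : ip (- y) z = - ip y z) ?subr_eq0 => [/eqP|]; last exact: bilinear_formNl.
Qed.

Lemma semi_inner_sqrD (V : lmodType R) (ip : V -> V -> R) (ipP : semi_inner ip) x y :
  ip (x + y) (x + y) = ip x x + 2 * ip x y + ip y y.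
Proof. by have [[Dl Dr _ _] C _] := ipP; rewrite Dl !Dr (C y x); lra. Qed.

Lemma semi_inner_ge0 (V : lmodType R) (ip : V -> V -> R) (ipP : semi_inner ip) x : 0 <= ip x x.
Proof. by case: ipP. Qed.

Definition halfline : mset R := MSet (@measurable_itv R `[0%R, +oo[).

Section Signal.
Variable I : finType.
Local Notation V := (L2 halfline I).
Local Notation W := (L2 (lineT R) (bool * I)%type).

Definition restr (T : R) (T0 : 0 < T) (u : V) (i : I) : L2 (itvT T) unit.
Proof.
refine (@MkL2 R (itvT T) unit (fun t _ => u t i) (fun _ => _)).
apply: sqint_subset (l2P u i) => //; [exact: measurable_itv|exact: measurable_itv|].
by move=> t /=; rewrite !in_itv/= andbT => /andP[].
Defined.

Lemma truncP (T : R) (u : V) : inL2on halfline (fun t i => if t <= T then u t i else 0).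
Proof.
move=> i; have mh : measurable (halfline : set R) by exact: msetP.
have mf : measurable_fun halfline (fun t => if t <= T then u t i else 0).
  apply: measurable_fun_if => //.
  - by apply: measurable_fun_ler => //; exact: measurable_cst.
  - by apply: measurable_funS (l2P u i).1 => //; exact: subIsetl.
split=> //; apply: le_lt_trans (l2P u i).2; apply: ge0_le_integral => //.
- by move=> t _; rewrite lee_fin sqr_ge0.
- by apply/measurable_EFinP; exact: measurable_funX.
- by apply/measurable_EFinP; apply: measurable_funX; exact: (l2P u i).1.
- by move=> t _; rewrite lee_fin; case: ifP => // _; rewrite expr0n sqr_ge0.
Qed.

Definition truncL2 (T : R) (u : V) : V := MkL2 (truncP T u).

Lemma ip_trunc_le T (u : V) : ip (truncL2 T u) (truncL2 T u) <= ip u u.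
Proof.
apply: le_ip_ae; apply: aeW => t _; apply: ler_sum => i _ /=.
by case: ifP => // _; rewrite mulr0 -expr2 sqr_ge0.
Qed.

Definition tail T (u : V) : V := u - truncL2 T u.

Lemma tailE T (u : V) t i : tail T u t i = if t <= T then 0 else u t i.
Proof. by rewrite L2BE /=; case: ifP => _; rewrite ?subrr ?subr0. Qed.

(** Dominated convergence along integer times; real times follow because the energy of the tail
    decreases with [T]. *)
Lemma tail_cvg0 (u : V) e : 0 < e -> exists2 N : R, 0 < N & forall T, N <= T -> ip (tail T u) (tail T u) < e.
Proof.
move=> e0.
pose g (n : nat) (t : R) : \bar R := (dot (tail n.+1%:R u) (tail n.+1%:R u) t)%:E.
have mh : measurable (halfline : set R) by exact: msetP.
have [|||||_ _] := @dominated_convergence _ _ _ mu halfline mh g (cst 0%E) (EFin \o dot u u).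
- by move=> n; exact: (measurable_int mu (dot_integrable _ _)).
- exact: measurable_cst.
- apply: aeW => t _; apply: cvg_near_cst; near=> n.
  rewrite /g /dot big1 // => i _; rewrite tailE ifT ?mul0r//.
  by rewrite (@le_trans _ _ n%:R) ?ler_nat//; near: n; exact: nbhs_infty_ger.
- exact: dot_integrable.
- apply: aeW => t n _; rewrite /g lee_fin ger0_norm ?dot_ge0//.
  by apply: ler_sum => i _; rewrite tailE; case: ifP => // _; rewrite mul0r -expr2 sqr_ge0.
rewrite integral_cst// mul0e => /fine_cvgP[_] /cvgrPdist_lt /(_ e e0)[n _ /(_ n (leqnn n))]/=.
rewrite sub0r normrN => lt_e; exists n.+1%:R => // T nT.
apply: le_lt_trans (le_lt_trans (ler_norm _) lt_e).
apply: le_ip_ae; apply: aeW => t _; apply: ler_sum => i _.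
rewrite !tailE; case: ifPn => [_|]; first by rewrite mul0r -expr2 sqr_ge0.
by rewrite -ltNge => Tt; rewrite ifN// -ltNge (le_lt_trans nT).
Unshelve. all: by end_near. Qed.


(* Component (true, i) is the real and (false, i) the imaginary part of the
   transform of the i-th entry of u. *)
Definition ft_signal (T : R) (u : R -> I -> R) (w : R) (bi : bool * I) : R :=
  if bi.1 then ft_cos T (u^~ bi.2) w else - ft_sin T (u^~ bi.2) w.

Lemma sqint_restr T (T0 : 0 < T) (u : V) i : sqint `[0%R, T] (u^~ i).
Proof. exact: (l2P (restr T0 u i) tt). Qed.

Lemma ft_signalP T (T0 : 0 < T) (u : V) : inL2on (lineT R) (ft_signal T u).
Proof.
move=> [[] i]; have [sc ss] := ft_sqint T0 (sqint_integrable_itv T0 (sqint_restr T0 u i)) (sqint_restr T0 u i).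
  exact: sc.
exact: (sqintN (msetP (lineT R)) ss).
Qed.

Definition FTT T (T0 : 0 < T) (u : V) : W := MkL2 (ft_signalP T0 u).

Lemma FTT_lin T (T0 : 0 < T) c (u v : V) : FTT T0 (c *: u + v) = c *: FTT T0 u + FTT T0 v.
Proof.
apply: L2_eq => w [b i]; rewrite L2DE L2ZE /= /ft_signal/=.
have := ft_cos_lin T0 c w (sqint_restr T0 u i) (sqint_restr T0 v i).
have := ft_sin_lin T0 c w (sqint_restr T0 u i) (sqint_restr T0 v i).
by case: b => // -> _; rewrite opprD mulrN.
Qed.

Lemma ip_FTT T (T0 : 0 < T) (u : V) :
  ip (FTT T0 u) (FTT T0 u) = 2 * pi * ip (truncL2 T u) (truncL2 T u).
Proof.
rewrite ip_slice ip_comp1 mulr_sumr; apply: eq_bigr => i _.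
rewrite (_ : ip (slice _ _) _ = ip (ftp T0 (restr T0 u i)) (ftp T0 (restr T0 u i))); last first.
  apply: eq_Rintegral => w _; rewrite /dot !big_bool/= /ft_signal/= mulrNN.
  by [].
rewrite ftp_plancherel; congr (_ * _).
rewrite ip_itvT /ip Rintegral_mkcond [RHS]Rintegral_mkcond; apply: eq_Rintegral => t _.
rewrite /patch !mem_setE !in_itv/= andbT dot_unit/=.
by case: (0 <= t) => //=; case: ifP => //; rewrite mul0r.
Qed.

Lemma ft_trunc T T' (T0 : 0 < T) (T0' : 0 < T') (u : V) : T <= T' ->
  FTT T0' (truncL2 T u) = FTT T0 u.
Proof.
move=> TT'; apply: L2_eq => w [b i]/=.
suff E (g : R -> R) : \int[mu]_(t in `[0, T']) ((if t <= T then u t i else 0) * g t) =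
    \int[mu]_(t in `[0, T]) (u t i * g t).
  by case: b; rewrite /ft_signal/= /ft_cos /ft_sin E.
rewrite Rintegral_mkcond [RHS]Rintegral_mkcond; apply: eq_Rintegral => t _.
rewrite /patch !mem_setE !in_itv/=; case: (0 <= t) => //=.
case: (leP t T) => [tT|_]; first by rewrite (le_trans tT).
by case: ifP => //; rewrite mul0r.
Qed.

Let W_ip := ip_semi_inner (lineT R) (bool * I)%type.
Let V_ip := ip_semi_inner halfline I.
Local Notation nV := (hnorm (@ip R halfline I)).
Local Notation nW := (hnorm (@ip R (lineT R) (bool * I)%type)).

(** The difference is the transform over [[0, T']] of the tail alone, so Plancherel on an interval
    makes the transforms Cauchy as [T] grows. *)
Lemma FTT_tail T T' (T0 : 0 < T) (T0' : 0 < T') (u : V) : T <= T' ->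
  ip (FTT T0' u - FTT T0 u) (FTT T0' u - FTT T0 u) <= 2 * pi * ip (tail T u) (tail T u).
Proof.
move=> TT'; have -> : FTT T0' u - FTT T0 u = FTT T0' (tail T u).
  rewrite -(ft_trunc T0 T0' u TT') /tail addrC -scaleN1r -FTT_lin scaleN1r.
  by rewrite addrC.
rewrite ip_FTT ler_pM2l ?mulr_gt0 ?pi_gt0//; exact: ip_trunc_le.
Qed.

Lemma FT_cvg (u : V) : exists F : W, forall e : R, 0 < e ->
  exists2 N : R, 0 < N & forall T (T0 : 0 < T), N <= T -> nW (FTT T0 u - F) < e.
Proof.
have near_tail (e : R) : 0 < e -> exists2 N : R, 0 < N &
    forall T T' (T0 : 0 < T) (T0' : 0 < T'), N <= T -> T <= T' -> nW (FTT T0' u - FTT T0 u) < e.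
  move=> e0; have p0 : 0 < 2 * pi :> R by rewrite mulr_gt0 ?pi_gt0.
  have [|N N0 NP] := @tail_cvg0 u (e ^+ 2 / (2 * pi)); first by rewrite divr_gt0 ?exprn_gt0.
  exists N => // T T' T0 T0' NT TT'.
  rewrite -(ltr_pXn2r (_ : 0 < 2)%N) ?nnegrE ?hnorm_ge0 ?(ltW e0)// (sqr_hnorm W_ip).
  apply: le_lt_trans (FTT_tail T0 T0' u TT') _.
  by rewrite mulrC -ltr_pdivlMr//; exact: NP.
have n0 n : 0 < n.+1%:R :> R by [].
have near2 (e : R) : 0 < e -> exists2 N : R, 0 < N &
    forall T T' (T0 : 0 < T) (T0' : 0 < T'), N <= T -> N <= T' -> nW (FTT T0' u - FTT T0 u) < e.
  move=> e0; have [N N0 NP] := near_tail e e0; exists N => // T T' T0 T0' NT NT'.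
  have [TT'|/ltW T'T] := leP T T'; first exact: NP.
  by rewrite (hnormB W_ip); exact: NP.
have [|F FP] := @L2_complete R (lineT R) (bool * I)%type (fun n => FTT (n0 n) u).
  move=> e e0; have [N N0 NP] := near2 e e0.
  have [k Nk] : exists k, N <= k%:R.
    by exists (Num.bound N); rewrite ltW// archi_boundP// ltW.
  by exists k => m n km kn; apply: NP; rewrite (le_trans Nk)// ler_nat ltnW// ltnS.
exists F => e e0; have e20 : 0 < e / 2 by rewrite divr_gt0.
have [N N0 NP] := near2 _ e20; exists N => // T T0 NT.
have [k kP] := FP _ e20.
pose n := maxn k (Num.bound N).
rewrite (splitr e); apply: le_lt_trans (hnorm_triangle W_ip (FTT (n0 n) u) _ _) _.
apply: ltrD; last by apply: kP; exact: leq_maxl.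
apply: NP => //; rewrite (@le_trans _ _ (Num.bound N)%:R)//; first by rewrite ltW// archi_boundP// ltW.
by rewrite ler_nat ltnW// ltnS leq_maxr.
Qed.

(* Choosing the transform inside an opaque constant keeps unification from
   unfolding it. *)
Lemma FT_exists : {F : V -> W | forall u (e : R), 0 < e ->
  exists2 N : R, 0 < N & forall T (T0 : 0 < T), N <= T -> nW (FTT T0 u - F u) < e}.
Proof. by exists (fun u => projT1 (cid (FT_cvg u))) => u; exact: (projT2 (cid (FT_cvg u))). Qed.

Definition FT : V -> W := projT1 FT_exists.

Lemma FTP (u : V) (e : R) : 0 < e ->
  exists2 N : R, 0 < N & forall T (T0 : 0 < T), N <= T -> nW (FTT T0 u - FT u) < e.
Proof. exact: (projT2 FT_exists). Qed.

(** [FT] picks a representative for each signal independently, so linearity holds only up to a null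
    function. *)
Lemma FT_lin c (u v : V) : nW (FT (c *: u + v) - (c *: FT u + FT v)) = 0.
Proof.
apply/eqP; rewrite eq_le hnorm_ge0 andbT; apply: (@le_vanish _ _ (2 + `|c|)) => e /andP[e0 _].
have [N1 N10 P1] := FTP (c *: u + v) e0; have [N2 N20 P2] := FTP u e0.
have [N3 N30 P3] := FTP v e0.
pose T := N1 + N2 + N3; have T0 : 0 < T by rewrite !addr_gt0.
have {}P1 := P1 T T0; have {}P2 := P2 T T0; have {}P3 := P3 T T0.
apply: le_trans (hnorm_triangle W_ip (FTT T0 (c *: u + v)) _ _) _.
have -> : FTT T0 (c *: u + v) - (c *: FT u + FT v) =
    c *: (FTT T0 u - FT u) + (FTT T0 v - FT v).
  by rewrite FTT_lin scalerBr opprD addrACA.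
rewrite (hnormB W_ip).
apply: le_trans (lerD (lexx _) (hnormD W_ip _ _)) _; rewrite (hnormZ W_ip).
by have [l1 l2 l3] := le_sum3 N10 N20 N30; apply: lt_comb3; [exact: P1|exact: P2|exact: P3|].
Qed.

Lemma FT_plancherel (u : V) : ip (FT u) (FT u) = 2 * pi * ip u u.
Proof.
have p0 : 0 < 2 * pi :> R by rewrite mulr_gt0 ?pi_gt0.
suff E : nW (FT u) = Num.sqrt (2 * pi) * nV u.
  by rewrite -(sqr_hnorm W_ip) E exprMn sqr_sqrtr ?(ltW p0)// (sqr_hnorm V_ip).
have tE T (T0 : 0 < T) : nW (FTT T0 u) = Num.sqrt (2 * pi) * nV (truncL2 T u).
  by rewrite /hnorm ip_FTT sqrtrM// ltW.
suff : `|nW (FT u) - Num.sqrt (2 * pi) * nV u| <= 0 by rewrite normr_le0 subr_eq0 => /eqP.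
apply: (@le_vanish _ _ (1 + Num.sqrt (2 * pi))) => e /andP[e0 _].
have [N1 N10 P1] := FTP u e0.
have [|N2 N20 P2] := @tail_cvg0 u (e ^+ 2); first by rewrite exprn_gt0.
pose T := N1 + N2; have T0 : 0 < T by rewrite addr_gt0.
have {}P1 : nW (FTT T0 u - FT u) < e by apply: P1; rewrite lerDl ltW.
have {}P2 : nV (tail T u) < e.
  rewrite -(ltr_pXn2r (_ : 0 < 2)%N) ?nnegrE ?hnorm_ge0 ?(ltW e0)// (sqr_hnorm V_ip).
  by apply: P2; rewrite lerDr ltW.
apply: (sandwich (c := nV (truncL2 T u)) (sqrtr_ge0 _) P1 P2); rewrite -?tE.
- by have := hnormD W_ip (FTT T0 u) (FT u - FTT T0 u); rewrite addrC subrK (hnormB W_ip (FT u)).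
- by have := hnormD W_ip (FT u) (FTT T0 u - FT u); rewrite addrC subrK.
- by have := hnormD V_ip (truncL2 T u) (tail T u); rewrite addrC subrK.
- by rewrite /hnorm ler_wsqrtr// ip_trunc_le.
Qed.

Lemma FT_ip (u v : V) : ip (FT u) (FT v) = 2 * pi * ip u v.
Proof.
have [_ C _] := W_ip.
have E : ip (FT (u + v)) (FT (u + v)) = ip (FT u + FT v) (FT u + FT v).
  have := FT_lin 1 u v; rewrite !scale1r => h0.
  by rewrite (semi_inner_eql W_ip _ h0) C (semi_inner_eql W_ip _ h0) C.
have E1 := semi_inner_sqrD W_ip (FT u) (FT v); have E2 := semi_inner_sqrD V_ip u v.
exact: polar (etrans (esym E1) (etrans (esym E) (FT_plancherel _))) E2 (FT_plancherel u) (FT_plancherel v).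
Qed.

End Signal.

(** The frequency response speaks only of signals that have a transform; this provides one for every
    square-integrable signal. *)
Lemma is_FT_FT n (u : L2 halfline 'I_n) :
  is_FT u (fun w i => Complex (FT u w (true, i)) (FT u w (false, i))).
Proof.
move=> i; split; first exact: (l2P (FT u) (true, i)).1.
split; first exact: (l2P (FT u) (false, i)).1.
set F := (X in X @ _ --> _).
have FE T (T0 : 0 < T) : F T = (ip (slice (FTT T0 u - FT u) i) (slice (FTT T0 u - FT u) i))%:E.
  by rewrite EFin_ip; apply: eq_integral => w _; rewrite /dot big_bool/= !expr2.
apply/fine_cvgP; split.
  by near=> T; have T0 : 0 < T by []; rewrite (FE T T0).
apply/cvgrPdist_lt => e e0; have s0 : 0 < Num.sqrt e by rewrite sqrtr_gt0.
have [N N0 NP] := FTP u s0.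
near=> T; have T0 : 0 < T by []; rewrite sub0r normrN /= -/(F T) (FE T T0)/=.
rewrite ger0_norm; last exact: (semi_inner_ge0 (ip_semi_inner _ _)).
have NT : N <= T by [].
have := NP T T0 NT; rewrite /hnorm ltr_sqrt// => h.
apply: le_lt_trans h; rewrite [leRHS]ip_slice (bigD1 i)//= lerDl sumr_ge0// => j _.
exact: (semi_inner_ge0 (ip_semi_inner _ _)).
Unshelve. all: by end_near. Qed.

End LineTransform.

(** * LTI systems in the frequency domain *)

Section Operator.
Variable R : realType.
Local Notation mu := (@lebesgue_measure R).
Local Notation C := (R[i]).
Local Notation cre := (@complex.Re R).
Local Notation cim := (@complex.Im R).

Definition aeq (D : mset R) (I : finType) (u v : L2 D I) :=
  {ae mu, forall x, mset_set D x -> forall i, u x i = v x i}.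

Section Aeq.
Variables (D : mset R) (I : finType).
Implicit Types u v w : L2 D I.

Lemma aeq_refl u : aeq u u. Proof. exact: aeW. Qed.

Lemma aeq_sym u v : aeq u v -> aeq v u.
Proof. by move=> h; apply: (ae_mp h) => x hx Dx i; rewrite hx. Qed.

Lemma aeq_trans v u w : aeq u v -> aeq v w -> aeq u w.
Proof. by move=> h k; apply: (ae_mp (ae_and h k)) => x [hx kx] Dx i; rewrite hx// kx. Qed.

Lemma aeq_lin c u u' v v' : aeq u u' -> aeq v v' -> aeq (c *: u + v) (c *: u' + v').
Proof.
move=> h k; apply: (ae_mp (ae_and h k)) => x [hx kx] Dx i.
by rewrite !L2DE !L2ZE hx// kx.
Qed.

Lemma aeqD u u' v v' : aeq u u' -> aeq v v' -> aeq (u + v) (u' + v').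
Proof. by move=> h k; rewrite -(scale1r u) -(scale1r u'); exact: aeq_lin. Qed.

Lemma aeq_hnorm u v : aeq u v -> hnorm (@ip R D I) u = hnorm (@ip R D I) v.
Proof. by move=> h; congr Num.sqrt; exact: eq_ip_ae. Qed.

Lemma aeqP u v : aeq u v <-> hnorm (@ip R D I) (u - v) = 0.
Proof.
split=> [h|h].
  apply: hnorm_eq0; apply: ip_ae_eq0; apply: (ae_mp h) => x hx Dx i.
  by rewrite L2BE hx// subrr.
have /ip_ae0 k : ip (u - v) (u - v) = 0 by rewrite -(sqr_hnorm (ip_semi_inner D I)) h expr0n.
by apply: (ae_mp k) => x kx Dx i; apply/eqP; rewrite -subr_eq0 -L2BE kx.
Qed.

End Aeq.

Lemma FT_linear (I : finType) c (u v : L2 (halfline R) I) : aeq (FT (c *: u + v)) (c *: FT u + FT v).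
Proof. by apply/aeqP; exact: FT_lin. Qed.

Lemma FT_hnorm (I : finType) (u : L2 (halfline R) I) :
  hnorm (@ip R _ _) (FT u) = Num.sqrt (2 * pi) * hnorm (@ip R _ _) u.
Proof. by rewrite /hnorm FT_plancherel sqrtrM// mulr_ge0// pi_ge0. Qed.

Lemma FT_hnormB (I : finType) (u v : L2 (halfline R) I) :
  hnorm (@ip R _ _) (FT u - FT v) = Num.sqrt (2 * pi) * hnorm (@ip R _ _) (u - v).
Proof.
rewrite -FT_hnorm; apply: aeq_hnorm; apply: aeq_sym.
have := FT_linear (-1) v u; rewrite !scaleN1r addrC => h; apply: (aeq_trans h).
by rewrite addrC; exact: aeq_refl.
Qed.

Lemma FT_aeq (I : finType) (u v : L2 (halfline R) I) : aeq (FT u) (FT v) <-> aeq u v.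
Proof.
rewrite !aeqP FT_hnormB; split=> [/eqP|->]; last by rewrite mulr0.
by rewrite mulf_eq0 gt_eqF ?sqrtr_gt0 ?mulr_gt0 ?pi_gt0//= => /eqP.
Qed.

(** Complex vectors are stored as real and imaginary parts, [true] indexing the real ones, so that
    the frequency side stays a real vector space. *)
Definition cact m n (A : 'M[C]_(m, n)) (x : bool * 'I_n -> R) (bi : bool * 'I_m) : R :=
  let z := \sum_j A bi.2 j * Complex (x (true, j)) (x (false, j)) in
  if bi.1 then cre z else cim z.

Lemma cre_sum (I : finType) (f : I -> C) : cre (\sum_i f i) = \sum_i cre (f i).
Proof. by apply: (big_morph cre) => // -[a b] [c d]. Qed.

Lemma cim_sum (I : finType) (f : I -> C) : cim (\sum_i f i) = \sum_i cim (f i).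
Proof. by apply: (big_morph cim) => // -[a b] [c d]. Qed.

Lemma cactE m n (A : 'M[C]_(m, n)) x b i : cact A x (b, i) =
  \sum_j (if b then cre (A i j) * x (true, j) - cim (A i j) * x (false, j)
          else cre (A i j) * x (false, j) + cim (A i j) * x (true, j)).
Proof.
rewrite /cact/=; case: b; rewrite ?cre_sum ?cim_sum; apply: eq_bigr => j _;
  by case: (A i j) => a c.
Qed.

Lemma cact_lin m n (A : 'M[C]_(m, n)) c x y bi :
  cact A (fun k => c * x k + y k) bi = c * cact A x bi + cact A y bi.
Proof.
case: bi => b i; rewrite !cactE mulr_sumr -big_split/=; apply: eq_bigr => j _.
by case: b; ring.
Qed.

Lemma cact_cvg m n (A : 'M[C]_(m, n)) (x : nat -> bool * 'I_n -> R) y bi :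
  (forall k, x j k @[j --> \oo] --> y k) -> cact A (x j) bi @[j --> \oo] --> cact A y bi.
Proof.
case: bi => b i h; under eq_fun do rewrite cactE; rewrite cactE.
apply: cvg_sumr => j; case: b.
  by apply: cvgB; apply: cvgMr; exact: h.
by apply: cvgD; apply: cvgMr; exact: h.
Qed.

Section FrequencyResponse.
Variables (m n : nat) (H : system R n m) (G : R -> 'M[C]_(m, n)).
Hypotheses (mapH : maps_L2 H) (freqH : freq_resp H G).
Local Notation U := (L2 (halfline R) 'I_n).
Local Notation Y := (L2 (halfline R) 'I_m).

Definition opL2 (u : U) : Y := @MkL2 R (halfline R) 'I_m (H u) (mapH (l2P u)).

Lemma FT_opL2 (u : U) : {ae mu, forall w, forall bi, FT (opL2 u) w bi = cact (G w) (FT u w) bi}.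
Proof.
have := freqH (l2P u) (is_FT_FT u) (is_FT_FT (opL2 u)).
by move=> h; apply: (ae_mp h) => w hw [b i]; rewrite /cact -hw; case: b.
Qed.

(** A system acts on functions, so nothing in its type makes a null change of the input harmless;
    the frequency response and the injectivity of [FT] do. *)
Lemma opL2_aeq (u v : U) : aeq u v -> aeq (opL2 u) (opL2 v).
Proof.
move/FT_aeq => h; apply/FT_aeq.
apply: (ae_mp (ae_and (ae_and (FT_opL2 u) (FT_opL2 v)) h)) => w [[hu hv] hw] _ bi.
by rewrite hu hv; congr cact; apply/funext => k; exact: hw.
Qed.

(** Linearity is inherited from the matrices [G w]: the transforms of both sides agree almost
    everywhere, and [FT] is injective up to null functions. *)
Lemma opL2_lin c (u v : U) : aeq (opL2 (c *: u + v)) (c *: opL2 u + opL2 v).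
Proof.
apply/FT_aeq; apply: aeq_trans (aeq_sym (FT_linear c (opL2 u) (opL2 v))).
have := ae_and (ae_and (FT_opL2 u) (FT_opL2 v)) (ae_and (FT_opL2 (c *: u + v)) (FT_linear c u v)).
move=> h; apply: (ae_mp h) => w [[hu hv] [huv hl]] _ bi.
rewrite huv L2DE L2ZE hu hv -cact_lin; congr cact.
by apply/funext => k; rewrite hl.
Qed.

Lemma opL2_0 : aeq (opL2 0) 0.
Proof. by have := opL2_lin (-1) 0 0; rewrite !scaleN1r !addNr. Qed.

Lemma cvg_of_sqr_le (x d : nat -> R) (l : R) : (forall k, (x k - l) ^+ 2 <= d k) ->
  d k @[k --> \oo] --> (0 : R) -> x k @[k --> \oo] --> l.
Proof.
move=> xd /cvgrPdist_lt d0; apply/cvgrPdist_lt => e e0.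
have e20 : 0 < e ^+ 2 by rewrite exprn_gt0.
move: (d0 _ e20); apply: filterS => k; rewrite sub0r normrN => dk.
rewrite distrC -(ltr_pXn2r (_ : 0 < 2)%N) ?nnegrE ?normr_ge0 ?(ltW e0)//.
rewrite real_normK ?num_real//; apply: le_lt_trans (le_lt_trans (ler_norm _) dk); exact: xd.
Qed.

(* Along a fast convergent sequence the transforms converge almost everywhere, so
   Fatou applies to the outputs. *)
Lemma opL2_lsc (y : nat -> U) (x : U) (c : R) :
  (forall k, hnorm (@ip R _ _) (y k - x) <= 2^-1 ^+ k) ->
  (forall k, hnorm (@ip R _ _) (opL2 (y k)) <= c) -> hnorm (@ip R _ _) (opL2 x) <= c.
Proof.
have YP := ip_semi_inner (halfline R) 'I_m; have UP := ip_semi_inner (halfline R) 'I_n.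
have WP := ip_semi_inner (lineT R) (bool * 'I_n)%type.
have WP' := ip_semi_inner (lineT R) (bool * 'I_m)%type.
move=> yx yc; have c0 : 0 <= c by apply: le_trans (yc 0%N); exact: hnorm_ge0.
have p0 : 0 < 2 * pi :> R by rewrite mulr_gt0 ?pi_gt0.
have cvs : {ae mu, forall w, [set: R] w -> cvgn (series (fun k => dot (FT (y k) - FT x) (FT (y k) - FT x) w))}.
  apply: (@ae_cvg_of_summable _ (lineT R) _ _ (geometric (2 * pi) 2^-1)).
  - move=> k; rewrite -(sqr_hnorm WP) FT_hnormB exprMn sqr_sqrtr ?(ltW p0)// /geometric/=.
    rewrite ler_pM2l//; have h1 : 2^-1 ^+ k <= 1 :> R by rewrite exprn_ile1 ?invf_le1// ler1n.
    apply: le_trans (_ : (2^-1 ^+ k) ^+ 2 <= _).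
      by rewrite lerXn2r ?nnegrE ?hnorm_ge0 ?exprn_ge0.
    by rewrite expr2 ler_piMl// exprn_ge0.
  - by move=> k; rewrite /geometric/= mulr_ge0 ?(ltW p0)// exprn_ge0.
  - by apply: is_cvg_geometric_series; rewrite gtr0_norm ?invf_lt1 ?ltr1n.
have ak : {ae mu, forall w, forall k bi, FT (opL2 (y k)) w bi = cact (G w) (FT (y k) w) bi}.
  by apply: ae_foralln => k; exact: FT_opL2.
have [||k|F FE Fc] := @L2_fatou R (lineT R) _ (fun k => FT (opL2 (y k))) (FT (opL2 x)) (2 * pi * c ^+ 2).
- by move=> i; exact: (l2P (FT (opL2 x)) i).1.
- apply: (ae_mp (ae_and (ae_and cvs ak) (FT_opL2 x))) => w [[hw hk] hx] _ bi.
  rewrite hx; under eq_fun do rewrite hk; apply: cact_cvg => k.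
  apply: (cvg_of_sqr_le (d := fun j => dot (FT (y j) - FT x) (FT (y j) - FT x) w)).
    by move=> j; rewrite -L2BE; exact: sqr_le_dot.
  exact: cvg_series_cvg_0 (hw I).
- rewrite -(sqr_hnorm WP') FT_hnorm exprMn sqr_sqrtr ?(ltW p0)// ler_pM2l//.
  by rewrite lerXn2r ?nnegrE ?hnorm_ge0.
have {}FE : F = FT (opL2 x) by apply: L2_eq => w i; rewrite FE.
move: Fc; rewrite FE -(sqr_hnorm WP') FT_hnorm exprMn sqr_sqrtr ?(ltW p0)// ler_pM2l//.
by rewrite ler_pXn2r ?nnegrE ?hnorm_ge0.
Qed.

(** Uniform boundedness: the norm of the output is a lower semicontinuous seminorm of the input, on
    a complete space. *)
Lemma opL2_bounded : exists2 c : R, 0 <= c & forall u : U,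
  hnorm (@ip R _ _) (opL2 u) <= c * hnorm (@ip R _ _) u.
Proof.
have YP := ip_semi_inner (halfline R) 'I_m; have UP := ip_semi_inner (halfline R) 'I_n.
have [||x M Mp|c cP] := @lsc_seminorm_bounded R U (@ip R _ _) UP (@L2_complete _ _ _)
  (fun u => hnorm (@ip R _ _) (opL2 u)).
- move=> x y; have := aeq_hnorm (opL2_lin 1 x y); rewrite !scale1r => ->; exact: (hnormD YP).
- move=> c x; rewrite -(hnormZ YP); apply: aeq_hnorm.
  have := opL2_lin c x 0; rewrite addr0 => h; apply: (aeq_trans h).
  rewrite -[X in aeq _ X]addr0; apply: aeqD; [exact: aeq_refl|exact: opL2_0].
(* Failure of semicontinuity at [x] gives inputs within [2^-1 ^+ k] of [x] whose outputs stay below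
   [M], which [opL2_lsc] excludes. *)
- apply: contrapT => nE.
  have h k : exists y, hnorm (@ip R _ _) (y - x) <= 2^-1 ^+ k /\ hnorm (@ip R _ _) (opL2 y) <= M.
    apply: contrapT => nk; apply: nE; exists (2^-1 ^+ k); first by rewrite exprn_gt0.
    move=> y hy; rewrite ltNge; apply/negP => hM; apply: nk; exists y; split => //.
    exact: ltW.
  have [y yP] := choice h.
  have := @opL2_lsc y x M (fun k => (yP k).1) (fun k => (yP k).2).
  by rewrite leNgt Mp.
exists (Num.max 0 c); first by rewrite le_max lexx.
move=> u; apply: le_trans (cP u) _; rewrite ler_wpM2r ?hnorm_ge0// le_max lexx orbT//.
Qed.

End FrequencyResponse.
End Operator.

(** * Quadratic forms of signals *)

Section MatrixForm.
Variable R : realType.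
Local Notation mu := (@lebesgue_measure R).
Local Notation halfline := (halfline R).

Lemma ae_forall_fin (I : finType) (P : I -> R -> Prop) :
  (forall i, {ae mu, forall x, P i x}) -> {ae mu, forall x, forall i, P i x}.
Proof.
move=> h.
suff : {ae mu, forall x, forall i, i \in enum I -> P i x}.
  by move=> k; apply: (ae_mp k) => x kx i; apply: kx; rewrite mem_enum.
elim: (enum I) => [|j s IH]; first exact: aeW.
apply: (ae_mp (ae_and (h j) IH)) => x [hj hs] i.
by rewrite inE => /orP[/eqP->//|]; exact: hs.
Qed.

Lemma comp1D (D : mset R) (I : finType) (u v : L2 D I) i : comp1 (u + v) i = comp1 u i + comp1 v i.
Proof. exact: L2_eq. Qed.

Lemma comp1Z (D : mset R) (I : finType) c (u : L2 D I) i : comp1 (c *: u) i = c *: comp1 u i.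
Proof. exact: L2_eq. Qed.

Lemma ip_slice_le (D : mset R) (J I : finType) (u : L2 D (J * I)%type) i :
  ip (slice u i) (slice u i) <= ip u u.
Proof.
rewrite [leRHS]ip_slice (bigD1 i)//= lerDl sumr_ge0// => j _.
exact: (semi_inner_ge0 (ip_semi_inner _ _)).
Qed.

Lemma ip_comp1_le (D : mset R) (I : finType) (u : L2 D I) i : ip (comp1 u i) (comp1 u i) <= ip u u.
Proof.
rewrite [leRHS]ip_comp1 (bigD1 i)//= lerDl sumr_ge0// => j _.
exact: (semi_inner_ge0 (ip_semi_inner _ _)).
Qed.

(** The transforms for the index types [I] and [unit] are chosen separately; they agree almost
    everywhere as limits of the same integrals over [[0, T]]. *)
Lemma FT_comp1 (I : finType) (u : L2 halfline I) i : aeq (slice (FT (comp1 u i)) tt) (slice (FT u) i).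
Proof.
have BP := ip_semi_inner (lineT R) bool.
apply/aeqP; apply/eqP; rewrite eq_le hnorm_ge0 andbT; apply: (@le_vanish _ _ 2) => e /andP[e0 _].
have [N1 N10 Q1] := FTP (comp1 u i) e0; have [N2 N20 Q2] := FTP u e0.
pose T := N1 + N2; have T0 : 0 < T by rewrite addr_gt0.
have {}Q1 := Q1 T T0 (_ : N1 <= T); have {}Q2 := Q2 T T0 (_ : N2 <= T).
rewrite lerDl ltW// in Q1; rewrite lerDr ltW// in Q2.
apply: le_trans (hnorm_triangle BP (slice (FTT T0 u) i) _ _) _.
have E1 : hnorm (@ip R _ _) (slice (FT (comp1 u i)) tt - slice (FTT T0 u) i) <=
    hnorm (@ip R _ _) (FTT T0 (comp1 u i) - FT (comp1 u i)).
  rewrite (hnormB BP) /hnorm ler_wsqrtr//.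
  by apply: le_trans (ip_slice_le (FTT T0 (comp1 u i) - FT (comp1 u i)) tt); rewrite le_eqVlt; apply/orP; left; apply/eqP; congr ip; exact: L2_eq.
have E2 : hnorm (@ip R _ _) (slice (FTT T0 u) i - slice (FT u) i) <= hnorm (@ip R _ _) (FTT T0 u - FT u).
  rewrite /hnorm ler_wsqrtr//; apply: le_trans (ip_slice_le (FTT T0 u - FT u) i).
  by rewrite le_eqVlt; apply/orP; left; apply/eqP; congr ip; exact: L2_eq.
rewrite mulr_natl mulr2n; apply: lerD; apply: ltW; apply: le_lt_trans; [exact: E1|exact: Q1|exact: E2|exact: Q2].
Qed.

Lemma FT_ip_comp1 (I J : finType) (u : L2 halfline I) (v : L2 halfline J) i j :
  2 * pi * ip (comp1 u i) (comp1 v j) = ip (slice (FT u) i) (slice (FT v) j).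
Proof.
rewrite -FT_ip ip_slice (bigD1 tt)//= big1 ?addr0; last by case.
by apply: eq_ip_ae; exact: FT_comp1.
Qed.

Section Form.
Variables (k : nat).
Implicit Types (A : 'M[R]_k) (z : L2 halfline 'I_k).

Definition mform A z z' : R := \sum_i \sum_j A i j * ip (comp1 z i) (comp1 z' j).

Lemma mform_bilinear A : bilinear_form (mform A).
Proof.
have [[Dl Dr Zl Zr] _ _] := ip_semi_inner halfline unit.
split=> [x x' y|x y y'|c x y|c x y]; rewrite /mform ?mulr_sumr -?big_split/=;
  apply: eq_bigr => i _; rewrite ?mulr_sumr -?big_split/=; apply: eq_bigr => j _.
- by rewrite comp1D Dl mulrDr.
- by rewrite comp1D Dr mulrDr.
- by rewrite comp1Z Zl mulrCA.
- by rewrite comp1Z Zr mulrCA.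
Qed.

Lemma mformC A z z' : A^T = A -> mform A z z' = mform A z' z.
Proof.
move=> sA; rewrite /mform exchange_big/=; apply: eq_bigr => i _; apply: eq_bigr => j _.
by have [_ -> _] := ip_semi_inner halfline unit; rewrite -{1}sA mxE.
Qed.

Lemma aeq_comp1 (D : mset R) (I : finType) (u v : L2 D I) i : aeq u v -> aeq (comp1 u i) (comp1 v i).
Proof. by move=> h; apply: (ae_mp h) => x hx Dx []; exact: hx. Qed.

Lemma mform_aeq A z1 z1' z2 z2' : aeq z1 z2 -> aeq z1' z2' -> mform A z1 z1' = mform A z2 z2'.
Proof.
move=> h h'; apply: eq_bigr => i _; apply: eq_bigr => j _; congr (_ * _).
by apply: eq_ip_ae; exact: aeq_comp1.
Qed.

Lemma mform_bounded A : exists2 c : R, 0 <= c & forall z z',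
  `|mform A z z'| <= c * hnorm (@ip R _ _) z * hnorm (@ip R _ _) z'.
Proof.
exists (\sum_i \sum_j `|A i j|); first by apply: sumr_ge0 => i _; apply: sumr_ge0.
move=> z z'; rewrite /mform 2!mulr_suml; apply: le_trans (ler_norm_sum _ _ _) _.
apply: ler_sum => i _; rewrite 2!mulr_suml; apply: le_trans (ler_norm_sum _ _ _) _.
apply: ler_sum => j _; rewrite normrM -mulrA ler_wpM2l//.
apply: le_trans (cauchy_schwarz (ip_semi_inner _ _) _ _) _.
by apply: ler_pM; rewrite ?hnorm_ge0// /hnorm ler_wsqrtr// ip_comp1_le.
Qed.

(** The real part of the sesquilinear form of [A] at the complex vector that [x] encodes. *)
Definition qf A (x : bool * 'I_k -> R) : R :=
  \sum_i \sum_j A i j * \sum_(b : bool) x (b, i) * x (b, j).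

Let integrable_qf A (z : L2 (lineT R) (bool * 'I_k)%type) :
  mu.-integrable setT (EFin \o (fun w => qf A (z w))) /\
  \int[mu]_w (qf A (z w)) = \sum_i \sum_j A i j * ip (slice z i) (slice z j).
Proof.
have mT : measurable [set: R] by exact: measurableT.
have i1 (c : 'I_k * 'I_k) : mu.-integrable setT (EFin \o (fun w => A c.1 c.2 * dot (slice z c.1) (slice z c.2) w)).
  apply: integrableZl_EFin => //; exact: (dot_integrable (slice z c.1) (slice z c.2)).
have qfE : (fun w => qf A (z w)) =
    (fun w => \sum_(c : 'I_k * 'I_k) A c.1 c.2 * dot (slice z c.1) (slice z c.2) w).
  by apply/funext => w; rewrite /qf pair_bigA.
have h := Rintegral_sum mT i1.
rewrite qfE; split.
  rewrite (_ : _ \o _ = fun x => (\sum_(c : 'I_k * 'I_k) (A c.1 c.2 * dot (slice z c.1) (slice z c.2) x)%:E)%E); last first.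
    by apply/funext => x; rewrite /= sumEFin.
  exact: (@integrable_sum _ _ _ mu setT mT _ _ _ _ (fun c _ => i1 c)).
rewrite h pair_bigA/=; apply: eq_bigr => c _.
by rewrite (@RintegralZl _ _ _ mu setT _ _ mT (dot_integrable (slice z c.1) (slice z c.2))).
Qed.

Lemma mform_FT A z : 2 * pi * mform A z z = \int[mu]_w (qf A (FT z w)).
Proof.
rewrite (integrable_qf A (FT z)).2 /mform mulr_sumr; apply: eq_bigr => i _.
by rewrite mulr_sumr; apply: eq_bigr => j _; rewrite mulrCA FT_ip_comp1.
Qed.

Lemma qf_integrable A z : mu.-integrable setT (EFin \o (fun w => qf A (FT z w))).
Proof. exact: (integrable_qf A (FT z)).1. Qed.

Lemma mformE A z :
  (\int[mu]_(t in halfline) (\sum_i \sum_j z t i * A i j * z t j)%:E = (mform A z z)%:E)%E.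
Proof.
have mh : measurable (halfline : set R) by exact: msetP.
pose g (c : 'I_k * 'I_k) t := A c.1 c.2 * dot (comp1 z c.1) (comp1 z c.2) t.
have gi c : mu.-integrable halfline (EFin \o g c).
  by apply: integrableZl_EFin => //; exact: dot_integrable.
have E : (fun t => \sum_i \sum_j z t i * A i j * z t j) = (fun t => \sum_c g c t).
  apply/funext => t; rewrite pair_bigA/=; apply: eq_bigr => c _.
  by rewrite /g dot_unit/= mulrA (mulrC (A _ _)).
have -> : (\int[mu]_(t in halfline) (\sum_i \sum_j z t i * A i j * z t j)%:E =
    \int[mu]_(t in halfline) (\sum_c g c t)%:E)%E.
  by apply: eq_integral => t _; rewrite -(congr1 (@^~ t) E).
rewrite -[LHS]fineK; last first.
  apply: (@integrable_fin_num _ _ _ mu halfline mh).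
  rewrite (_ : (fun t => _) = fun t => (\sum_c (g c t)%:E)%E); last first.
    by apply/funext => x; rewrite /= sumEFin.
  exact: (@integrable_sum _ _ _ mu halfline mh _ _ _ _ (fun c _ => gi c)).
congr EFin; apply: (etrans (Rintegral_sum mh gi)); rewrite /mform pair_bigA/=; apply: eq_bigr => c _.
by rewrite (@RintegralZl _ _ _ mu halfline _ _ mh (dot_integrable (comp1 z c.1) (comp1 z c.2))).
Qed.

End Form.

(** A frequency-wise inequality becomes one between signals, both forms being integrals of [qf] over
    all frequencies. The sizes differ because the form of the IQC acts on the filtered signal, the
    form of the multiplier on the unfiltered pair. *)
Lemma mform_le k k' (A : 'M[R]_k) (B : 'M[R]_k') (z : L2 halfline 'I_k) (z' : L2 halfline 'I_k') :
  {ae mu, forall w, qf A (FT z w) <= qf B (FT z' w)} -> mform A z z <= mform B z' z'.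
Proof.
move=> h; have p0 : 0 < 2 * pi :> R by rewrite mulr_gt0 ?pi_gt0.
rewrite -(ler_pM2l p0) !mform_FT; apply: le_Rintegral_ae; [exact: measurableT|exact: qf_integrable|exact: qf_integrable|].
by apply: (ae_mp h).
Qed.

Section Stack.
Variable n : nat.
Implicit Types p q : L2 halfline 'I_n.

Lemma sstackP p q : inL2on halfline (sstack p q).
Proof.
move=> i; rewrite /sstack; case: (fintype.split i) => j; exact: l2P.
Qed.

Definition stack p q : L2 halfline 'I_(n + n) := MkL2 (sstackP p q).

Lemma stack_lin c p p' q q' : stack (c *: p + p') (c *: q + q') = c *: stack p q + stack p' q'.
Proof. by apply: L2_eq => t i; rewrite L2DE L2ZE/= /sstack; case: (fintype.split i). Qed.

Lemma stack_comp1l p q j : comp1 (stack p q) (lshift n j) = comp1 p j.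
Proof. by apply: L2_eq => t i /=; rewrite /sstack (unsplitK (inl j)). Qed.

Lemma stack_comp1r p q j : comp1 (stack p q) (rshift n j) = comp1 q j.
Proof. by apply: L2_eq => t i /=; rewrite /sstack (unsplitK (inr j)). Qed.

Lemma stack_hnorml p : hnorm (@ip R _ _) (stack p 0) = hnorm (@ip R _ _) p.
Proof.
congr Num.sqrt; rewrite !ip_comp1 big_split_ord/= [X in _ + X]big1 ?addr0.
  by apply: eq_bigr => i _; rewrite stack_comp1l.
move=> i _; rewrite stack_comp1r; apply: ip_ae_eq0; exact: aeW.
Qed.

Lemma stack_hnormr p : hnorm (@ip R _ _) (stack 0 p) = hnorm (@ip R _ _) p.
Proof.
congr Num.sqrt; rewrite !ip_comp1 big_split_ord/= [X in X + _]big1 ?add0r.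
  by apply: eq_bigr => i _; rewrite stack_comp1r.
move=> i _; rewrite stack_comp1l; apply: ip_ae_eq0; exact: aeW.
Qed.

Definition vstack (x y : bool * 'I_n -> R) (bi : bool * 'I_(n + n)) : R :=
  match fintype.split bi.2 with inl j => x (bi.1, j) | inr j => y (bi.1, j) end.

Lemma FT_stack p q : {ae mu, forall w, FT (stack p q) w = vstack (FT p w) (FT q w)}.
Proof.
have hl : {ae mu, forall w j, forall b, FT (stack p q) w (b, lshift n j) = FT p w (b, j)}.
  apply: ae_forall_fin => j.
  have := aeq_trans (aeq_sym (FT_comp1 (stack p q) (lshift n j))).
  rewrite stack_comp1l => /(_ _ (FT_comp1 p j)) h.
  by apply: (ae_mp h) => w hw b; exact: hw.
have hr : {ae mu, forall w j, forall b, FT (stack p q) w (b, rshift n j) = FT q w (b, j)}.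
  apply: ae_forall_fin => j.
  have := aeq_trans (aeq_sym (FT_comp1 (stack p q) (rshift n j))).
  rewrite stack_comp1r => /(_ _ (FT_comp1 q j)) h.
  by apply: (ae_mp h) => w hw b; exact: hw.
apply: (ae_mp (ae_and hl hr)) => w [hwl hwr]; apply/funext => -[b i].
rewrite /vstack/= -{1}(splitK i); case: (fintype.split i) => j /=; [exact: hwl|exact: hwr].
Qed.

Lemma mform_kron (P : 'M[R]_2) p q : P^T = P ->
  mform (kronI2 n P) (stack p q) (stack p q) =
  P 0 0 * ip p p + 2 * P 0 1 * ip p q + P 1 1 * ip q q.
Proof.
move=> sP; have P10 : P 1 0 = P 0 1 by rewrite -{1}sP mxE.
have diag (a : R) (u v : L2 halfline 'I_n) :
    \sum_i \sum_j (a *: (1%:M : 'M[R]_n)) i j * ip (comp1 u i) (comp1 v j) = a * ip u v.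
  rewrite ip_comp1 mulr_sumr; apply: eq_bigr => i _; rewrite (bigD1 i)//= big1 ?addr0.
    by rewrite !mxE eqxx mulr1.
  by move=> j /negbTE ji; rewrite !mxE eq_sym ji mulr0 mul0r.
rewrite /mform big_split_ord/=.
under eq_bigr do rewrite big_split_ord/=.
under [X in _ + X]eq_bigr do rewrite big_split_ord/=.
rewrite !big_split/= /kronI2.
have -> : P 0 0 * ip p p + 2 * P 0 1 * ip p q + P 1 1 * ip q q =
    P 0 0 * ip p p + P 0 1 * ip p q + (P 1 0 * ip q p + P 1 1 * ip q q).
  by rewrite P10; have [_ -> _] := ip_semi_inner halfline 'I_n; ring.
rewrite -(diag (P 0 0) p p) -(diag (P 0 1) p q) -(diag (P 1 0) q p) -(diag (P 1 1) q q).
congr (_ + _ + (_ + _)); apply: eq_bigr => i _; apply: eq_bigr => j _.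
- by rewrite block_mxEul !stack_comp1l.
- by rewrite block_mxEur stack_comp1l stack_comp1r.
- by rewrite block_mxEdl stack_comp1l stack_comp1r.
- by rewrite block_mxEdr !stack_comp1r.
Qed.


End Stack.
End MatrixForm.

(** * Multipliers and the scaled relative graph at one frequency *)

Section Pointwise.
Variable R : realType.
Local Notation C := (R[i]).
Local Notation cre := (@complex.Re R).
Local Notation cim := (@complex.Im R).

Definition dotv (I : finType) (x y : I -> R) : R := \sum_i x i * y i.

Lemma dotvC (I : finType) (x y : I -> R) : dotv x y = dotv y x.
Proof. by apply: eq_bigr => i _; rewrite mulrC. Qed.

Lemma dotv_ge0 (I : finType) (x : I -> R) : 0 <= dotv x x.
Proof. by apply: sumr_ge0 => i _; rewrite -expr2 sqr_ge0. Qed.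

Lemma dotv_eq0 (I : finType) (x : I -> R) : dotv x x = 0 -> x = (fun=> 0).
Proof.
move=> h; apply/funext => i; apply/eqP; rewrite -sqrf_eq0 expr2.
have := psumr_eq0P (fun j _ => (_ : 0 <= x j * x j)) h; move=> -> // j.
by rewrite -expr2 sqr_ge0.
Qed.

Lemma dotv_linl (I : finType) c d (x x' y : I -> R) :
  dotv (fun i => c * x i + d * x' i) y = c * dotv x y + d * dotv x' y.
Proof. by rewrite /dotv !mulr_sumr -big_split; apply: eq_bigr => i _; rewrite /=; ring. Qed.

Lemma dotv_cauchy (I : finType) (x y : I -> R) : dotv x y ^+ 2 <= dotv x x * dotv y y.
Proof.
have [|_ _ //] := @quad_ge0P R (dotv x x) (dotv x y) (dotv y y).
move=> s; have := dotv_ge0 (fun i => s * x i + 1 * y i).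
set z := fun i => _; rewrite /z dotv_linl -/z (dotvC x z) (dotvC y z) !dotv_linl (dotvC y x).
lra.
Qed.

Definition cv n (x : bool * 'I_n -> R) : 'cV[C]_n := \col_i Complex (x (true, i)) (x (false, i)).

Lemma cv_cact m n (A : 'M[C]_(m, n)) x : cv (cact A x) = A *m cv x.
Proof.
apply/matrixP => i j; rewrite !mxE /cact/=.
set s := \sum_j _; rewrite (_ : \sum_j _ = s); first by case: s.
by apply: eq_bigr => l _; rewrite mxE.
Qed.

Lemma dotv_bool (I : finType) (x y : bool * I -> R) :
  dotv x y = \sum_i (x (true, i) * y (true, i) + x (false, i) * y (false, i)).
Proof.
transitivity (\sum_(b : bool) \sum_i x (b, i) * y (b, i)).
  by rewrite pair_bigA/=; apply: eq_bigr => -[].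
by rewrite exchange_big/=; apply: eq_bigr => i _; rewrite big_bool.
Qed.

Lemma cre_ctransM n (x y : bool * 'I_n -> R) : cre ((ctrans (cv x) *m cv y) 0 0) = dotv x y.
Proof.
rewrite mxE cre_sum dotv_bool; apply: eq_bigr => i _; rewrite !mxE/=.
by rewrite mulNr opprK.
Qed.

Lemma cre_quad k (A : 'M[R]_k) x : cre ((ctrans (cv x) *m cmx A *m cv x) 0 0) = qf A x.
Proof.
rewrite -mulmxA -cv_cact cre_ctransM dotv_bool; apply: eq_bigr => i _.
rewrite !cactE !mulr_sumr -big_split/=; apply: eq_bigr => j _.
by rewrite big_bool mxE/=; ring.
Qed.

Lemma creD (a b : C) : cre (a + b) = cre a + cre b. Proof. by case: a b => ? ? []. Qed.

Lemma ctransM m n p (A : 'M[C]_(m, n)) (B : 'M[C]_(n, p)) : ctrans (A *m B) = ctrans B *m ctrans A.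
Proof. by rewrite /ctrans map_mxM trmx_mul. Qed.

Lemma ctrans_col m1 m2 n (A : 'M[C]_(m1, n)) (B : 'M[C]_(m2, n)) :
  ctrans (col_mx A B) = row_mx (ctrans A) (ctrans B).
Proof. by rewrite /ctrans map_col_mx tr_col_mx. Qed.

Lemma qfZ k (a : R) (A : 'M[R]_k) x : qf (a *: A) x = a * qf A x.
Proof.
rewrite /qf mulr_sumr; apply: eq_bigr => i _; rewrite mulr_sumr; apply: eq_bigr => j _.
by rewrite mxE mulrA.
Qed.

Lemma qf_kron n (P : 'M[R]_2) (x y : bool * 'I_n -> R) : P^T = P ->
  qf (kronI2 n P) (vstack x y) = P 0 0 * dotv x x + 2 * P 0 1 * dotv x y + P 1 1 * dotv y y.
Proof.
move=> sP; have P10 : P 1 0 = P 0 1 by rewrite -{1}sP mxE.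
have vl b i : vstack x y (b, lshift n i) = x (b, i) by rewrite /vstack/= (unsplitK (inl i)).
have vr b i : vstack x y (b, rshift n i) = y (b, i) by rewrite /vstack/= (unsplitK (inr i)).
have diag (a : R) (u v : bool * 'I_n -> R) :
    \sum_i \sum_j (a *: (1%:M : 'M[R]_n)) i j * (\sum_(b : bool) u (b, i) * v (b, j)) = a * dotv u v.
  rewrite dotv_bool mulr_sumr; apply: eq_bigr => i _; rewrite (bigD1 i)//= [X in _ + X]big1 ?addr0.
    by rewrite !mxE eqxx mulr1 big_bool.
  by move=> j /negbTE ji; rewrite !mxE eq_sym ji mulr0 mul0r.
rewrite /qf big_split_ord/=.
under eq_bigr do rewrite big_split_ord/=.
under [X in _ + X]eq_bigr do rewrite big_split_ord/=.
rewrite !big_split/= /kronI2.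
have -> : P 0 0 * dotv x x + 2 * P 0 1 * dotv x y + P 1 1 * dotv y y =
    P 0 0 * dotv x x + P 0 1 * dotv x y + (P 1 0 * dotv y x + P 1 1 * dotv y y).
  by rewrite P10 (dotvC y x); ring.
rewrite -(diag (P 0 0) x x) -(diag (P 0 1) x y) -(diag (P 1 0) y x) -(diag (P 1 1) y y).
congr (_ + _ + (_ + _)); apply: eq_bigr => i _; apply: eq_bigr => j _.
- by rewrite block_mxEul; congr (_ * _); apply: eq_bigr => b _; rewrite !vl.
- by rewrite block_mxEur; congr (_ * _); apply: eq_bigr => b _; rewrite vl vr.
- by rewrite block_mxEdl; congr (_ * _); apply: eq_bigr => b _; rewrite vl vr.
- by rewrite block_mxEdr; congr (_ * _); apply: eq_bigr => b _; rewrite !vr.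
Qed.

Section Multiplier.
Variables (n k : nat) (M : 'M[R]_k) (Nf : R -> 'M[C]_(k, n + n)).

(** The matrix inequality tested at one stacked vector; the Kronecker factor leaves only the three
    numbers [dotv x x], [dotv x y] and [dotv y y]. *)
Lemma PiSetP P : PiSet M Nf P -> P^T = P /\ exists2 tau : R, 0 < tau & forall w x y,
  tau * qf M (cact (Nf w) (vstack x y)) <=
  P 0 0 * dotv x x + 2 * P 0 1 * dotv x y + P 1 1 * dotv y y.
Proof.
move=> [sP [tau [tau0 h]]]; split=> //; exists tau => // w x y.
have := h w (cv (vstack x y)); rewrite !mulmxA -ctransM -!mulmxA.
set S := col_mx _ _; have -> : S *m cv (vstack x y) = col_mx (cv (vstack x y)) (cv (cact (Nf w) (vstack x y))).
  by rewrite /S mul_col_mx mul1mx cv_cact.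
rewrite /cmx map_block_mx !map_mx0 mul_block_col !mul0mx addr0 add0r ctrans_col mul_row_col.
rewrite lecE => /andP[_]; rewrite mxE creD !mulmxA -/(cmx _) -/(cmx _) !cre_quad qf_kron// qfZ.
by rewrite mulNr subr_ge0.
Qed.

Lemma notCSet z : ~ CSet M Nf z -> exists2 P, PiSet M Nf P &
  P 0 0 * (cre z ^+ 2 + cim z ^+ 2) + 2 * P 0 1 * cre z + P 1 1 < 0.
Proof.
move=> nz; apply: contrapT => h; apply: nz => P PP.
have [sP _] := PP; have P10 : P 1 0 = P 0 1 by rewrite -{1}sP mxE.
have : ~ (P 0 0 * (cre z ^+ 2 + cim z ^+ 2) + 2 * P 0 1 * cre z + P 1 1 < 0) by move=> k1; apply: h; exists P.
move/negP; rewrite -leNgt.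
move=> hh; have -> : (ctrans (vz z) *m cmx P *m vz z) 0 0 =
    Complex (P 0 0 * (cre z ^+ 2 + cim z ^+ 2) + 2 * P 0 1 * cre z + P 1 1) 0.
  rewrite !mxE !big_ord_recl !big_ord0 !mxE !big_ord_recl !big_ord0 !mxE/=.
  rewrite (_ : lift ord0 ord0 = 1 :> 'I_2); last exact: val_inj.
  rewrite P10; case: z {h hh} => a b /=; congr Complex; rewrite /=; ring.
by rewrite lecE/= eqxx.
Qed.



Section Gap.
Variables (G : R -> 'M[C]_n) (r : R).
Hypothesis r0 : 0 < r.
Hypothesis gap : forall m w : R, 0 < m <= 1 -> dist_ge (SRG (G w)) (scale_set m (CSet M Nf)) r.

(** If [l] times the point were in the set, the point itself would lie in the copy scaled by [l^-1],
    which stays at distance at least [r] from the graph. The gap for small gains is used here. *)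
Lemma gap_notCSet (l w a b : R) (z : C) : 1 <= l -> SRG (G w) z ->
  (cre z - a) ^+ 2 + (cim z - b) ^+ 2 < r ^+ 2 -> ~ CSet M Nf (Complex (l * a) (l * b)).
Proof.
move=> l1 zS lt_r Cz; have l0 : 0 < l by apply: lt_le_trans l1.
have m01 : 0 < l^-1 <= 1 by rewrite invr_gt0 l0 invf_le1.
have : scale_set l^-1 (CSet M Nf) (Complex a b).
  exists (Complex (l * a) (l * b)) => //; rewrite /=.
  by congr Complex; rewrite mul0r ?subr0 ?addr0 mulrA mulVf ?gt_eqF// mul1r.
move=> /(gap m01 zS); rewrite leNgt => /negP; apply.
rewrite /cnorm -[ltRHS](gtr0_norm r0) -sqrtr_sqr; case: z {zS} lt_r => x y/= h.
by rewrite ltr_sqrt ?exprn_gt0.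
Qed.

(** The point generated by [x] in the upper half plane. Its real part and squared modulus are
    quotients of real inner products, and a real symmetric form in [(z, 1)] sees nothing else of
    [z]. *)
Lemma SRG_point (w : R) (x : bool * 'I_n -> R) : dotv x x != 0 -> exists2 z, SRG (G w) z &
  [/\ 0 <= cim z, dotv x x * cre z = dotv x (cact (G w) x) &
      dotv x x * (cre z ^+ 2 + cim z ^+ 2) = dotv (cact (G w) x) (cact (G w) x)].
Proof.
move=> x0; have xp : 0 < dotv x x by rewrite lt_neqAle eq_sym x0 dotv_ge0.
have vn (y : bool * 'I_n -> R) : vnorm (cv y) = Num.sqrt (dotv y y).
  rewrite /vnorm dotv_bool; congr Num.sqrt; apply: eq_bigr => i _.
  by rewrite !mxE /cnorm sqr_sqrtr ?addr_ge0 ?sqr_ge0//= !expr2.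
have cv0 : cv x != 0.
  apply: contra x0 => /eqP h; have := cre_ctransM x x; rewrite h mulmx0 mxE/= => <-.
  by [].
set y := cact (G w) x.
have yE : G w *m cv x = cv y by rewrite -cv_cact.
set rh := rho (cv x) (cv y); set th := theta (cv x) (cv y).
exists (Complex (rh * cos th) (rh * sin th)).
  by exists (cv x); split => //; left; rewrite yE.
have rhE : rh ^+ 2 * dotv x x = dotv y y.
  by rewrite /rh /rho !vn expr_div_n !sqr_sqrtr ?dotv_ge0// divfK.
have [y0|y0] := eqVneq (cv y) 0.
  have yy0 : dotv y y = 0.
    by rewrite -cre_ctransM y0 mulmx0 mxE.
  have rh0 : rh = 0 by rewrite /rh /rho vn yy0 sqrtr0 mul0r.
  rewrite rh0 !mul0r /=; split => //.
    by rewrite mulr0 (dotv_eq0 yy0) /dotv big1// => i _; rewrite mulr0.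
  by rewrite expr0n addr0 mulr0.
have yy0 : dotv y y != 0.
  apply: contra y0 => /eqP /dotv_eq0 y0; apply/eqP/matrixP => i j; rewrite !mxE.
  by rewrite y0.
have yp : 0 < dotv y y by rewrite lt_neqAle eq_sym yy0 dotv_ge0.
have sx : 0 < Num.sqrt (dotv x x) by rewrite sqrtr_gt0.
have sy : 0 < Num.sqrt (dotv y y) by rewrite sqrtr_gt0.
set c := dotv x y / (Num.sqrt (dotv x x) * Num.sqrt (dotv y y)).
have thE : th = acos c by rewrite /th /theta (negbTE y0) cre_ctransM !vn.
have c1 : c ^+ 2 <= 1.
  rewrite /c expr_div_n exprMn !sqr_sqrtr ?dotv_ge0// ler_pdivrMr ?mulr_gt0// mul1r.
  exact: dotv_cauchy.
have cb : -1 <= c <= 1 by rewrite -ler_norml -(ler_pXn2r (_ : 0 < 2)%N) ?nnegrE// real_normK ?num_real// expr1n.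
have cosE : cos th = c by rewrite thE acosK// in_itv.
have rh0 : 0 <= rh by rewrite /rh /rho !vn divr_ge0 ?ltW.
split => /=.
- rewrite mulr_ge0// thE; apply: sin_ge0_pi.
  by rewrite acos_ge0// acos_lepi.
- rewrite cosE /rh /rho !vn /c -[in X in X * _](sqr_sqrtr (ltW xp)).
  by field; rewrite !gt_eqF.
- by rewrite -rhE !exprMn -mulrDr cos2Dsin2; ring.
Qed.

(** Here [y = l (G w + a) x]; a real shift moves the real part of the point by [a] and keeps the
    imaginary part. So the form of [P] at [(y, x)] is [dotv x x] times its negative value at
    [l (z + a)]. *)
Lemma pointwise_neg (l a w : R) (x : bool * 'I_n -> R) : 1 <= l -> `|a| < r ->
  qf M (cact (Nf w) (vstack (fun c => l * cact (G w) x c + l * a * x c) x)) <= 0.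
Proof.
move=> l1 ar; set y := fun c => _.
have [x0|x0] := eqVneq (dotv x x) 0.
  have x0' := dotv_eq0 x0.
  have cact0 p q (A : 'M[C]_(p, q)) : cact A (fun=> 0) = (fun=> 0).
    apply/funext => -[b i]; rewrite cactE big1// => j _.
    by case: b; rewrite !mulr0 ?subrr ?addr0.
  have -> : vstack y x = (fun=> 0).
    apply/funext => -[b i]; rewrite /vstack /y x0' cact0/=.
    by case: (fintype.split i) => j //; rewrite !mulr0 addr0.
  by rewrite cact0 /qf big1// => i _; rewrite big1// => j _; rewrite big1 ?mulr0// => b _; rewrite mulr0.
have xp : 0 < dotv x x by rewrite lt_neqAle eq_sym x0 dotv_ge0.
have [z zS [_ z1 z2]] := SRG_point w x0.
have /notCSet[P PP Pneg] : ~ CSet M Nf (Complex (l * (cre z + a)) (l * cim z)).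
  apply: (gap_notCSet l1 zS); rewrite subrr expr0n addr0 opprD addNKr sqrrN.
  by rewrite -(real_normK (num_real a)) ltr_pXn2r// nnegrE// ltW.
have [_ [tau tau0 tP]] := PiSetP PP.
rewrite -(pmulr_rle0 _ tau0); apply: le_trans (tP w y x) _.
have yx : dotv y x = dotv x x * (l * (cre z + a)).
  by rewrite /y dotv_linl (dotvC (cact _ _)) -z1; ring.
have yy : dotv y y = dotv x x * ((l * (cre z + a)) ^+ 2 + (l * cim z) ^+ 2).
  have e1 : dotv y y = l * dotv (cact (G w) x) y + l * a * dotv x y := dotv_linl _ _ _ _ _.
  have e2 : dotv y (cact (G w) x) = l * dotv (cact (G w) x) (cact (G w) x) +
      l * a * dotv x (cact (G w) x) := dotv_linl _ _ _ _ _.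
  by rewrite e1 (dotvC _ y) e2 (dotvC x y) yx -z1 -z2; ring.
move: Pneg; rewrite yx yy/=; set A := P 0 0; set B := P 0 1; set D := P 1 1.
set u := l * (cre z + a); set v := l * cim z => Pneg.
suff -> : A * (dotv x x * (u ^+ 2 + v ^+ 2)) + 2 * B * (dotv x x * u) + D * dotv x x =
    dotv x x * (A * (u ^+ 2 + v ^+ 2) + 2 * B * u + D) by rewrite pmulr_rle0// ltW.
by ring.
Qed.

(** A graph point in the closed upper half plane, moved up by [r / 2], stays at distance less than
    [r] and leaves the real axis, whence [kap = |x1| / m < 1]. *)
Lemma trap_point (w0 : R) (n0 : (0 < n)%N) : exists m x1 kap : R,
  [/\ 0 < m, 0 <= kap, kap < 1 & `|x1| <= kap * m] /\
  forall e : R, 0 < e <= 1 -> exists A B D : R, A * m ^+ 2 + 2 * B * x1 + D < 0 /\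
    forall w x y, qf M (cact (Nf w) (vstack x y)) <=
      A * e * dotv x x + 2 * B * dotv x y + D / e * dotv y y.
Proof.
pose i0 : bool * 'I_n := (true, Ordinal n0).
have x0 : dotv (fun i => (i == i0)%:R) (fun i => (i == i0)%:R) != 0 :> R.
  apply/eqP => /dotv_eq0 /(congr1 (fun f => f i0)) /eqP.
  by rewrite [_ == _ :> bool * 'I_n]eqxx oner_eq0.
have [z0 z0S [z0i _ _]] := SRG_point w0 x0.
pose x1 := cre z0; pose y1 := cim z0 + r / 2.
have r2 : 0 < r / 2 by rewrite divr_gt0.
have y1p : 0 < y1 by rewrite /y1 ltr_wpDl.
have mm : 0 < x1 ^+ 2 + y1 ^+ 2 by rewrite ltr_wpDl ?sqr_ge0 ?exprn_gt0.
pose m := Num.sqrt (x1 ^+ 2 + y1 ^+ 2).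
have m0 : 0 < m by rewrite sqrtr_gt0.
have m2 : m ^+ 2 = x1 ^+ 2 + y1 ^+ 2 by rewrite sqr_sqrtr ?ltW.
exists m, x1, (`|x1| / m); split; first split => //.
- by rewrite divr_ge0 ?normr_ge0 ?(ltW m0).
- rewrite ltr_pdivrMr// mul1r -(ltr_pXn2r (_ : 0 < 2)%N) ?nnegrE ?normr_ge0 ?(ltW m0)//.
  by rewrite real_normK ?num_real// m2 ltrDl exprn_gt0.
- by rewrite divfK ?gt_eqF.
move=> e /andP[e0 e1]; have l1 : 1 <= e^-1 by rewrite invf_ge1.
have /notCSet[P PP Pneg] : ~ CSet M Nf (Complex (e^-1 * x1) (e^-1 * y1)).
  apply: (gap_notCSet l1 z0S); rewrite subrr expr0n add0r /y1 opprD addNKr sqrrN.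
  by rewrite ltr_pXn2r// ?nnegrE ?ltW// ltr_pdivrMr// ltr_pMr// ltr1n.
have [_ [tau tau0 tP]] := PiSetP PP.
(* The negativity at [z / e] is multiplied by [e / tau] and the domination is divided by [tau];
   these entries express both. *)
exists (P 0 0 / (e * tau)), (P 0 1 / tau), (P 1 1 * e / tau); split.
  move: Pneg => /=; rewrite m2 => Pneg.
  have et : 0 < e / tau by rewrite divr_gt0.
  rewrite -(pmulr_rlt0 _ et) in Pneg; apply: le_lt_trans Pneg.
  rewrite le_eqVlt; apply/orP; left; apply/eqP.
  by field; rewrite !gt_eqF.
move=> w x y; rewrite -(ler_pM2l tau0); apply: le_trans (tP w x y) _.
rewrite le_eqVlt; apply/orP; left; apply/eqP.
by field; rewrite !gt_eqF.
Qed.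

End Gap.
End Multiplier.
End Pointwise.

(** * The form of the IQC *)

Section StorageForm.
Variables (R : realType) (n k : nat).
Local Notation mu := (@lebesgue_measure R).
Local Notation C := (R[i]).
Local Notation V := (L2 (halfline R) 'I_n).
Local Notation nrm := (hnorm (@ip R (halfline R) 'I_n)).
Variables (M : 'M[R]_k) (N : system R (n + n) k) (Nf : R -> 'M[C]_(k, n + n)).
Hypotheses (symM : M^T = M) (mapN : maps_L2 N) (freqN : freq_resp N Nf).

Definition filt (p q : V) := opL2 mapN (stack p q).
Definition sig p q := mform M (filt p q) (filt p q).
Definition suu p := mform M (filt p 0) (filt p 0).
Definition syy q := mform M (filt 0 q) (filt 0 q).
Definition bb p q := mform M (filt p 0) (filt 0 q).

Lemma filt_aeq p p' q q' : aeq p p' -> aeq q q' -> aeq (filt p q) (filt p' q').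
Proof.
move=> h h'; apply: (opL2_aeq mapN freqN).
apply: (ae_mp (ae_and h h')) => t [ht ht'] Dt i /=; rewrite /sstack.
by case: (fintype.split i) => j; [exact: ht|exact: ht'].
Qed.

Lemma filt_lin c p p' q q' : aeq (filt (c *: p + p') (c *: q + q')) (c *: filt p q + filt p' q').
Proof. by rewrite /filt stack_lin; exact: (opL2_lin mapN freqN). Qed.

Lemma filt_split p q : aeq (filt p q) (filt p 0 + filt 0 q).
Proof. by have := filt_lin 1 p 0 0 q; rewrite !scale1r addr0 add0r. Qed.

Lemma sigE p q : sig p q = suu p + 2 * bb p q + syy q.
Proof.
rewrite /sig (mform_aeq M (filt_split p q) (filt_split p q)).
have [Dl Dr _ _] := mform_bilinear M.
by rewrite Dl !Dr (mformC (filt 0 q) (filt p 0) symM) /suu /bb /syy; ring.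
Qed.

Lemma filtZ0 c p p' : aeq (filt (c *: p + p') 0) (c *: filt p 0 + filt p' 0).
Proof. by have := filt_lin c p p' 0 0; rewrite scaler0 addr0. Qed.

Lemma filt0Z c q q' : aeq (filt 0 (c *: q + q')) (c *: filt 0 q + filt 0 q').
Proof. by have := filt_lin c 0 0 q q'; rewrite scaler0 addr0. Qed.

Lemma filt00 : aeq (filt 0 0) 0.
Proof. by have := filt_lin (-1) 0 0 0 0; rewrite !scaleN1r !addNr. Qed.

Lemma mform_lin_aeq (f : V -> L2 (halfline R) 'I_k) :
  aeq (f 0) 0 -> (forall c p p', aeq (f (c *: p + p')) (c *: f p + f p')) ->
  forall z, [/\ forall p p', mform M (f (p + p')) z = mform M (f p) z + mform M (f p') z,
             forall c p, mform M (f (c *: p)) z = c * mform M (f p) z,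
             forall p p', mform M z (f (p + p')) = mform M z (f p) + mform M z (f p') &
             forall c p, mform M z (f (c *: p)) = c * mform M z (f p)].
Proof.
move=> f0 fl z; have [Dl Dr Zl Zr] := mform_bilinear M.
have fD p p' : aeq (f (p + p')) (f p + f p') by have := fl 1 p p'; rewrite !scale1r.
have fZ c p : aeq (f (c *: p)) (c *: f p).
  have := fl c p 0; rewrite addr0 => h; apply: (aeq_trans h).
  rewrite -[X in aeq _ X]addr0; exact: aeqD (aeq_refl _) f0.
split=> [p p'|c p|p p'|c p].
- by rewrite (mform_aeq M (fD p p') (aeq_refl z)) Dl.
- by rewrite (mform_aeq M (fZ c p) (aeq_refl z)) Zl.
- by rewrite (mform_aeq M (aeq_refl z) (fD p p')) Dr.
- by rewrite (mform_aeq M (aeq_refl z) (fZ c p)) Zr.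
Qed.

Lemma bb_bilinear : bilinear_form bb.
Proof.
have h z := mform_lin_aeq (f := fun p => filt p 0) filt00 filtZ0 z.
have h' z := mform_lin_aeq (f := fun p => filt 0 p) filt00 filt0Z z.
split=> [x x' y|x y y'|c x y|c x y]; rewrite /bb.
- by have [-> _ _ _] := h (filt 0 y).
- by have [_ _ -> _] := h' (filt x 0).
- by have [_ -> _ _] := h (filt 0 y).
- by have [_ _ _ ->] := h' (filt x 0).
Qed.

Lemma syyZ c q : syy (c *: q) = c ^+ 2 * syy q.
Proof.
have h z := mform_lin_aeq (f := fun p => filt 0 p) filt00 filt0Z z.
rewrite /syy; have [_ -> _ _] := h (filt 0 (c *: q)); have [_ _ _ ->] := h (filt 0 q).
by rewrite mulrA -expr2.
Qed.

Lemma bb_aeq p p' q q' : aeq p p' -> aeq q q' -> bb p q = bb p' q'.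
Proof. by move=> h h'; apply: mform_aeq; apply: filt_aeq => //; exact: aeq_refl. Qed.

Lemma bb_bounded : exists2 c : R, 0 <= c & forall p q, `|bb p q| <= c * nrm p * nrm q.
Proof.
have [c c0 cP] := mform_bounded M; have [d d0 dP] := opL2_bounded mapN freqN.
exists (c * d * d); first by rewrite !mulr_ge0.
move=> p q; apply: le_trans (cP _ _) _.
have h1 : hnorm (@ip R _ _) (filt p 0) <= d * nrm p by rewrite -(stack_hnorml p); exact: dP.
have h2 : hnorm (@ip R _ _) (filt 0 q) <= d * nrm q by rewrite -(stack_hnormr q); exact: dP.
have -> : c * d * d * nrm p * nrm q = c * (d * nrm p) * (d * nrm q) by ring.
by rewrite ler_pM ?mulr_ge0 ?hnorm_ge0// ler_wpM2l.
Qed.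

Lemma FT_filt p q : {ae mu, forall w, FT (filt p q) w = cact (Nf w) (vstack (FT p w) (FT q w))}.
Proof.
apply: (ae_mp (ae_and (FT_opL2 mapN freqN (stack p q)) (FT_stack p q))) => w [h1 h2].
by apply/funext => bi; rewrite /filt h1 h2.
Qed.

Lemma sig_le (a b c : R) p q :
  (forall w x y, qf M (cact (Nf w) (vstack x y)) <= a * dotv x x + 2 * b * dotv x y + c * dotv y y) ->
  sig p q <= a * ip p p + 2 * b * ip p q + c * ip q q.
Proof.
move=> h; pose P : 'M[R]_2 := \matrix_(i, j) (if i == j then if i == 0 then a else c else b).
have sP : P^T = P by apply/matrixP => i j; rewrite !mxE eq_sym; case: eqP => // ->.
have [Pa Pb Pc] : [/\ P 0 0 = a, P 0 1 = b & P 1 1 = c] by rewrite !mxE.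
rewrite -Pa -Pb -Pc -mform_kron//; apply: mform_le.
apply: (ae_mp (ae_and (FT_filt p q) (FT_stack p q))) => w [-> ->].
by rewrite qf_kron// Pa Pb Pc.
Qed.

Lemma sig_le0 p q : {ae mu, forall w, qf M (cact (Nf w) (vstack (FT p w) (FT q w))) <= 0} -> sig p q <= 0.
Proof.
move=> h; have -> : 0 = mform (0 : 'M[R]_k) (filt p q) (filt p q).
  by rewrite /mform big1// => i _; rewrite big1// => j _; rewrite mxE mul0r.
apply: mform_le; apply: (ae_mp (ae_and h (FT_filt p q))) => w [h1 h2]; rewrite h2.
rewrite [leRHS](_ : _ = 0)//; rewrite /qf big1// => i _; rewrite big1// => j _.
by rewrite mxE mul0r.
Qed.

Section Nonlinearity.
Variable H2 : system R n n.
Hypothesis mapH2 : maps_L2 H2.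
Hypothesis iqc : forall m : R, 0 < m <= 1 -> inc_IQC (fun u => sscale m (H2 u)) M N.

Definition nl (u : V) : V := @MkL2 R (halfline R) 'I_n (H2 u) (mapH2 (l2P u)).

Lemma iqc_sig (m : R) (u v : V) : 0 < m <= 1 -> 0 <= sig (u - v) (m *: (nl u - nl v)).
Proof.
move=> m01; have sP (u' : V) : inL2 (sscale m (H2 u')) by exact: (l2P (m *: nl u')).
have := iqc m01 (l2P u) (sP u) (l2P v) (sP v); rewrite /=.
have -> : sstack (ssub u v) (ssub (sscale m (H2 u)) (sscale m (H2 v))) =
    stack (u - v) (m *: (nl u - nl v)).
  apply/funext => t; apply/funext => i /=; rewrite /sstack; case: (fintype.split i) => j //.
  by rewrite /ssub /sscale mulrBr.
by rewrite (mformE M (filt (u - v) (m *: (nl u - nl v)))) lee_fin.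
Qed.

Let sigm (m : R) p q : sig p (m *: q) = suu p + 2 * m * bb p q + m ^+ 2 * syy q.
Proof. by rewrite sigE syyZ; have [_ _ _ ->] := bb_bilinear; rewrite mulrA. Qed.

Let scal_le (s b y m : R) : 0 < m -> m <= 1 -> 0 <= s + 2 * m * b + m ^+ 2 * y ->
  - s <= (2 * `|b| + `|y|) * m.
Proof.
move=> m0 m1 h.
have h1 : m * b <= m * `|b| by rewrite ler_wpM2l ?ler_norm// ltW.
have h2 : m ^+ 2 * y <= m * `|y|.
  apply: le_trans (_ : m ^+ 2 * `|y| <= _); first by rewrite ler_wpM2l ?ler_norm// sqr_ge0.
  by rewrite ler_wpM2r// expr2 ler_piMl// ltW.
have -> : (2 * `|b| + `|y|) * m = 2 * (m * `|b|) + m * `|y| by ring.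
have E : 2 * m * b = 2 * (m * b) by ring.
rewrite E in h; lra.
Qed.

(** Every [p] is an input increment, namely from the zero signal; the output increment is [m *: q],
    so as [m -> 0] only [suu p] survives. *)
Lemma suu_ge0 p : 0 <= suu p.
Proof.
pose q := nl p - nl 0; rewrite -oppr_le0; apply: (@le_vanish _ _ (2 * `|bb p q| + `|syy q|)).
move=> m /andP[m0 m1]; have m01 : 0 < m <= 1 by rewrite m0.
have := iqc_sig p 0 m01; rewrite subr0 sigm.
rewrite -/q; exact: scal_le.
Qed.

(** Once [suu] drops out the inequality can be divided by [m], and the term in [syy] disappears as
    [m -> 0]. *)
Lemma bb_incr_ge0 u v : suu (u - v) <= 0 -> 0 <= bb (u - v) (nl u - nl v).
Proof.
set p := u - v; set q := nl u - nl v => s0.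
rewrite -oppr_le0; apply: (@le_vanish _ _ `|syy q|) => m /andP[m0 m1].
have m01 : 0 < m <= 1 by rewrite m0.
have h := iqc_sig u v m01; rewrite -/p -/q sigm in h.
have h1 : 0 <= m * (2 * bb p q + m * syy q).
  have -> : m * (2 * bb p q + m * syy q) = 2 * m * bb p q + m ^+ 2 * syy q by ring.
  by lra.
rewrite pmulr_rge0// in h1.
have h2 : m * syy q <= `|syy q| * m by rewrite mulrC ler_wpM2r ?ler_norm// ltW.
have h3 : 0 <= `|syy q| * m by rewrite mulr_ge0// ltW.
lra.
Qed.

Lemma sig_incr_ge0 u v : suu (u - v) <= 0 -> 0 <= 2 * bb (u - v) (nl u - nl v) + syy (nl u - nl v).
Proof.
move=> s0; have := @iqc_sig 1 u v; rewrite ltr01 lexx scale1r sigE => /(_ isT) h.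
by move: s0 h; lra.
Qed.

End Nonlinearity.

Section Plant.
Variables (H1 : system R n n) (G1 : R -> 'M[C]_n) (r : R).
Hypotheses (mapH1 : maps_L2 H1) (freqH1 : freq_resp H1 G1) (r0 : 0 < r).
Hypothesis gap : forall m w : R, 0 < m <= 1 -> dist_ge (SRG (G1 w)) (scale_set m (CSet M Nf)) r.
Hypothesis suu0 : forall p, suu p = 0.
Local Notation op := (opL2 mapH1).

Lemma FT_comb (a b : R) (u v : V) : aeq (FT (a *: u + b *: v)) (a *: FT u + b *: FT v).
Proof.
have h0 : aeq (FT (0 : V)) 0 by have := FT_linear (-1) (0 : V) 0; rewrite !scaleN1r !addNr.
apply: aeq_trans (FT_linear a u (b *: v)) _; apply: aeq_lin; first exact: aeq_refl.
have := FT_linear b v 0; rewrite addr0 => h; apply: (aeq_trans h).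
by rewrite -[X in aeq _ X]addr0; apply: aeq_lin; first exact: aeq_refl.
Qed.

Lemma plant_sig (l a : R) u : 1 <= l -> `|a| < r -> sig (l *: op u + (l * a) *: u) u <= 0.
Proof.
move=> l1 ar; apply: sig_le0.
have := ae_and (FT_comb l (l * a) (op u) u) (FT_opL2 mapH1 freqH1 u) => h.
apply: (ae_mp h) => w [h1 h2].
have -> : FT (l *: op u + (l * a) *: u) w = fun c => l * cact (G1 w) (FT u w) c + l * a * FT u w c.
  by apply/funext => c; rewrite h1// L2DE !L2ZE h2.
exact: (pointwise_neg r0 gap).
Qed.

(** With [suu = 0] the form at [(l (op u + a u), u)] is affine in [l]; being nonpositive for all
    [l >= 1], it has nonpositive slope. *)
Lemma plant_bb (a : R) u : `|a| < r -> bb (op u) u + a * bb u u <= 0.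
Proof.
move=> ar; have [Dl Dr Zl Zr] := bb_bilinear.
set b := bb (op u) u + a * bb u u.
rewrite -[b]mul1r; apply: (@le_vanish _ _ (`|syy u|)) => e /andP[e0 e1].
have l1 : 1 <= e^-1 by rewrite invf_ge1.
have h := plant_sig u l1 ar.
rewrite sigE suu0 add0r Dl !Zl -mulrA -mulrDr -/b in h.
have h1 : e * (2 * (e^-1 * b) + syy u) <= 0 by rewrite pmulr_rle0.
have h2 : 2 * b + e * syy u <= 0.
  by apply: le_trans h1; rewrite le_eqVlt; apply/orP; left; apply/eqP; field; rewrite gt_eqF.
have h3 : - syy u * e <= `|syy u| * e by rewrite ler_wpM2r ?(ltW e0)// -normrN ler_norm.
have h4 : 0 <= `|syy u| * e by rewrite mulr_ge0 ?(ltW e0).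
rewrite mulNr in h3; rewrite mulrC in h2.
lra.
Qed.

(** The shifts [r / 2] and [- (r / 2)], of modulus strictly below [r], cover both signs of
    [bb u u]. *)
Lemma plant_coercive u : (r / 2) * `|bb u u| <= - bb (op u) u.
Proof.
have r20 : 0 < r / 2 by rewrite divr_gt0.
have r2 : r / 2 < r by rewrite ltr_pdivrMr// ltr_pMr// ltr1n.
have h1 := @plant_bb (r / 2) u; rewrite gtr0_norm// in h1.
have h2 := @plant_bb (- (r / 2)) u; rewrite normrN gtr0_norm// in h2.
have := h1 r2; have := h2 r2; rewrite mulNr.
case: (ger0P (bb u u)) => _ k1 k2; lra.
Qed.

End Plant.

Lemma form_trap (G1 : R -> 'M[C]_n) (r : R) : 0 < r -> (0 < n)%N ->
  (forall m w : R, 0 < m <= 1 -> dist_ge (SRG (G1 w)) (scale_set m (CSet M Nf)) r) ->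
  (forall p, 0 <= suu p) ->
  (forall p, suu p = 0) /\
  ((exists2 eta : R, 0 < eta & forall u : V, eta * ip u u <= `|bb u u|) \/
   (forall p q : V, ip p p != 0 -> ip q q != 0 -> bb p q = 0) /\
   (forall q : V, ip q q != 0 -> syy q < 0)).
Proof.
move=> r0 n0 gap s0; have [m [x1 [kap [[m0 kap0 kap1 hx] tr]]]] := trap_point r0 gap 0 n0.
have trap (e : R) : 0 < e <= 1 -> exists A B D : R, A * m ^+ 2 + 2 * B * x1 + D < 0 /\
    forall p q, suu p + 2 * bb p q + syy q <= A * e * ip p p + 2 * B * ip p q + D / e * ip q q.
  move=> /tr[A [B [D [neg le]]]]; exists A, B, D; split=> // p q.
  by rewrite -sigE; exact: sig_le.
have VP := ip_semi_inner (halfline R) 'I_n.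
split; last exact: (trap_dichotomy VP bb_bilinear m0 kap0 kap1 hx s0 syyZ trap).
move=> p; apply/eqP; rewrite eq_le s0 andbT.
exact: (trap_suu_le0 VP bb_bilinear m0 kap0 kap1 hx s0 syyZ trap).
Qed.

End StorageForm.

(** * The closed loop *)

Section Tail.
Variables (R : realType) (I : finType) (T : R).
Hypothesis T0 : 0 < T.
Local Notation mu := (@lebesgue_measure R).
Local Notation V := (L2 (halfline R) I).

Definition tailset : mset R := MSet (@measurable_itv R `]T, +oo[).

Let tail_half : `]T, +oo[ `<=` (`[0%R, +oo[%classic : set R).
Proof. by move=> t /=; rewrite !in_itv/= !andbT => /(lt_trans T0)/ltW. Qed.

Lemma extP (h : L2 tailset I) : inL2on (halfline R) (fun t i => ((h^~ i) \_ `]T, +oo[) t).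
Proof.
move=> i; have [mf fi] := l2P h i.
have mt : measurable (`]T, +oo[%classic : set R) by exact: measurable_itv.
have mh : measurable (`[0%R, +oo[%classic : set R) by exact: measurable_itv.
split.
  apply: measurable_funTS; exact/(measurable_restrictT _ mt).
have -> : (\int[mu]_(t in halfline R) ((((h^~ i) \_ `]T, +oo[) t) ^+ 2)%:E =
    \int[mu]_(t in tailset) ((h t i) ^+ 2)%:E)%E.
  rewrite integral_mkcond [RHS]integral_mkcond; apply: eq_integral => t _.
  rewrite /patch !mem_setE; case: ifPn => [t0|t0]; case: ifPn => tT //.
    by rewrite expr0n.
  by have := tail_half tT; rewrite /= (negbTE t0).
exact: fi.
Qed.

Definition ext (h : L2 tailset I) : V := MkL2 (extP h).

Lemma extE h t i : ext h t i = if t <= T then 0 else h t i.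
Proof. by rewrite /= /patch mem_setE in_itv/= andbT ltNge; case: (t <= T). Qed.

Lemma ext_lin c h h' : ext (c *: h + h') = c *: ext h + ext h'.
Proof.
apply: L2_eq => t i; rewrite L2DE L2ZE !extE; case: ifP => // _.
by rewrite mulr0 addr0.
Qed.

Lemma ip_ext h h' : ip (ext h) (ext h') = ip h h'.
Proof.
rewrite /ip Rintegral_mkcond [RHS]Rintegral_mkcond; apply: eq_Rintegral => t _.
rewrite /patch !mem_setE; case: ifPn => [t0|t0]; case: ifPn => tT //.
- apply: eq_bigr => i _; rewrite !extE.
  by move: tT; rewrite in_itv/= andbT ltNge => /negbTE ->.
- rewrite /dot big1// => i _; rewrite !extE.
  by move: tT; rewrite in_itv/= andbT -leNgt => ->; rewrite mul0r.
- by have := tail_half tT; rewrite /= (negbTE t0).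
Qed.

Definition res (u : V) : L2 tailset I.
Proof.
refine (@MkL2 R tailset I u (fun i => _)).
by apply: sqint_subset (l2P u i) => //; exact: measurable_itv.
Defined.

End Tail.

Definition sigL2 (R : realType) n (u : signal R n) (hu : inL2 u) : L2 (halfline R) 'I_n :=
  @MkL2 R (halfline R) 'I_n u hu.

Section ClosedLoop.
Variables (R : realType) (n k : nat).
Local Notation C := (R[i]).
Local Notation V := (L2 (halfline R) 'I_n).
Local Notation nrm := (hnorm (@ip R (halfline R) 'I_n)).
Variables (H1 : system R n n) (G1 : R -> 'M[C]_n) (H2 : system R n n).
Variables (M : 'M[R]_k) (N : system R (n + n) k) (Nf : R -> 'M[C]_(k, n + n)) (r : R).
Hypotheses (n0 : (0 < n)%N) (r0 : 0 < r).
Hypotheses (causalH1 : causal H1) (mapH1 : maps_L2 H1) (freqH1 : freq_resp H1 G1).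
Hypotheses (causalH2 : causal H2) (mapH2 : maps_L2 H2).
Hypotheses (symM : M^T = M) (mapN : maps_L2 N) (freqN : freq_resp N Nf).
Hypothesis iqc : forall m : R, 0 < m <= 1 -> inc_IQC (fun u => sscale m (H2 u)) M N.
Hypothesis gap : forall m w : R, 0 < m <= 1 -> dist_ge (SRG (G1 w)) (scale_set m (CSet M Nf)) r.

Local Notation op := (opL2 mapH1).
Local Notation nl := (nl mapH2).
Local Notation b := (bb M mapN).

Let VP := ip_semi_inner (halfline R) 'I_n.
Let bP : bilinear_form b := bb_bilinear M mapN freqN.

Lemma tail_equation (T c0 : R) (T0 : 0 < T) (d : V) : 0 < c0 ->
  (forall u : V, c0 * ip u u <= - b (op u) u) ->
  exists g : L2 (tailset T) 'I_n, forall h, b (op (d + ext T0 g)) (ext T0 h) = 0.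
Proof.
move=> c00 coer; have [Dl Dr Zl Zr] := bP.
have [cb cb0 cbP] := bb_bounded M mapN freqN.
have [c1 c10 c1P] := opL2_bounded mapH1 freqH1.
pose W := L2 (tailset T) 'I_n; pose E := ext T0 : W -> V.
have WP := ip_semi_inner (tailset T) 'I_n.
have nE (h : W) : nrm (E h) = hnorm (@ip R _ _) h by congr Num.sqrt; exact: ip_ext.
have ED h h' : E (h + h') = E h + E h' by have := ext_lin T0 1 h h'; rewrite !scale1r.
have E0 : E 0 = 0 by apply: L2_eq => t i; rewrite extE if_same.
have EZ c h : E (c *: h) = c *: E h by have := ext_lin T0 c h 0; rewrite addr0 -/E E0 addr0.
have opD u u' : aeq (op (u + u')) (op u + op u') by have := opL2_lin mapH1 freqH1 1 u u'; rewrite !scale1r.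
have opZ c u : aeq (op (c *: u)) (c *: op u).
  have := opL2_lin mapH1 freqH1 c u 0; rewrite addr0 => h; apply: (aeq_trans h).
  rewrite -[X in aeq _ X]addr0; exact: aeqD (aeq_refl _) (opL2_0 mapH1 freqH1).
have bo u v : `|b (op u) v| <= cb * c1 * nrm u * nrm v.
  apply: le_trans (cbP _ _) _; rewrite ler_wpM2r ?hnorm_ge0// -mulrA ler_wpM2l//.
have bl u u' v : aeq u u' -> b u v = b u' v by move=> h; apply: (bb_aeq M mapN freqN h); exact: aeq_refl.
(* The minus sign makes the form coercive; the data is the response to [d], so the response to the
   solution cancels it against all signals supported after [T]. *)
have [|||||||g gP] := @lax_milgram R W (@ip R _ _) WP (@L2_complete _ _ _)
  (fun x y => - b (op (E x)) (E y)) (fun y => b (op d) (E y)) (cb * c1) c0.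
- split=> [x x' y|x y y'|c x y|c x y].
  + by rewrite ED (bl _ _ _ (opD _ _)) Dl opprD.
  + by rewrite ED Dr opprD.
  + by rewrite EZ (bl _ _ _ (opZ _ _)) Zl mulrN.
  + by rewrite EZ Zr mulrN.
- by move=> x y; rewrite normrN -!nE.
- exact: c00.
- by move=> x; rewrite -(ip_ext T0); exact: coer.
- by move=> x y; rewrite ED Dr.
- by move=> c x; rewrite EZ Zr.
- exists (cb * c1 * nrm d) => x; rewrite -nE; exact: bo.
exists g => h; rewrite (bl _ _ _ (opD _ _)) Dl -/E -(gP h) addNr.
by [].
Qed.

(** The loop signal [u1] is not known to be square integrable; by causality any square-integrable
    [x] that agrees with it on [[0, T]] reproduces the loop there. *)
Lemma loop_local (T : R) (w u1 : signal R n) (x : V) :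
  sigeq u1 (sadd w (H2 (H1 u1))) -> (forall t, 0 <= t <= T -> x t = u1 t) ->
  forall t, 0 <= t <= T -> forall i, nl (op x) t i = u1 t i - w t i.
Proof.
move=> eu xu t tT i; have /andP[t0 _] := tT.
have -> : nl (op x) t = H2 (H1 u1) t.
  by apply: (causalH2 (T := T)) tT => s sT; exact: (causalH1 (T := T)) sT.
by rewrite (eu t t0) /sadd addrAC subrr add0r.
Qed.


Lemma truncated_estimate : exists2 gamma : R, 0 <= gamma &
  forall (T : R) (w v u1 v1 : signal R n) (hw : inL2 w) (hv : inL2 v) (hu : inL2e u1) (hv1 : inL2e v1),
  0 < T -> sigeq u1 (sadd w (H2 (H1 u1))) -> sigeq v1 (sadd v (H2 (H1 v1))) ->
  nrm (sigL2 (hu T) - sigL2 (hv1 T)) <= gamma * nrm (sigL2 hw - sigL2 hv).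
Proof.
have [Dl Dr Zl Zr] := bP.
have [suu0 dich] := form_trap symM freqN r0 n0 gap (suu_ge0 symM mapN freqN mapH2 iqc).
have s0 p : suu M mapN p <= 0 by rewrite suu0.
have trE (T : R) (u : signal R n) (hu : inL2e u) t : 0 <= t <= T -> sigL2 (hu T) t = u t.
  by move=> /andP[_ tT]; apply/funext => i /=; rewrite /trunc tT.
have tr0 (T : R) (u : signal R n) (hu : inL2e u) t i : T < t -> sigL2 (hu T) t i = 0.
  by move=> Tt; rewrite /= /trunc leNgt Tt.
(* In the degenerate branch the IQC at gain 1 reads [0 <= syy q] for the output increment [q] of
   [H2], which is therefore null. The loop signals then differ by [w - v] on [[0, T]], and the bound
   holds with constant 1. *)
case: dich => [[eta eta0 etaP]|[b0 syy0]]; last first.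
  exists 1 => // T w v u1 v1 hw hv hu hv1 T0 eu ev.
  set x1 := sigL2 (hu T); set x2 := sigL2 (hv1 T).
  set q := nl (op x1) - nl (op x2).
  have q0 : ip q q = 0.
    apply/eqP/negPn/negP => qn.
    have := sig_incr_ge0 symM freqN mapH2 iqc (s0 (op x1 - op x2)); rewrite -/q.
    have -> : b (op x1 - op x2) q = 0.
      have [pn|pn] := eqVneq (ip (op x1 - op x2) (op x1 - op x2)) 0; last exact: b0.
      have [cb cb0 cbP] := bb_bounded M mapN freqN.
      have := cbP (op x1 - op x2) q; rewrite (hnorm_eq0 pn) mulr0 mul0r normr_le0.
      by move/eqP.
    by rewrite mulr0 add0r leNgt syy0.
  rewrite mul1r /hnorm ler_wsqrtr//; apply: le_ip_ae.
  apply: (ae_mp (ip_ae0 q0)) => t qt t0; apply: ler_sum => i _.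
  have t0' : 0 <= t by move: t0; rewrite /= in_itv/= andbT.
  have [tT|Tt] := leP t T; last first.
    by rewrite L2BE !tr0// subrr mul0r -expr2 sqr_ge0.
  have tT' : 0 <= t <= T by rewrite t0'.
  have e : u1 t i - w t i - (v1 t i - v t i) = 0.
    rewrite -(loop_local eu (trE T u1 hu) tT') -(loop_local ev (trE T v1 hv1) tT').
    exact: (qt t0 i).
  have {}e : x1 t i - x2 t i = w t i - v t i.
    by rewrite [x1 t](trE T u1 hu t tT') [x2 t](trE T v1 hv1 t tT'); lra.
  suff : (x1 t i - x2 t i) * (x1 t i - x2 t i) <= (w t i - v t i) * (w t i - v t i) by [].
  by rewrite e.
have c00 : 0 < r / 2 * eta by rewrite !mulr_gt0.
have coer (u : V) : r / 2 * eta * ip u u <= - b (op u) u.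
  apply: le_trans (plant_coercive symM freqN mapH1 freqH1 r0 gap suu0 u).
  by rewrite -mulrA ler_wpM2l// divr_ge0 ?ltW.
set c0 := r / 2 * eta in c00 coer.
have [cb cb0 cbP] := bb_bounded M mapN freqN.
have [c1 c10 c1P] := opL2_bounded mapH1 freqH1.
exists (cb * c1 / c0); first by rewrite divr_ge0 ?mulr_ge0// ltW.
move=> T w v u1 v1 hw hv hu hv1 T0 eu ev.
set d1 := sigL2 (hu T); set d2 := sigL2 (hv1 T).
set dw := sigL2 hw - sigL2 hv.
have [g gP] := tail_equation T0 (d1 - d2) c00 coer.
set e := d1 - d2 + ext T0 g in gP.
(* Only the first signal is continued past [T], the second stays cut off; the inputs of [H1] then
   differ by [e]. *)
set x1 := d1 + ext T0 g.
have x1E t : 0 <= t <= T -> x1 t = u1 t.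
  move=> tT; rewrite -(trE T u1 hu)//; apply/funext => i; rewrite L2DE extE.
  by case/andP: tT => _ ->; rewrite addr0.
(* Target: [c0 |e| ^ 2 <= - b (op e) (truncL2 T dw) <= cb c1 |e| |dw|], in which no constant depends
   on [T]. *)
set q := nl (op x1) - nl (op d2).
have bq : 0 <= b (op x1 - op d2) q := bb_incr_ge0 symM freqN mapH2 iqc (s0 _).
have pE : aeq (op x1 - op d2) (op e).
  have := opL2_lin mapH1 freqH1 (-1) d2 x1; rewrite !scaleN1r addrC.
  have -> : x1 - d2 = e by rewrite /x1 /e addrAC.
  by rewrite [- op d2 + _]addrC => h; exact: aeq_sym h.
(* After [T] the increment [q] is unknown; [res] records it as a signal supported there, which [gP]
   annihilates. *)
have qE : aeq q (d1 - d2 - truncL2 T dw + ext T0 (res T0 q)).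
  apply: aeW => t t0 i.
  have t0' : 0 <= t by move: t0; rewrite /= in_itv/= andbT.
  have -> : (d1 - d2 - truncL2 T dw + ext T0 (res T0 q)) t i =
    d1 t i - d2 t i - (if t <= T then w t i - v t i else 0) + ext T0 (res T0 q) t i by [].
  rewrite extE; have [tT|Tt] := leP t T; last by rewrite /d1 /d2 !tr0// !subr0 add0r.
  have tT' : 0 <= t <= T by rewrite t0'.
  have -> : q t i = u1 t i - w t i - (v1 t i - v t i).
    by rewrite -(loop_local eu x1E tT') -(loop_local ev (trE T v1 hv1) tT').
  by rewrite /d1 /d2 !trE//; ring.
rewrite (bb_aeq M mapN freqN pE qE) in bq.
have bN p q' : b p (- q') = - b p q' by rewrite -scaleN1r Zr mulN1r.
(* Since [gP] removes whatever is supported after [T], [d1 - d2] may be completed to [e] in the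
   second argument, where coercivity applies. *)
have {}bq : 0 <= b (op e) e - b (op e) (truncL2 T dw).
  have h : b (op e) e = b (op e) (d1 - d2) by rewrite {2}/e Dr gP addr0.
  by rewrite h; move: bq; rewrite !Dr gP addr0 !bN.
have eb : c0 * nrm e ^+ 2 <= cb * c1 * nrm e * nrm dw.
  rewrite (sqr_hnorm VP); apply: le_trans (coer e) _.
  apply: le_trans (_ : `|b (op e) (truncL2 T dw)| <= _).
    by apply: le_trans (_ : - b (op e) (truncL2 T dw) <= _); [lra|rewrite -normrN ler_norm].
  apply: le_trans (cbP _ _) _; apply: ler_pM; rewrite ?mulr_ge0 ?hnorm_ge0//.
    by rewrite -mulrA ler_wpM2l.
  by rewrite /hnorm ler_wsqrtr// ip_trunc_le.
(* The signals [d1 - d2] and [ext T0 g] have disjoint supports. *)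
have ed : nrm (d1 - d2) <= nrm e.
  rewrite /hnorm ler_wsqrtr//; apply: le_ip_ae; apply: aeW => t _; apply: ler_sum => i _.
  have -> : e t i = d1 t i - d2 t i + ext T0 g t i by [].
  rewrite -/((d1 - d2) t i) extE; have [tT|Tt] := leP t T; first by rewrite addr0.
  have -> : (d1 - d2) t i = 0 by rewrite L2BE /d1 /d2 !tr0// subrr.
  by rewrite mul0r -expr2 sqr_ge0.
apply: le_trans ed _; rewrite mulrAC ler_pdivlMr// mulrC.
have := hnorm_ge0 (@ip R _ _) e; rewrite le_eqVlt => /orP[/eqP <-|e0].
  by rewrite mulr0 !mulr_ge0 ?hnorm_ge0.
by rewrite -(ler_pM2r e0) -mulrA -expr2 (mulrAC _ (nrm dw)).
Qed.

Lemma L2normE (u : signal R n) (hu : inL2 u) : L2norm u = nrm (sigL2 hu).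
Proof.
rewrite /L2norm /hnorm ip_comp1; congr Num.sqrt; apply: eq_bigr => i _.
by congr fine; apply: eq_integral => t _; rewrite dot_unit/= expr2.
Qed.

(** The outputs [H1 u1] and [H1 v1] are not known to be square integrable one by one. Their
    difference is the pointwise limit of the truncations [y j], which are uniformly bounded, and
    Fatou puts it in [L2]. *)
Lemma closed_loop_gain : exists gamma : R, forall w v u1 v1 : signal R n,
  inL2 w -> inL2 v -> inL2e u1 -> inL2e v1 ->
  sigeq u1 (sadd w (H2 (H1 u1))) -> sigeq v1 (sadd v (H2 (H1 v1))) ->
  inL2 (ssub (H1 u1) (H1 v1)) /\
  L2norm (ssub (H1 u1) (H1 v1)) <= gamma * L2norm (ssub w v).
Proof.
have [gamma gamma0 est] := truncated_estimate.
have [c1 c10 c1P] := opL2_bounded mapH1 freqH1.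
exists (c1 * gamma) => w v u1 v1 hw hv hu hv1 eu ev.
set f := ssub (H1 u1) (H1 v1).
set dw := sigL2 hw - sigL2 hv.
pose T (j : nat) : R := j.+1%:R.
(* The loop signals are cut off before [H1] so that the bound on [op] applies; the output is cut off
   again, at the time up to which causality identifies it with [f]. *)
pose y j := truncL2 (T j) (op (sigL2 (hu (T j))) - op (sigL2 (hv1 (T j)))).
have yE j t i : 0 <= t -> y j t i = if t <= T j then f t i else 0.
  move=> t0; rewrite /=; case: ifP => // tT; have tT' : 0 <= t <= T j by rewrite t0.
  have trH u : H1 (trunc (T j) u) t = H1 u t.
    apply: (causalH1 (T := T j)) tT' => s /andP[_ sT]; apply/funext => l.
    by rewrite /trunc sT.
  by rewrite !trH.
have cvy t i : 0 <= t -> y j t i @[j --> \oo] --> f t i.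
  move=> t0; apply: cvg_near_cst; near=> j; rewrite yE// ifT//.
  rewrite (@le_trans _ _ j%:R) ?ler_nat//; near: j; exact: nbhs_infty_ger.
have yn j : ip (y j) (y j) <= (c1 * gamma * nrm dw) ^+ 2.
  apply: le_trans (ip_trunc_le _ _) _; rewrite -(sqr_hnorm VP) ler_pXn2r ?nnegrE ?hnorm_ge0 ?mulr_ge0 ?hnorm_ge0//.
  have := aeq_hnorm (opL2_lin mapH1 freqH1 (-1) (sigL2 (hv1 (T j))) (sigL2 (hu (T j)))).
  rewrite !scaleN1r ![- _ + _]addrC => <-; apply: le_trans (c1P _) _.
  by rewrite -mulrA ler_wpM2l//; exact: est.
have halfP (t : R) : mset_set (halfline R) t -> 0 <= t by rewrite /= in_itv/= andbT.
have [||F FE Fn] := @L2_fatou R (halfline R) 'I_n y f _ _ _ yn.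
- move=> i; apply: (@measurable_fun_cvg _ _ _ _ (fun j t => y j t i)).
    by move=> j; exact: (l2P (y j) i).1.
  by move=> t /halfP t0; exact: cvy.
- by apply: aeW => t /halfP t0 i; exact: cvy.
have hf : inL2 f by rewrite -FE; exact: (l2P F).
split=> //; have hwv : inL2 (ssub w v) by exact: (l2P dw).
rewrite (L2normE hf) (L2normE hwv).
have -> : sigL2 hf = F by apply: L2_eq => t i; rewrite FE.
have -> : sigL2 hwv = dw by exact: L2_eq.
by rewrite -(ler_pXn2r (_ : 0 < 2)%N) ?nnegrE ?hnorm_ge0 ?mulr_ge0 ?hnorm_ge0// (sqr_hnorm VP).
Unshelve. all: by end_near. Qed.

End ClosedLoop.

Theorem theorem3 (R : realType) (n k : nat)
  (H1 : system R n n) (G1 : R -> 'M[R[i]]_n)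
  (H2 : system R n n)
  (M : 'M[R]_k) (N : system R (n + n) k) (Nf : R -> 'M[R[i]]_(k, n + n)) :
  causal_LTI H1 G1 ->
  causal H2 -> maps_L2 H2 ->
  M^T = M ->
  causal_LTI N Nf -> bounded N ->
  (forall m : R, 0 < m <= 1 ->
     wellposed H1 H2 m /\ inc_IQC (fun u => sscale m (H2 u)) M N) ->
  (exists r : R, 0 < r /\ forall (m w : R), 0 < m <= 1 ->
     dist_ge (SRG (G1 w)) (scale_set m (CSet M Nf)) r) ->
  (* the closed loop map T : w |-> y1 = H1 u1 (mu = 1) has finite incremental gain *)
  exists gamma : R, forall (w v u1 v1 : signal R n),
    inL2 w -> inL2 v -> inL2e u1 -> inL2e v1 ->
    sigeq u1 (sadd w (H2 (H1 u1))) -> sigeq v1 (sadd v (H2 (H1 v1))) ->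
    inL2 (ssub (H1 u1) (H1 v1)) /\
    L2norm (ssub (H1 u1) (H1 v1)) <= gamma * L2norm (ssub w v).
Proof.
move=> [cH1 [mH1 fH1]] cH2 mH2 sM [_ [mN fN]] _ wiqc [r [r0 gap]].
have iqc m : 0 < m <= 1 -> inc_IQC (fun u => sscale m (H2 u)) M N by move=> /wiqc[].
(* In dimension 0 the scaled relative graph is empty and the gap says nothing, but all norms
   vanish. *)
have [n0|n0] := posnP n; last exact: (closed_loop_gain n0 r0 cH1 mH1 fH1 cH2 mH2 sM mN fN iqc gap).
subst n; exists 0 => w v u1 v1 _ _ _ _ _ _; split; first by case.
by rewrite /L2norm big_ord0 sqrtr0 mul0r.
Qed.
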